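(* Let $G = \langle A * B;\ H\rangle$ be the generalized free product of groups $A$ and $B$ with amalgamated subgroup $H$, and let $\mathfrak{P}$ be a set of primes such that $G$ and $\mathfrak{P}$ satisfy Condition $( * )$. Let $\tau A$ and $\tau B$ be the sets of all elements of finite order of $A$ and $B$, respectively. Suppose that $H$ is periodic and that there exist homomorphisms of $A$ and of $B$ that map them onto $\mathcal{BN}_{\mathfrak{P}}$-groups and act injectively on the subgroups $\operatorname{sgp}\{\tau A\}$ and $\operatorname{sgp}\{\tau B\}$, respectively. Then, for each $p \in \mathfrak{P}$, the sets $A(p) = p\text{-}\mathfrak{Rt}(A,1)$ and $B(p) = p\text{-}\mathfrak{Rt}(B,1)$ are finite normal subgroups of $A$ and $B$, respectively, and $H$ is $\mathcal{FN}_{\mathfrak{P}}$-separable in $A$ and in $B$. For $p\in\mathfrak{P}$, let $\mathrm{N}(p)$ denote the following condition: the groups $A(p)$ and $B(p)$ have normal series $$1 = A_{0} \leqslant A_{1} \leqslant \ldots \leqslant A_{k} = A(p)\quad\text{and}\quad 1 = B_{0} \leqslant B_{1} \leqslant \ldots \leqslant B_{m} = B(p)$$ with factors of order $p$ such that, for all $i \in \{0,1,\ldots,k\}$ and $j \in \{0,1,\ldots,m\}$: $A_{i}$ is a normal subgroup of $A$; $B_{j}$ is a normal subgroup of $B$; and $\{A_{i} \cap H \mid 0 \leqslant i \leqslant k\} = \{B_{j} \cap H \mid 0 \leqslant j \leqslant m\}$. Then the following statements hold. 1. The group $G$ is residually an $\mathcal{FN}_{\mathfrak{P}}$-group if $H$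 is $\mathcal{F}_{q}$-separable in $A$ and in $B$ for some $q \in \mathfrak{P}$ and, for every $p \in \mathfrak{P}$, condition $\mathrm{N}(p)$ holds. 2. If $G$ is residually an $\mathcal{FN}_{\mathfrak{P}}$-group, then $H$ is $q'$-isolated in $A$ and in $B$ for some $q \in \mathfrak{P}$ and, for every $p \in \mathfrak{P}$, condition $\mathrm{N}(p)$ holds. 3. The group $G$ is residually a $\Phi\cdot\mathcal{FN}_{\mathfrak{P}}$-group and, for each prime $q$, residually an $\mathcal{F}_{q}\cdot\mathcal{FN}_{\mathfrak{P}}$-group if and only if, for every $p \in \mathfrak{P}$, condition $\mathrm{N}(p)$ holds.
   Context: $G=\langle A*B;\ H\rangle$ means that $G$ is the generalized (amalgamated) free product of $A$ and $B$ with amalgamated subgroup $H$; $A$ and $B$ are regarded as subgroups of $G$, with $A\cap B=H$. $\operatorname{sgp}\{S\}$ is the subgroup generated by the set $S$. For a set of primes $\mathfrak{P}$, a $\mathfrak{P}$-number is an integer all of whose prime divisors lie in $\mathfrak{P}$, and a $\mathfrak{P}$-group is a periodic group all of whose element orders are $\mathfrak{P}$-numbers. $\Phi$, $\mathcal{FN}_{\mathfrak{P}}$, $\mathcal{F}_p$ are the classes of free groups, finite nilpotent $\mathfrak{P}$-groups and finite $p$-groups. For classes $\mathcal{C},\mathcal{D}$, $\mathcal{C}\cdot\mathcal{D}$ is the class of all extensions of a $\mathcal{C}$-group by a $\mathcal{D}$-group (groups having a normal subgroup in $\mathcal{C}$ with quotient in $\mathcal{D}$). A group $X$ is residually a $\mathcal{C}$-group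 if for every $x\in X\setminus\{1\}$ there is a homomorphism $\sigma$ of $X$ onto a group from $\mathcal{C}$ with $x\sigma\neq1$. A subgroup $Y\leqslant X$ is $\mathcal{C}$-separable in $X$ if for every $x\in X\setminus Y$ there is a homomorphism $\sigma$ of $X$ onto a group from $\mathcal{C}$ with $x\sigma\notin Y\sigma$. For a prime $q$, a subgroup $Y\leqslant X$ is $q'$-isolated in $X$ if for every prime $r\neq q$ and every $x\in X$, $x^r\in Y$ implies $x\in Y$. For a prime $p$, $p\text{-}\mathfrak{Rt}(X,1)$ is the set of $x\in X$ such that $x^n=1$ for some power $n$ of $p$. An abelian group is $\mathfrak{P}$-bounded if in each of its quotient groups, for every $p\in\mathfrak{P}$, the $p$-primary component of the periodic part is finite. A nilpotent group is $\mathfrak{P}$-bounded if it has a finite central series with $\mathfrak{P}$-bounded abelian factors; $\mathcal{BN}_{\mathfrak{P}}$ is the class of $\mathfrak{P}$-bounded nilpotent groups. $G=\langle A*B;\ H\rangle$ and $\mathfrak{P}$ satisfy Condition $( * )$ if: (i) $A\neq H\neq B$; (ii) $\mathfrak{P}$ is non-empty; (iii) $A$ and $B$ are residually $\mathcal{FN}_{\mathfrak{P}}$-groups; (iv) there exist homomorphisms of $A$ and of $B$ mapping them onto $\mathcal{BN}_{\mathfrak{P}}$-groups and acting injectively on $H$. *)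

(* Defs.v *)
From HB Require Import structures.
From mathcomp Require Import all_boot.
From mathcomp Require Import boolp classical_sets functions cardinality.
Set Implicit Arguments.
Unset Strict Implicit.
Unset Printing Implicit Defensive.
Local Open Scope classical_set_scope.
Local Open Scope group_scope.

(* [groupType] is the type of all (possibly infinite) groups.  Its choiceType
   layer is no restriction, since every type carries one classically. *)
Definition group_class := groupType -> Prop.

Section OneGroup.
Variable X : groupType.
Implicit Types (Y N : set X) (p q : nat) (pi : nat_pred).

Definition subgroup Y : Prop := group_closed [in Y].

Definition normal_subgroup N : Prop :=
  subgroup N /\ forall x y : X, N y -> N (y ^ x).

Definition sgp (S : set X) : set X := smallest subgroup S.

Definition has_order (x : X) (n : nat) : Prop :=
  [/\ (0 < n)%N, x ^+ n = 1 &
      forall m, (0 < m)%N -> x ^+ m = 1 -> (n <= m)%N].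

Definition torsion : set X := [set x | exists n, has_order x n].

Definition periodic : Prop := forall x : X, torsion x.

Definition pi_group pi : Prop :=
  periodic /\ forall (x : X) n, has_order x n -> pi.-nat n.

Definition pRt p : set X := [set x | exists k, x ^+ (p ^ k)%N = 1].

Definition isolated' q Y : Prop :=
  forall r, prime r -> r <> q -> forall x : X, Y (x ^+ r) -> Y x.

Definition abelian_group : Prop := forall x y : X, commute x y.

Definition finite_group : Prop := finite_set [set: X].

(* Only the terms of index at most [n] matter. *)
Definition central_series (n : nat) (Z : nat -> set X) : Prop :=
  [/\ Z 0 = [set 1], Z n = [set: X],
      forall i, (i <= n)%N -> normal_subgroup (Z i),
      forall i, (i < n)%N -> Z i `<=` Z i.+1 &
      forall i, (i < n)%N -> forall x y : X, Z i.+1 x -> Z i [~ x, y]].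

Definition nilpotent_group : Prop := exists n Z, central_series n Z.

End OneGroup.

Arguments sgp {X} S.
Arguments torsion X : clear implicits.
Arguments periodic X : clear implicits.
Arguments pi_group X pi : clear implicits.
Arguments pRt X p : clear implicits.
Arguments abelian_group X : clear implicits.
Arguments finite_group X : clear implicits.
Arguments nilpotent_group X : clear implicits.

Definition onto (X K : groupType) (f : {multiplicative X -> K}) : Prop :=
  set_surj [set: X] [set: K] f.

Definition ker (X K : groupType) (f : {multiplicative X -> K}) : set X :=
  f @^-1` [set 1].

(* [Q] is isomorphic to the factor group [Y / N] of subgroups [N <= Y] of [X];
   [S] is a copy of [Y] embedded in [X] by [i]. *)
Definition is_factor (X : groupType) (Y N : set X) (Q : groupType) : Prop :=
  N `<=` Y /\
  exists (S : groupType) (i : {multiplicative S -> X})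
         (f : {multiplicative S -> Q}),
    [/\ injective i, range i = Y, onto f & ker f = i @^-1` N].

Definition residually (C : group_class) (X : groupType) : Prop :=
  forall x : X, x <> 1 ->
  exists (K : groupType) (s : {multiplicative X -> K}),
    [/\ C K, onto s & s x <> 1].

Definition separable (C : group_class) (X : groupType) (Y : set X) : Prop :=
  forall x : X, ~ Y x ->
  exists (K : groupType) (s : {multiplicative X -> K}),
    [/\ C K, onto s & ~ (s @` Y) (s x)].

(* Some homomorphism of [X] onto a [C]-group is injective on [Y]. *)
Definition onto_injective_on (C : group_class) (X : groupType) (Y : set X)
    : Prop :=
  exists (K : groupType) (s : {multiplicative X -> K}),
    [/\ C K, onto s & set_inj Y s].

(* The class of extensions of a [C]-group by a [D]-group. *)
Definition extension (C D : group_class) : group_class := fun X =>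
  exists (K Q : groupType) (i : {multiplicative K -> X})
         (f : {multiplicative X -> Q}),
    [/\ injective i, onto f, range i = ker f, C K & D Q].

(* [S] is a basis; only the values of [f] on [S] matter. *)
Definition free_group : group_class := fun X =>
  exists S : set X, forall (K : groupType) (f : X -> K),
  exists h : {multiplicative X -> K},
    {in S, h =1 f} /\
    forall h' : {multiplicative X -> K}, {in S, h' =1 f} -> h' =1 h.

Definition fin_p_group (p : nat) : group_class := fun X =>
  finite_group X /\ pi_group X p.

Definition fin_nilpotent_pi_group (P : nat_pred) : group_class := fun X =>
  [/\ finite_group X, nilpotent_group X & pi_group X P].

(* The quotients of [X] are its homomorphic images [Q], and the p-primary
   component of the periodic part of the abelian group [Q] is [pRt Q p]. *)
Definition bounded_abelian (P : nat_pred) : group_class := fun X =>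
  abelian_group X /\
  forall (Q : groupType) (f : {multiplicative X -> Q}), onto f ->
  forall p, p \in P -> finite_set (pRt Q p).

Definition bounded_nilpotent (P : nat_pred) : group_class := fun X =>
  exists n (Z : nat -> set X), central_series n Z /\
    forall i, (i < n)%N ->
    exists Q : groupType, is_factor (Z i.+1) (Z i) Q /\ bounded_abelian P Q.

Section Amalgam.
Variables (H A B G : groupType).
Variables (iA : {multiplicative H -> A}) (iB : {multiplicative H -> B}).
Variables (jA : {multiplicative A -> G}) (jB : {multiplicative B -> G}).

(* [G] is the generalized free product of [A] and [B] amalgamating the
   subgroups [iA(H)] of [A] and [iB(H)] of [B], i.e. the pushout of the
   embeddings [iA] and [iB]; then [jA] and [jB] are injective and
   [jA(A)] meets [jB(B)] in the common image of [H]. *)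
Definition is_amalgam : Prop :=
  [/\ injective iA, injective iB, jA \o iA =1 jB \o iB &
      forall (K : groupType)
        (f : {multiplicative A -> K}) (g : {multiplicative B -> K}),
      f \o iA =1 g \o iB ->
      exists u : {multiplicative G -> K},
        [/\ u \o jA =1 f, u \o jB =1 g &
            forall u' : {multiplicative G -> K},
              u' \o jA =1 f -> u' \o jB =1 g -> u' =1 u]].

Definition condition_star (P : nat_pred) : Prop :=
  [/\ range iA <> [set: A] /\ range iB <> [set: B],
      exists p, p \in P,
      residually (fin_nilpotent_pi_group P) A /\
      residually (fin_nilpotent_pi_group P) B &
      onto_injective_on (bounded_nilpotent P) (range iA) /\
      onto_injective_on (bounded_nilpotent P) (range iB)].

End Amalgam.

(* The first [n.+1] terms of [S] are normal subgroups of [X] increasing from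
   the trivial subgroup to [Y], with successive factors of order [p]. *)
Definition normal_p_series (X : groupType) (p : nat) (Y : set X)
    (n : nat) (S : nat -> set X) : Prop :=
  [/\ S 0 = [set 1], S n = Y,
      forall i, (i <= n)%N -> normal_subgroup (S i) &
      forall i, (i < n)%N ->
      exists Q : groupType, is_factor (S i.+1) (S i) Q /\ ([set: Q] #= `I_p)%card].

(* The intersections with [H] are compared as subsets of [H]. *)
Definition condition_N (H A B : groupType)
    (iA : {multiplicative H -> A}) (iB : {multiplicative H -> B})
    (p : nat) : Prop :=
  exists (k : nat) (S : nat -> set A) (m : nat) (T : nat -> set B),
    [/\ normal_p_series p (pRt A p) k S,
        normal_p_series p (pRt B p) m T &
        [set iA @^-1` S i | i in `I_k.+1] =
        [set iB @^-1` T j | j in `I_m.+1]].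

(* Main.v *)
From HB Require Import structures.
From mathcomp Require Import all_boot all_fingroup all_solvable all_algebra.
From mathcomp Require Import boolp classical_sets functions cardinality.
Require Import Defs.

(** Two constructions of finite quotients of [G] carry the proof.

    For a fixed prime [p], the series of condition N(p) consist of normal
    [p]-subgroups of [A] and [B] with the same traces on [H]; each step of order [p] is
    centralized by the whole group, because the group acts on the series through a
    finite [p]-group ([p_series_step]). Multiplying by kernels of [p]-quotients
    that are injective on the [p]-torsion, one obtains a chain of pairs of normal
    subgroups with central steps of exponent [p] and equal traces on [H]
    ([condition_N_linked]). Higman's criterion ([higman]) turns such a chain into
    a finite [p]-quotient of [G] inducing prescribed finite [p]-quotients on the
    factors: the permutational product built from a section compatible with the
    chain induces a finite [p]-group on the classes of the smallest pair.
    Conversely, a finite [p]-quotient of [G] injective on the finite groups [A(p)]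
    and [B(p)] has a chief series, and its traces are the series wanted ([condition_N_of_quotient]).

    Under N(p) for all [p] the factors thus inherit all their finite [p]-quotients
    from [G], and every element of a factor outside [H] can be separated from [H] in
    one of them ([separated_prime]). The letters of a reduced word [g] are therefore
    separated from [H] in a single quotient [G / M]. There [g] may die; but [G]
    acts on a family of vector spaces over a prime field of arbitrary characteristic
    [q], indexed by [G / M], through transvections attached to the cosets that the
    word traverses, and [g] acts nontrivially ([word_survives]). This
    extends [G / M] by a finite [q]-group without touching the factors. If [M] has
    index a power of the same [q], as can be achieved if [H] is separable by finite
    [q]-quotients, the extension is a finite [q]-group. In general it shows that [G] is
    residually an extension of a [q]-group by a nilpotent one; and since the
    kernel [K] contains the intersections of [M] with the factors, [g] also
    survives modulo the normal closure of these, where the image of [M] is free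
    because it acts freely on a tree ([kernel_free]).

    For the remaining implications: a [p]-element survives in a finite
    nilpotent quotient only if it survives in a [p]-quotient, which gives N(p); and
    if [G] is residually finite nilpotent, elements of orders powers of different
    primes commute, whereas outside [H] they would produce a nontrivial reduced
    commutator ([outside_primes]). So only one prime [q] occurs outside [H], and
    [H] is [q']-isolated. *)

Set Implicit Arguments.
Unset Strict Implicit.
Unset Printing Implicit Defensive.
Local Open Scope classical_set_scope.
Local Open Scope group_scope.

(** * Homomorphisms, subgroups, quotients and permutation groups *)

Section HomTheory.
Variables (X K : groupType) (f : {multiplicative X -> K}).

Lemma hom1 : f 1 = 1.
Proof. by apply: (mulgI (f 1)); rewrite -gmulfM !mulg1. Qed.

Lemma homV x : f x^-1 = (f x)^-1.
Proof. by apply: (mulgI (f x)); rewrite -gmulfM !mulgV hom1. Qed.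

Lemma homX x n : f (x ^+ n) = f x ^+ n.
Proof.
by elim: n => [|n IH]; rewrite ?expg0 ?hom1 // !expgS gmulfM IH.
Qed.

Lemma homJ x y : f (x ^ y) = f x ^ f y.
Proof. by rewrite /conjg !gmulfM homV. Qed.

Lemma homR x y : f [~ x, y] = [~ f x, f y].
Proof. by rewrite /commg gmulfM homV homJ. Qed.

Lemma hom_inj : (forall x, f x = 1 -> x = 1) -> injective f.
Proof.
move=> f_inj x y eq_fxy; apply: divg1_eq; apply: f_inj.
by rewrite gmulfM homV eq_fxy mulgV.
Qed.
End HomTheory.

Lemma hom_of (X K : groupType) (f : X -> K) :
  {morph f : x y / x * y} -> exists h : {multiplicative X -> K}, h =1 f.
Proof.
move=> fM; pose h : {multiplicative X -> K} :=
  HB.pack f (isMultiplicative.Build X K f fM).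
by exists h.
Qed.

Lemma hom_comp (X Y Z : groupType) (g : {multiplicative Y -> Z})
    (f : {multiplicative X -> Y}) :
  exists h : {multiplicative X -> Z}, h =1 g \o f.
Proof. by apply: hom_of => x y /=; rewrite !gmulfM. Qed.

Lemma subgroupP (X : groupType) (Y : set X) :
  subgroup Y <-> [/\ Y 1, forall x y, Y x -> Y y -> Y (x * y) &
                    forall x, Y x -> Y x^-1].
Proof.
split=> [gY|[Y1 YM YV]].
  have YM := group_closedM gY; have YV := group_closedV gY.
  case: gY => Y1 _; split; first by rewrite inE in Y1.
    by move=> x y /mem_set Yx /mem_set Yy; apply/set_mem/YM.
  by move=> x /mem_set Yx; apply/set_mem/YV.
split; first exact/mem_set.
by move=> x y /set_mem Yx /set_mem Yy; apply/mem_set/YM => //; apply: YV.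
Qed.

Section SubgroupTheory.
Variables (X : groupType) (Y : set X).
Hypothesis gY : subgroup Y.

Lemma sub1 : Y 1. Proof. by case/subgroupP: gY. Qed.

Lemma subM x y : Y x -> Y y -> Y (x * y).
Proof. by case/subgroupP: gY => _ + _; apply. Qed.

Lemma subV x : Y x -> Y x^-1.
Proof. by case/subgroupP: gY => _ _; apply. Qed.

Lemma subX x n : Y x -> Y (x ^+ n).
Proof.
by move=> Yx; elim: n => [|n IH]; [apply: sub1 | rewrite expgS; apply: subM].
Qed.

End SubgroupTheory.

Lemma subgroup_group (X : groupType) (Y : set X) : subgroup Y ->
  exists (S : groupType) (i : {multiplicative S -> X}),
    injective i /\ range i = Y.
Proof.
move=> gY.
pose T := {x : X | `[< Y x >]}.
have valY (u : T) : Y (val u) by apply/asboolP; exact: valP u.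
pose inT x (Yx : Y x) : T := exist _ x (asboolT Yx).
pose m (u v : T) := inT _ (subM gY (valY u) (valY v)).
pose e := inT _ (sub1 gY).
pose n (u : T) := inT _ (subV gY (valY u)).
have mA : associative m by move=> u v w; apply/val_inj; rewrite /= mulgA.
have m1 : left_id e m by move=> u; apply/val_inj; rewrite /= mul1g.
have m1' : right_id e m by move=> u; apply/val_inj; rewrite /= mulg1.
have mV : left_inverse e n m by move=> u; apply/val_inj; rewrite /= mulVg.
have mV' : right_inverse e n m by move=> u; apply/val_inj; rewrite /= mulgV.
pose S : groupType := HB.pack T (isGroup.Build T mA m1 m1' mV mV').
have [//|i iE] := @hom_of S X (fun u : T => val u).
exists S, i; split; first by move=> u v; rewrite !iE => /val_inj.
apply/seteqP; split=> [_ [u _ <-]|x Yx]; first by rewrite iE; apply: valY.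
by exists (inT x Yx) => //; rewrite iE.
Qed.

Lemma normal_grp (X : groupType) (N : set X) : normal_subgroup N -> subgroup N.
Proof. by case. Qed.

Lemma normal_conj (X : groupType) (N : set X) x y :
  normal_subgroup N -> N x -> N (x ^ y).
Proof. by case=> _; apply. Qed.

Lemma normal_mulC (X : groupType) (N : set X) x y :
  normal_subgroup N -> N (x * y) -> N (y * x).
Proof. by move=> nN /(normal_conj x nN); rewrite /conjg -mulgA mulKg. Qed.

(** The carrier is a system of coset representatives, a subtype of [X]. *)
Lemma quotient_group (X : groupType) (N : set X) : normal_subgroup N ->
  exists (Q : groupType) (f : {multiplicative X -> Q}),
    onto f /\ forall x, f x = 1 <-> N x.
Proof.
move=> nN; have gN := normal_grp nN.
pose r x := xget x [set y | N (x^-1 * y)].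
have rP x : N (x^-1 * r x).
  by apply: (@xgetPex _ x [set y | N (x^-1 * y)]); exists x; rewrite /= mulVg;
     apply: sub1.
have rE x y : N (x^-1 * y) -> r x = r y.
  move=> Nxy; rewrite /r.
  have -> : [set z | N (x^-1 * z)] = [set z | N (y^-1 * z)].
    apply/seteqP; split=> z /= Nz.
      rewrite -(mulgK x y^-1) -mulgA; apply: subM => //.
      by rewrite -[x in _ * x]invgK -invgM; apply: subV.
    by rewrite -(mulgK y x^-1) -mulgA; apply: subM.
  rewrite /xget; case: pselect => // -[].
  by exists y; apply/asboolP; rewrite /= mulVg; apply: sub1.
pose T := {x : X | r x == x}.
have rr x : r (r x) == r x by apply/eqP; rewrite -(rE x (r x)).
pose p x : T := exist _ (r x) (rr x).
have pE x y : N (x^-1 * y) -> p x = p y by move=> Nxy; apply/val_inj/rE.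
have pEr x y : p x = p y -> N (x^-1 * y).
  move=> /(congr1 val) /= eq_r.
  have := rP x; rewrite eq_r => Nx.
  rewrite -(mulgK (r y) x^-1) -mulgA; apply: subM => //.
  by rewrite -[y in _ * y]invgK -invgM; apply: subV.
have pK (u : T) : p (val u) = u by apply/val_inj/eqP; exact: valP u.
have pr x : p (r x) = p x by apply/esym/pE/rP.
have pM x y : p (r x * r y) = p (x * y).
  apply/esym/pE; rewrite invgM.
  have -> : y^-1 * x^-1 * (r x * r y) = (x^-1 * r x) ^ y * (y^-1 * r y).
    by rewrite /conjg !mulgA mulgK.
  by apply: subM => //; apply: normal_conj.
pose m (u v : T) := p (val u * val v).
pose n (u : T) := p (val u)^-1.
have mp x y : m (p x) (p y) = p (x * y) by apply: pM.
have np x : n (p x) = p x^-1.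
  apply/esym/pE; rewrite invgK.
  have -> : x * (r x)^-1 = (r x * x^-1)^-1 by rewrite invgM invgK.
  by apply: (subV gN); apply: (normal_mulC nN).
have pind (Pr : T -> Prop) : (forall x, Pr (p x)) -> forall u, Pr u.
  by move=> Pp u; rewrite -(pK u).
have mA : associative m.
  by elim/pind=> x; elim/pind=> y; elim/pind=> z; rewrite !mp mulgA.
have m1 : left_id (p 1) m by elim/pind=> x; rewrite mp mul1g.
have m1' : right_id (p 1) m by elim/pind=> x; rewrite mp mulg1.
have mV : left_inverse (p 1) n m by elim/pind=> x; rewrite np mp mulVg.
have mV' : right_inverse (p 1) n m by elim/pind=> x; rewrite np mp mulgV.
pose Q : groupType := HB.pack T (isGroup.Build T mA m1 m1' mV mV').
have [|f fE] := @hom_of X Q p; first by move=> x y; rewrite -mp.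
exists Q, f; split=> [u _|x]; first by exists (val u) => //; rewrite fE pK.
rewrite fE; split=> [/(@pEr x 1)|Nx]; last first.
  by apply: pE; rewrite mulg1; apply: subV.
by rewrite mulg1 => /(subV gN); rewrite invgK.
Qed.

Definition is_action (X : groupType) (W : Type) (act : X -> W -> W) : Prop :=
  (forall w, act 1 w = w) /\ (forall x y w, act (x * y) w = act x (act y w)).

(** A permutation is encoded as a pair of mutually inverse maps, so that inversion
    exchanges the two maps. *)
Lemma symmetric_group (W : Type) :
  exists (S : groupType) (app : S -> W -> W),
    [/\ is_action app, forall s t, app s =1 app t -> s = t &
        forall (X : groupType) (act : X -> W -> W), is_action act ->
        exists f : {multiplicative X -> S}, forall x, app (f x) =1 act x].
Proof.
pose inverse (fg : (W -> W) * (W -> W)) := cancel fg.1 fg.2 /\ cancel fg.2 fg.1.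
pose T0 := {fg | inverse fg}.
pose T : choiceType := HB.pack T0 (gen_eqMixin T0) (gen_choiceMixin T0).
have T_inj (u v : T) : (sval u).1 =1 (sval v).1 -> u = v.
  case: u v => [[f f'] [fK f'K]] [[g g'] [gK g'K]] /= /funext eq_fg.
  rewrite /= in fK f'K gK g'K *; subst g.
  have eq_f'g' : f' = g' by apply/funext=> w; rewrite -{1}(g'K w) fK.
  by subst g'; congr exist; apply: Prop_irrelevance.
have invM (u v : T) :
    inverse ((sval u).1 \o (sval v).1, (sval v).2 \o (sval u).2).
  case: u v => [[f f'] [/= fK f'K]] [[g g'] [/= gK g'K]].
  by split=> w /=; rewrite ?fK ?gK ?g'K ?f'K.
have inv1 : inverse (id, id) by [].
have invV (u : T) : inverse ((sval u).2, (sval u).1).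
  by case: u => [[f f'] [/= fK f'K]].
pose m (u v : T) : T := exist inverse _ (invM u v).
pose e : T := exist inverse _ inv1.
pose n (u : T) : T := exist inverse _ (invV u).
have mA : associative m by move=> u v w; apply: T_inj.
have m1 : left_id e m by move=> u; apply: T_inj.
have m1' : right_id e m by move=> u; apply: T_inj.
have mV : left_inverse e n m.
  by move=> u; apply: T_inj => w /=; case: (svalP u) => + _; apply.
have mV' : right_inverse e n m.
  by move=> u; apply: T_inj => w /=; case: (svalP u) => _; apply.
pose S : groupType := HB.pack T (isGroup.Build T mA m1 m1' mV mV').
exists S, (fun s w => (sval s).1 w); split=> //.
move=> X act [act1 actM].
have invact x : inverse (act x, act x^-1).
  by split=> w /=; rewrite -actM ?mulVg ?mulgV act1.
have [|f fE] := @hom_of X S (fun x => exist inverse _ (invact x)); last first.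
  by exists f => x w; rewrite fE.
by move=> x y; apply: T_inj => w /=; rewrite actM.
Qed.

Section AmalgamTheory.
Variables (H A B G : groupType).
Variables (iA : {multiplicative H -> A}) (iB : {multiplicative H -> B}).
Variables (jA : {multiplicative A -> G}) (jB : {multiplicative B -> G}).
Hypothesis G_amalgam : is_amalgam iA iB jA jB.

Lemma amalgam_compat h : jA (iA h) = jB (iB h).
Proof. by case: G_amalgam => _ _ jE _; apply: jE. Qed.

(** The subgroup [Y] receives the two factors, so the universal property
    yields a retraction-like map [G -> Y] whose composite with the inclusion is
    the identity by uniqueness. *)
Lemma amalgam_ind (Y : set G) : subgroup Y ->
  (forall a, Y (jA a)) -> (forall b, Y (jB b)) -> forall g, Y g.
Proof.
move=> gY YA YB.
case: (subgroup_group gY) => S [i [i_inj rY]].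
have lift (X : groupType) (f : {multiplicative X -> G}) :
    (forall x, Y (f x)) -> exists f' : {multiplicative X -> S}, i \o f' =1 f.
  move=> Yf; have /choice[f' f'E] x : exists s, i s = f x.
    by have := Yf x; rewrite -rY => -[s _ <-]; exists s.
  have [|h hE] := @hom_of X S f'; last by exists h => x /=; rewrite hE.
  by move=> x y; apply: i_inj; rewrite gmulfM !f'E gmulfM.
have [fA fAE] := lift _ _ YA; have [fB fBE] := lift _ _ YB.
case: G_amalgam => _ _ jE univ.
have [|u [uA uB _]] := univ S fA fB.
  by move=> h /=; apply: i_inj; rewrite -[LHS]/((i \o fA) _) fAE
     -[RHS]/((i \o fB) _) fBE; apply: jE.
have [v [_ _ v_uniq]] := univ G jA jB jE.
have [iu iuE] := hom_comp i u.
have [id' idE] := @hom_of G G id (fun x y => erefl).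
have iu_v : iu =1 v.
  apply: v_uniq => x /=; rewrite iuE /=.
    by have := fAE x; rewrite /= -(uA x).
  by have := fBE x; rewrite /= -(uB x).
have id_v : id' =1 v by apply: v_uniq => x /=; rewrite idE.
move=> g; have -> : g = i (u g) by rewrite -[RHS]iuE iu_v -id_v idE.
by rewrite -rY; exists (u g).
Qed.

Lemma amalgam_action (W : Type) (actA : A -> W -> W) (actB : B -> W -> W) :
  is_action actA -> is_action actB ->
  (forall h w, actA (iA h) w = actB (iB h) w) ->
  exists act : G -> W -> W,
    [/\ is_action act, forall a, act (jA a) =1 actA a &
        forall b, act (jB b) =1 actB b].
Proof.
move=> aA aB aH.
have [S [app [[app1 appM] app_inj univS]]] := symmetric_group W.
have [fA fAE] := univS _ _ aA; have [fB fBE] := univS _ _ aB.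
case: G_amalgam => _ _ _ /(_ S fA fB)[|u [uA uB _]].
  by move=> h /=; apply: app_inj => w; rewrite fAE fBE.
exists (fun g => app (u g)); split=> [|a w|b w].
- by split=> [w|x y w]; rewrite ?hom1 ?gmulfM ?app1 ?appM.
- by rewrite -fAE -uA.
- by rewrite -fBE -uB.
Qed.
End AmalgamTheory.

(** * Finite quotients *)

(** A colouring of the elements by a finite type that separates the cosets is
    the form of finiteness of the index that is stable under intersections and
    inverse images. *)
Definition fin_index (X : groupType) (M N : set X) : Prop :=
  exists (I : finType) (c : X -> I),
    forall x y, M x -> M y -> c x = c y -> N (x^-1 * y).

(** The kernels of the homomorphisms onto finite [p]-groups. Unlike the
    homomorphisms themselves they can be intersected and pulled back. *)
Definition finite_pquot (X : groupType) (p : nat) (N : set X) : Prop :=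
  [/\ normal_subgroup N, fin_index setT N &
      forall x, exists k, N (x ^+ (p ^ k)%N)].

Lemma finite_colour (T : choiceType) (A : set T) : finite_set A ->
  exists (I : finType) (c : T -> I), forall x y, A x -> A y -> c x = c y -> x = y.
Proof.
move=> /finite_seqP[s As]; exists 'I_(size s).+1, (fun x => inord (index x s)).
move=> x y; rewrite As /= => sx sy /(congr1 val) /=.
rewrite !inordK ?ltnS ?index_size // => eq_i.
by rewrite -(nth_index x sx) eq_i nth_index.
Qed.

Lemma finite_setI (T : choiceType) (I : finType) (c : T -> I) (A : set T) :
  (forall x y, A x -> A y -> c x = c y -> x = y) -> finite_set A.
Proof.
move=> c_inj; apply/finite_seqP.
have [[x0 Ax0]|A0] := pselect (exists x, A x); last first.
  exists nil; apply/seteqP; split=> x //= Ax; by case: A0; exists x.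
pose r (i : I) := xget x0 [set x | A x /\ c x = i].
exists (undup [seq r i | i <- enum I & `[< exists x, A x /\ c x = i >]]).
apply/seteqP; split=> x /=; rewrite mem_undup.
  move=> Ax; apply/mapP; exists (c x).
    by rewrite mem_filter mem_enum andbT; apply/asboolP; exists x.
  have [Ar cr] : A (r (c x)) /\ c (r (c x)) = c x.
    by apply: (@xgetPex _ x0 [set y | A y /\ c y = c x]); exists x.
  by apply: c_inj.
case/mapP=> i; rewrite mem_filter => /andP[/asboolP ex _] ->.
by case: (@xgetPex _ x0 [set y | A y /\ c y = i] ex).
Qed.

Section QuotientTheory.
Variable X : groupType.
Implicit Types (M N : set X) (p : nat).

Lemma normal_setI N N' :
  normal_subgroup N -> normal_subgroup N' -> normal_subgroup (N `&` N').
Proof.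
move=> nN nN'; have gN := normal_grp nN; have gN' := normal_grp nN'.
split; last by move=> x y [Nx N'x]; split; apply: normal_conj.
apply/subgroupP; split=> [|x y [Nx N'x] [Ny N'y]|x [Nx N'x]].
- by split; apply: sub1.
- by split; apply: subM.
- by split; apply: subV.
Qed.

Lemma normal_full : normal_subgroup [set: X].
Proof. by split=> //; apply/subgroupP; split. Qed.

Lemma normal_triv : normal_subgroup [set (1 : X)].
Proof.
split; last by move=> x y /= ->; rewrite conj1g.
apply/subgroupP; split=> //= [x y -> ->|x ->]; rewrite ?mulg1 //.
by rewrite invg1.
Qed.

Lemma fin_indexI M N N' :
  fin_index M N -> fin_index M N' -> fin_index M (N `&` N').
Proof.
move=> [I [c cP]] [I' [c' cP']]; exists (I * I')%type, (fun x => (c x, c' x)).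
by move=> x y Mx My [/cP Nxy /cP' N'xy]; split; [apply: Nxy | apply: N'xy].
Qed.

Lemma fin_index_trans L M N : subgroup M -> M `<=` L ->
  fin_index L M -> fin_index M N -> subgroup N -> fin_index L N.
Proof.
move=> gM sML [I [c cP]] [I' [c' cP']] gN.
pose r i := xget 1 [set y | L y /\ c y = i].
have rP x : L x -> M ((r (c x))^-1 * x).
  move=> Lx; have [Lr cr] : L (r (c x)) /\ c (r (c x)) = c x.
    by apply: (@xgetPex _ 1 [set y | L y /\ c y = c x]); exists x.
  exact: cP.
exists (I * I')%type, (fun x => (c x, c' ((r (c x))^-1 * x))).
move=> x y Lx Ly [cxy]; rewrite -cxy => c'xy.
have := cP' _ _ (rP x Lx) _ c'xy; rewrite {1}cxy => /(_ (rP y Ly)).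
by rewrite invgM invgK -!mulgA mulVKg.
Qed.

Lemma finite_pquotI p N N' :
  finite_pquot p N -> finite_pquot p N' -> finite_pquot p (N `&` N').
Proof.
move=> [nN fN tN] [nN' fN' tN']; split; first exact: normal_setI.
  exact: fin_indexI.
move=> x; have [k Nx] := tN x; have [k' N'x] := tN' x.
exists (k + k')%N; rewrite expnD; split.
  by rewrite expgnA; apply: subX => //; apply: normal_grp.
by rewrite mulnC expgnA; apply: subX => //; apply: normal_grp.
Qed.

Lemma finite_pquotT p : finite_pquot p [set: X].
Proof.
split=> //; first exact: normal_full.
  by exists unit, (fun=> tt).
by move=> x; exists 0.
Qed.

End QuotientTheory.

Lemma normal_preim (X K : groupType) (f : {multiplicative X -> K}) (N : set K) :
  normal_subgroup N -> normal_subgroup (f @^-1` N).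
Proof.
move=> nN; have gN := normal_grp nN.
split; last by move=> x y /= Nx; rewrite homJ; apply: normal_conj.
apply/subgroupP; split=> /= [|x y Nx Ny|x Nx].
- by rewrite hom1; apply: sub1.
- by rewrite gmulfM; apply: subM.
- by rewrite homV; apply: subV.
Qed.

Lemma normal_ker (X K : groupType) (f : {multiplicative X -> K}) :
  normal_subgroup (ker f).
Proof. exact/normal_preim/normal_triv. Qed.

Lemma finite_pquot_preim (X K : groupType) (f : {multiplicative X -> K}) p N :
  finite_pquot p N -> finite_pquot p (f @^-1` N).
Proof.
move=> [nN [I [c cP]] tN]; split; first exact: normal_preim.
  by exists I, (c \o f) => x y _ _ cfxy; rewrite /= gmulfM homV; apply: cP.
by move=> x; have [k Nk] := tN (f x); exists k; rewrite /= homX.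
Qed.

Lemma normal_image (X K : groupType) (f : {multiplicative X -> K}) (N : set X) :
  onto f -> normal_subgroup N -> normal_subgroup (f @` N).
Proof.
move=> f_onto nN; have gN := normal_grp nN; split; last first.
  move=> y fx [x Nx <-{fx}]; have [z _ <-] := f_onto y I.
  by exists (x ^ z); [apply: normal_conj | rewrite homJ].
apply/subgroupP; split.
- by exists 1; [apply: sub1 | apply: hom1].
- move=> fx fy [x Nx <-{fx}] [y Ny <-{fy}].
  by exists (x * y); [apply: subM | rewrite gmulfM].
- by move=> fx [x Nx <-{fx}]; exists x^-1; [apply: subV | rewrite homV].
Qed.

(** Finitely many elements can be kept out of the kernel simultaneously, by
    intersecting kernels. *)
Lemma finite_pquot_avoid (X : groupType) (p : nat) (T : choiceType)
    (A : set T) (g : T -> X) : finite_set A ->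
  (forall t, A t -> exists2 N, finite_pquot p N & ~ N (g t)) ->
  exists2 N, finite_pquot p N & forall t, A t -> ~ N (g t).
Proof.
move=> /finite_seqP[s ->]; elim: s => [|t s IH] ex.
  by exists setT => //; apply: finite_pquotT.
have [|N pN Ng] := IH; first by move=> t' st'; apply: ex; rewrite /= inE st' orbT.
have [|N' pN' N'g] := ex t; first by rewrite /= mem_head.
exists (N `&` N'); first exact: finite_pquotI.
by move=> t'; rewrite /= inE => /orP[/eqP -> [_ /N'g]|/Ng Nt' [/Nt']].
Qed.

(** * Nilpotent groups *)

Fixpoint ucs (X : groupType) (n : nat) : set X :=
  if n is n'.+1 then [set x | forall g, ucs n' [~ x, g]] else [set 1].
Arguments ucs X n : clear implicits, simpl never.

Lemma ucsP (X : groupType) n (x : X) :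
  ucs X n.+1 x <-> forall g, ucs X n [~ x, g].
Proof. by []. Qed.

Definition prod_set (X : groupType) (M N : set X) : set X :=
  [set x | exists2 y, M y & N (y^-1 * x)].

Lemma prod_setE (X Q : groupType) (f : {multiplicative X -> Q}) (M N : set X) :
  (forall x, f x = 1 <-> N x) -> prod_set M N = f @^-1` (f @` M).
Proof.
move=> fN; apply/seteqP; split=> x /= [y My].
  move/fN; rewrite gmulfM homV => fyx; exists y => //.
  by rewrite -[RHS](mulVKg (f y)) fyx mulg1.
by move=> fyx; exists y => //; apply/fN; rewrite gmulfM homV fyx mulVg.
Qed.

Lemma prod_normal (X : groupType) (M N : set X) :
  normal_subgroup M -> normal_subgroup N -> normal_subgroup (prod_set M N).
Proof.
move=> nM nN; have [Q [f [f_onto fN]]] := quotient_group nN.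
by rewrite (prod_setE _ fN); apply/normal_preim/normal_image.
Qed.

Lemma prod_setl (X : groupType) (M N : set X) :
  subgroup N -> M `<=` prod_set M N.
Proof. by move=> gN x Mx; exists x => //; rewrite mulVg; apply: sub1. Qed.

Lemma prod_setr (X : groupType) (M N : set X) :
  subgroup M -> N `<=` prod_set M N.
Proof.
by move=> gM x Nx; exists 1; [apply: sub1 | rewrite invg1 mul1g].
Qed.

Lemma commg_central (X Q : groupType) (f : {multiplicative X -> Q}) (N : set X) :
  (forall x, f x = 1 <-> N x) ->
  forall x g, N [~ x, g] <-> commute (f x) (f g).
Proof.
move=> fN x g; rewrite -fN homR.
by split=> [/eqP/commgP|/commgP/eqP].
Qed.

Lemma ucs_normal (X : groupType) n : normal_subgroup (ucs X n).
Proof.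
elim: n => [|n IH]; first exact: normal_triv.
have [Q [f [f_onto fN]]] := quotient_group IH.
have fE := commg_central fN.
split.
  apply/subgroupP; split=> [|x y /ucsP Cx /ucsP Cy|x /ucsP Cx];
    apply/ucsP => g.
  - by rewrite comm1g; apply: (sub1 (normal_grp IH)).
  - apply/fE; rewrite gmulfM; apply/commute_sym/commuteM/commute_sym.
      exact/commute_sym/fE.
    exact/fE.
  - by apply/fE; rewrite homV; apply/commute_sym/commuteV/commute_sym/fE.
move=> y x /ucsP Cx; apply/ucsP => g; rewrite -(conjgKV y g) -conjRg.
by apply: normal_conj => //; apply: Cx.
Qed.

Lemma ucs_sub (X : groupType) n : ucs X n `<=` ucs X n.+1.
Proof.
move=> x Cx; apply/ucsP => g; rewrite /commg; apply: subM; first exact/normal_grp/ucs_normal.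
  by apply: subV => //; apply/normal_grp/ucs_normal.
exact: normal_conj (ucs_normal X n) Cx.
Qed.

Lemma nilpotent_ucs (X : groupType) :
  nilpotent_group X <-> exists n, forall x, ucs X n x.
Proof.
split=> [[n [Z [Z0 Zn _ sZ cZ]]]|[n Cn]].
  exists n => x; have: Z n x by rewrite Zn.
  have: (n <= n)%N by []; move: {-2}n x; elim=> [|i IH] x lin.
    by rewrite Z0.
  by move=> Zx; apply/ucsP => g; apply: IH; [apply: ltnW | apply: cZ].
exists n, (ucs X); split=> //.
- by apply/seteqP; split.
- by move=> i _; apply: ucs_normal.
- by move=> i _; apply: ucs_sub.
Qed.

Lemma ucs_image (X Q : groupType) (f : {multiplicative X -> Q}) n x :
  onto f -> ucs X n x -> ucs Q n (f x).
Proof.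
move=> f_onto; elim: n x => [x /= ->|n IH x /ucsP Cx]; first exact: hom1.
apply/ucsP => u; by have [g _ <-] := f_onto u I; rewrite -homR; apply/IH/Cx.
Qed.

Lemma nilpotent_onto (X Q : groupType) (f : {multiplicative X -> Q}) :
  onto f -> nilpotent_group X -> nilpotent_group Q.
Proof.
move=> f_onto /nilpotent_ucs[n Cn]; apply/nilpotent_ucs; exists n => u.
by have [x _ <-] := f_onto u I; apply: ucs_image.
Qed.

Lemma commXg_commute (X : groupType) (x g : X) n :
  commute x [~ x, g] -> [~ x ^+ n, g] = [~ x, g] ^+ n.
Proof.
move=> cx; rewrite {1}/commg conjXg.
have -> : x ^ g = x * [~ x, g] by rewrite /commg mulVKg.
by rewrite expgMn // mulKg.
Qed.

(** Modulo the [n]-th term, commutation with a fixed element is a homomorphism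
    from the cyclic group generated by [x] to the next lower factor. *)
Lemma ucs_commX (X : groupType) n m (x g : X) : ucs X n.+2 x ->
  ucs X n [~ x ^+ m, g] <-> ucs X n ([~ x, g] ^+ m).
Proof.
move=> Cx; have [Q [f [f_onto fN]]] := quotient_group (ucs_normal X n).
rewrite -!fN homR !homX homR commXg_commute // -homR.
by apply/commute_sym/(commg_central fN); move: x Cx => x /ucsP Cx; apply: Cx.
Qed.

(** Commutation with a fixed element maps each factor of the upper central series
    to the next lower one, so an exponent of the centre propagates upwards. *)
Lemma ucs_exponent (X : groupType) m :
  (forall z, ucs X 1 z -> z ^+ m = 1) ->
  forall n x, ucs X n.+1 x -> ucs X n (x ^+ m).
Proof.
move=> Zm; elim=> [|n IH] x Cx; first exact: Zm.
by apply/ucsP => g; apply/ucs_commX => //; apply: IH; apply/(iffLR (ucsP _ _)).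
Qed.

(** No nontrivial element of a factor is killed by commutation with all elements,
    so torsion-freeness propagates upwards too. *)
Lemma ucs_torsion_free (X : groupType) m :
  (forall z, ucs X 1 z -> z ^+ m = 1 -> z = 1) ->
  forall n x, ucs X n.+1 x -> ucs X n (x ^+ m) -> ucs X n x.
Proof.
move=> Zm; elim=> [|n IH] x Cx; first exact: Zm.
move=> /ucsP Cxm; apply/ucsP => g; apply: IH; last exact/ucs_commX.
by move/ucsP: Cx; apply.
Qed.

Definition pi_elt (X : groupType) (pi : nat_pred) : set X :=
  [set x | exists2 m, pi.-nat m & x ^+ m = 1].
Arguments pi_elt X pi : clear implicits.

Lemma pi_eltJ (X : groupType) pi (x y : X) : pi_elt X pi x -> pi_elt X pi (x ^ y).
Proof. by move=> [m pim xm]; exists m; rewrite // -conjXg xm conj1g. Qed.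

(** Modulo the largest normal subgroup consisting of [pi]-elements the centre
    has no [pi]-elements, hence neither has the whole nilpotent group. *)
Lemma pi_elt_normal (X : groupType) (pi : nat_pred) :
  nilpotent_group X -> normal_subgroup (pi_elt X pi).
Proof.
move=> nilX; split; last by move=> *; apply: pi_eltJ.
pose M := [set x | exists N, [/\ normal_subgroup N, N `<=` pi_elt X pi & N x]].
have MP : M `<=` pi_elt X pi by move=> x [N [_ sN Nx]]; apply: sN.
have nM : normal_subgroup M.
  split; last first.
    by move=> y x [N [nN sN Nx]]; exists N; split=> //; apply: normal_conj.
  apply/subgroupP; split.
  - exists [set 1]; split=> //; first exact: normal_triv.
    by move=> x ->; exists 1%N.
  - move=> x y [N [nN sN Nx]] [N' [nN' sN' N'y]].
    exists (prod_set N N'); split; first exact: prod_normal.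
    + have [Q [f [f_onto fN']]] := quotient_group nN'.
      move=> z [w Nw N'z]; have [m pim wm] := sN _ Nw.
      have /sN'[m' pim' zm'] : N' (z ^+ m).
        apply/fN'; move/fN': N'z; rewrite gmulfM homV => fz.
        have fzE : f w = f z by rewrite -[RHS](mulVKg (f w)) fz mulg1.
        by rewrite homX -fzE -homX wm hom1.
      by exists (m * m')%N; rewrite ?pnatM ?pim // expgnA.
    + by exists x => //; rewrite mulKg.
  - move=> x [N [nN sN Nx]]; exists N; split=> //.
    by apply: subV => //; apply: normal_grp.
have [Q [f [f_onto fM]]] := quotient_group nM.
have Zfree m z : pi.-nat m -> ucs Q 1 z -> z ^+ m = 1 -> z = 1.
  move=> pim Cz zm.
  pose C : set Q := ucs Q 1 `&` pi_elt Q pi.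
  have nC : normal_subgroup C.
    have gZ := normal_grp (ucs_normal Q 1).
    have cZ w u : ucs Q 1 w -> commute w u by move=> Zw; apply/commgP/eqP/Zw.
    split; last first.
      move=> u w [Zw piw]; split; last exact: pi_eltJ.
      exact: normal_conj (ucs_normal Q 1) Zw.
    apply/subgroupP; split.
    - by split; [apply: (sub1 gZ) | exists 1%N; rewrite ?expg1n].
    - move=> w u [Zw [k pik wk]] [Zu [l pil ul]]; split; first exact: (subM gZ).
      exists (k * l)%N; first by rewrite pnatM pik.
      rewrite expgMn; last exact: cZ.
      by rewrite expgnA wk expg1n mul1g mulnC expgnA ul expg1n.
    - move=> w [Zw [k pik wk]]; split; first exact: (subV gZ).
      by exists k; rewrite ?expVgn ?wk ?invg1.
  have [x _ fx] := f_onto z I; rewrite -fx; apply/fM.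
  exists (f @^-1` C); split; first exact: normal_preim.
    move=> y [_ [k pik]]; rewrite -homX => /fM/MP[l pil yl].
    by exists (k * l)%N; rewrite ?pnatM ?pik ?expgnA.
  by rewrite /= fx; split=> //; exists m.
have [n Cn] := (iffLR (nilpotent_ucs X) nilX).
suff -> : pi_elt X pi = M by apply: normal_grp.
apply/seteqP; split=> // x [m pim xm]; apply/fM.
have: ucs Q n (f x) by apply: ucs_image.
elim: n {Cn} => // n IH /(ucs_torsion_free (m := m)) Cx; apply/IH/Cx.
  by move=> z Zz /(Zfree _ _ pim Zz).
by rewrite -homX xm hom1; exact: (sub1 (normal_grp (ucs_normal Q n))).
Qed.

Lemma pRtE (X : groupType) p : prime p -> pRt X p = pi_elt X p.
Proof.
move=> p_pr; apply/seteqP; split=> x /=.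
  by move=> [k xk]; exists (p ^ k)%N; rewrite // pnatX pnat_id.
by move=> [m /p_natP[k ->] xm]; exists k.
Qed.

(** The form in which boundedness is used: [p]-torsion sections are finite. *)
Definition p_bounded (X : groupType) (p : nat) : Prop :=
  forall M N : set X, normal_subgroup M -> normal_subgroup N -> N `<=` M ->
  (forall x, M x -> exists k, N (x ^+ (p ^ k)%N)) -> fin_index M N.

Lemma p_bounded_onto (X Q : groupType) (f : {multiplicative X -> Q}) p :
  onto f -> p_bounded X p -> p_bounded Q p.
Proof.
move=> f_onto bX M N nM nN sNM tMN.
have [|||x Mx|J [c cP]] := bX (f @^-1` M) (f @^-1` N).
- exact: normal_preim.
- exact: normal_preim.
- by move=> x; apply: sNM.
- by have [k Nk] := tMN _ Mx; exists k; rewrite /= homX.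
have /choice[s sP] u : exists x, f x = u by have [x _ <-] := f_onto u I; exists x.
exists J, (c \o s) => u v Mu Mv /cP /=.
by rewrite gmulfM homV !sP; apply.
Qed.

Lemma p_bounded_finite (X : groupType) p : finite_group X -> p_bounded X p.
Proof.
move=> /finite_colour[J [c cP]] M N _ nN _ _; exists J, c => x y _ _ cxy.
by rewrite (cP x y) // mulVg; apply: (sub1 (normal_grp nN)).
Qed.

(** [M] meets the terms [Z i * N] of the series in subgroups of finite successive
    indices: modulo the previous term these are [p]-torsion subgroups of quotients
    of the abelian factors. *)
Lemma p_bounded_nilpotent (X : groupType) (P : nat_pred) p :
  p \in P -> bounded_nilpotent P X -> p_bounded X p.
Proof.
move=> Pp [n [Z [[Z0 Zn nZ sZ _] bZ]]] M N nM nN sNM tMN.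
have gM := normal_grp nM; have gN := normal_grp nN.
pose ZN i := prod_set (Z i) N.
have nZN i : (i <= n)%N -> normal_subgroup (ZN i).
  by move=> le_in; apply: prod_normal => //; apply: nZ.
pose Mi i := M `&` ZN i.
have nMi i : (i <= n)%N -> normal_subgroup (Mi i).
  by move=> le_in; apply: normal_setI => //; apply: nZN.
suff fMi i : (i <= n)%N -> fin_index (Mi i) N.
  have [//|J [c cP]] := fMi n; exists J, c => x y Mx My; apply: cP; split=> //.
    by exists x; rewrite ?Zn // mulVg; apply: (sub1 gN).
  by exists y; rewrite ?Zn // mulVg; apply: (sub1 gN).
elim: i => [_|i IH lt_in].
  exists unit, (fun=> tt) => x y [_ [z + Nzx]] [_ [w + Nwy]] _.
  rewrite !Z0 => /= z1 w1; move: Nzx Nwy; rewrite z1 w1 invg1 !mul1g => Nx Ny.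
  by apply: (subM gN) => //; apply: (subV gN).
have le_in := ltnW lt_in.
apply: (fin_index_trans _ _ _ (IH le_in) gN); first exact: normal_grp (nMi _ le_in).
  move=> x [Mx [z Zz Nzx]]; split=> //; exists z => //.
  exact: sZ.
have [Q [[sZi [S [e [f [e_inj re f_onto kf]]]]] [abQ bQ]]] := bZ i lt_in.
have nZNi := nZN i le_in; have gZNi := normal_grp nZNi.
have kerf s : f s = 1 -> Z i (e s) by move=> fs; have : ker f s by []; rewrite kf.
pose D := f @` (e @^-1` (ZN i)).
have nD : normal_subgroup D by apply: normal_image => //; apply: normal_preim.
have [Q' [g [g_onto gD]]] := quotient_group nD.
have [J [c cP]] := finite_colour (bQ Q' g g_onto p Pp).
have ex x : exists s, Mi i.+1 x -> N ((e s)^-1 * x).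
  have [[_ [z Zz Nzx]]|] := pselect (Mi i.+1 x); last by exists 1.
  by move: Zz; rewrite -re => -[s _ es]; exists s; rewrite es.
have [s sP] := choice ex.
have tors x : Mi i.+1 x -> pRt Q' p (g (f (s x))).
  move=> Mx; have [k Nk] := tMN _ (proj1 Mx); exists k.
  rewrite -!homX; apply/gD; exists (s x ^+ (p ^ k)%N) => //=.
  have [R [h [h_onto hN]]] := quotient_group nN.
  apply: (prod_setr (normal_grp (nZ i le_in))); apply/hN.
  have : h (e (s x)) = h x.
    have /hN := sP x Mx; rewrite gmulfM homV => hx.
    by rewrite -[RHS](mulVKg (h (e (s x)))) hx mulg1.
  by rewrite !homX => ->; rewrite -homX; apply/hN.
exists J, (fun x => c (g (f (s x)))) => x y Mx My /cP => /(_ (tors x Mx) (tors y My)).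
move=> eq_g; split.
  by apply: (subM gM); [apply: (subV gM); case: Mx | case: My].
have : D (f ((s x)^-1 * s y)).
  by apply/gD; rewrite !gmulfM !homV eq_g mulVg.
move=> [t ZNt ft].
have ZNe : ZN i (e ((s x)^-1 * s y)).
  have : Z i (e (t^-1 * ((s x)^-1 * s y))).
    by apply: kerf; rewrite gmulfM homV ft mulVg.
  rewrite gmulfM homV => /(prod_setl gN) Zt.
  by rewrite -(mulVKg (e t) (e _)); apply: (subM gZNi).
have [R [h [h_onto hZN]]] := quotient_group nZNi.
have hE w : Mi i.+1 w -> h (e (s w)) = h w.
  move=> Mw; have /(prod_setr (normal_grp (nZ i le_in)))/hZN := sP w Mw.
  rewrite gmulfM homV => hx.
  by rewrite -[RHS](mulVKg (h (e (s w)))) hx mulg1.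
apply/hZN; rewrite gmulfM homV -(hE x Mx) -(hE y My).
by move/hZN: ZNe; rewrite !gmulfM !homV.
Qed.

Lemma normal_maximal (X : groupType) (T N0 : set X) :
  normal_subgroup N0 -> (forall x, T x -> ~ N0 x) ->
  exists N, [/\ normal_subgroup N, N0 `<=` N, forall x, T x -> ~ N x &
    forall N', normal_subgroup N' -> N `<=` N' -> (forall x, T x -> ~ N' x) ->
      N' `<=` N].
Proof.
move=> nN0 TN0.
(* the union with [N0] makes the empty chain harmless *)
pose P (N : set X) :=
  normal_subgroup (N `|` N0) /\ forall x, T x -> ~ (N `|` N0) x.
have [|N [[nN TN] maxN]] := @Zorn_bigcup X P.
  move=> F FP totF; pose U := \bigcup_(Y in F) Y.
  have common x y : (U `|` N0) x -> (U `|` N0) y ->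
      exists2 Y, (Y = set0 \/ F Y) & (Y `|` N0) x /\ (Y `|` N0) y.
    move=> [[Y FY Yx]|N0x] [[Z FZ Zy]|N0y].
    - have [sYZ|sZY] := totF _ _ FY FZ.
        by exists Z; [right | split; left => //; apply: sYZ].
      by exists Y; [right | split; left => //; apply: sZY].
    - by exists Y; [right | split; [left | right]].
    - by exists Z; [right | split; [right | left]].
    - by exists set0; [left | split; right].
  have normY Y : Y = set0 \/ F Y -> normal_subgroup (Y `|` N0).
    by move=> [->|/FP[]] //; rewrite set0U.
  have subY Y : Y = set0 \/ F Y -> Y `|` N0 `<=` U `|` N0.
    by move=> [->|FY] x [Yx|N0x]; try (by []); try (by right); left; exists Y.
  split.
    split; last first.
      move=> y x Ux; have [Y FY [Yx _]] := common x x Ux Ux.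
      by apply: (subY Y FY); apply: normal_conj Yx; apply: normY.
    apply/subgroupP; split.
    - by right; apply: (sub1 (normal_grp nN0)).
    - move=> x y Ux Uy; have [Y FY [Yx Yy]] := common x y Ux Uy.
      by apply: (subY Y FY); apply: subM => //; apply/normal_grp/normY.
    - move=> x Ux; have [Y FY [Yx _]] := common x x Ux Ux.
      by apply: (subY Y FY); apply: subV => //; apply/normal_grp/normY.
  move=> x Tx Ux; have [Y FY [Yx _]] := common x x Ux Ux.
  case: FY Yx => [->|/FP[_ TY] Yx]; last exact: TY Yx.
  by rewrite set0U; apply: TN0.
exists (N `|` N0); split=> // N' nN' sNN' TN' x N'x.
have N'E : N' `|` N0 = N' by apply/setUidPl => y N0y; apply: sNN'; right.
apply: contrapT => Nx; apply: (maxN N'); last by rewrite /P N'E.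
split; first by apply: subset_trans sNN'; apply: subsetUl.
by move=> sN'N; apply: Nx; left; apply: sN'N.
Qed.

(** For central [z] this is the cyclic subgroup generated by [z], its negative
    powers being moved to the other side. *)
Definition powers (X : groupType) (z : X) : set X :=
  [set x | exists i j, x * z ^+ i = z ^+ j].

Lemma powers_normal (X : groupType) (z : X) :
  ucs X 1 z -> normal_subgroup (powers z).
Proof.
move=> /ucsP Zz.
have cz n x : commute x (z ^+ n).
  by apply/commuteX/commute_sym/commgP/eqP/Zz.
split; last first.
  move=> y x [i [j xz]]; exists i, j.
  by rewrite /conjg -!mulgA (cz i y) (mulgA x) xz -cz mulKg.
apply/subgroupP; split=> [|x y [i [j xz]] [k [l yz]]|x [i [j xz]]].
- by exists 0%N, 0%N; rewrite mulg1.
- exists (i + k)%N, (j + l)%N; rewrite !expgnDr -xz -yz !mulgA.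
  by rewrite -(mulgA x y) (cz i y) !mulgA.
- exists j, i; by rewrite -xz mulKg.
Qed.

(** In the quotient by a maximal normal subgroup avoiding the powers [y ^+ m]
    with [m] prime to [p], every nontrivial normal subgroup meets these powers.
    Applied to cyclic central subgroups this forces the centre to be a
    [p]-group. *)
Lemma monolith_center (X : groupType) p (y : X) : prime p ->
  (forall m, ~~ (p %| m) -> y ^+ m <> 1) ->
  (forall N z, normal_subgroup N -> N z -> z <> 1 ->
     exists2 m, ~~ (p %| m) & N (y ^+ m)) ->
  forall z, ucs X 1 z -> exists k, z ^+ (p ^ k)%N = 1.
Proof.
move=> p_pr y_free y_mono z Zz.
have gZ := normal_grp (ucs_normal X 1).
have cZ u w : ucs X 1 u -> commute u w by move=> /ucsP Zu; apply/commgP/eqP/Zu.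
have zP (u : X) : powers u u by exists 0%N, 1%N; rewrite mulg1.
have [->|/eqP z1] := eqVneq z 1; first by exists 0%N.
have ydiff a b : (a <= b)%N -> ~~ (p %| b - a)%N -> y ^+ a <> y ^+ b.
  move=> le_ab pab yab.
  by apply: y_free pab _; rewrite expgnFr // yab mulgV.
have [m pm [i [j yz]]] := y_mono _ _ (powers_normal Zz) (zP z) z1.
pose w := y ^+ m; have Zw : ucs X 1 w.
  have -> : w = z ^+ j * (z ^+ i)^-1 by rewrite -yz mulgK.
  by apply: (subM gZ); [|apply: (subV gZ)]; apply: (subX gZ).
have wp : w ^+ p = 1.
  have [//|/eqP wp1] := eqVneq (w ^+ p) 1.
  have [k pk [a [b yw]]] := y_mono _ _ (powers_normal (subX gZ p Zw)) (zP _) wp1.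
  move: yw; rewrite /w -!expgnA -expgnDr => yw.
  have pmul c : p %| m * (p * c) by rewrite mulnCA dvdn_mulr.
  have [le|/ltnW le] := leqP (k + m * (p * a)) (m * (p * b)).
    by case: (ydiff _ _ le _ yw); rewrite dvdn_subr ?dvdn_addl ?pmul.
  by case: (ydiff _ _ le _ (esym yw)); rewrite dvdn_subl ?dvdn_addl ?pmul.
have [n n_gt0 zn] : exists2 n, (0 < n)%N & z ^+ n = 1.
  have zpij : z ^+ (p * i) = z ^+ (p * j).
    rewrite !(mulnC p) !expgnA -yz expgMn; last exact: cZ.
    by rewrite -/w wp mul1g.
  have neq_ij : i <> j.
    by move=> eq_ij; apply: (y_free m pm); move: yz; rewrite eq_ij => /(canRL (mulgK _)) ->; rewrite mulgV.
  have p_gt0 := prime_gt0 p_pr.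
  case: (ltngtP i j) => // lt.
    exists (p * j - p * i)%N; first by rewrite subn_gt0 ltn_pmul2l.
    by rewrite expgnFr ?zpij ?mulgV // leq_mul2l ltnW // orbT.
  exists (p * i - p * j)%N; first by rewrite subn_gt0 ltn_pmul2l.
  by rewrite expgnFr ?zpij ?mulgV // leq_mul2l ltnW // orbT.
have [n' pn' nE] := pfactor_coprime p_pr n_gt0.
exists (logn p n); set k := logn p n in nE *.
have [//|/eqP zk1] := eqVneq (z ^+ (p ^ k)) 1.
have [l pl [a [b yz']]] := y_mono _ _ (powers_normal (subX gZ (p ^ k) Zz)) (zP _) zk1.
case: (y_free (l * n')%N).
  by rewrite Euclid_dvdM // negb_or pl -prime_coprime.
rewrite expgnA; have zn' c : ((z ^+ (p ^ k)) ^+ c) ^+ n' = 1.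
  by rewrite -!expgnA mulnCA (mulnC (p ^ k)%N) -nE mulnC expgnA zn expg1n.
have := zn' b; rewrite -yz' expgMn ?zn' ?mulg1 //.
by apply/commute_sym/cZ/(subX gZ)/(subX gZ).
Qed.

(** Residual finiteness. A normal subgroup maximal among those avoiding all
    [x ^+ m] with [m] prime to [p] has a [p]-torsion centre in its quotient;
    boundedness makes that centre finite, so of bounded exponent, and then the
    whole nilpotent quotient is a [p]-group, finite by boundedness again. *)
Lemma nilpotent_residual (X : groupType) p (x : X) : prime p ->
  nilpotent_group X -> p_bounded X p ->
  (forall m, ~~ (p %| m) -> x ^+ m <> 1) ->
  exists2 N, finite_pquot p N & ~ N x.
Proof.
move=> p_pr nilX bX x_free.
have [||N [nN _ xN maxN]] :=
  @normal_maximal X [set x ^+ m | m in [set m | ~~ (p %| m)]] [set 1].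
- exact: normal_triv.
- by move=> _ [m pm <-]; apply: x_free.
have gN := normal_grp nN.
have [Q [f [f_onto fN]]] := quotient_group nN.
pose y := f x.
have y_free m : ~~ (p %| m) -> y ^+ m <> 1.
  by move=> pm; rewrite -homX => /fN; apply: xN; exists m.
have y_mono M z : normal_subgroup M -> M z -> z <> 1 ->
    exists2 m, ~~ (p %| m) & M (y ^+ m).
  move=> nM Mz z1; apply: contrapT => noM; apply: z1.
  have [w _ wz] := f_onto z I; rewrite -wz; apply/fN.
  apply: (maxN (f @^-1` M)); last by rewrite /= wz.
  - exact: normal_preim.
  - by move=> u /fN /= ->; apply: (sub1 (normal_grp nM)).
  - move=> _ [m pm <-] /= Mxm; apply: noM.
    by exists m => //; rewrite -homX.
have tZ := monolith_center p_pr y_free y_mono.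
have nilQ := nilpotent_onto f_onto nilX.
have bQ := p_bounded_onto f_onto bX.
have [e Ze] : exists e, forall z, ucs Q 1 z -> z ^+ (p ^ e)%N = 1.
  have [||||J [c cP]] := bQ (ucs Q 1) [set 1].
  - exact: ucs_normal.
  - exact: normal_triv.
  - by move=> _ ->; apply: (sub1 (normal_grp (ucs_normal Q 1))).
  - exact: tZ.
  have ex (i : J) : exists k, forall z, ucs Q 1 z -> c z = i -> z ^+ (p ^ k)%N = 1.
    have [[z Zz cz]|noz] := pselect (exists2 z, ucs Q 1 z & c z = i).
      have [k zk] := tZ _ Zz; exists k => w Zw cw.
      have /mulg1_eq <- : z^-1 * w = 1 by apply: (cP z w); rewrite ?cz ?cw.
      by rewrite invgK.
    by exists 0%N => z Zz cz; case: noz; exists z.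
  have [k kP] := choice ex.
  exists (\max_i k i) => z Zz.
  rewrite -(subnK (leq_bigmax (c z))) expnD mulnC expgnA (kP (c z)) //.
  by rewrite expg1n.
have [n Cn] := (iffLR (nilpotent_ucs Q) nilQ).
have tQ (u : Q) : u ^+ ((p ^ e) ^ n)%N = 1.
  have := Cn u; elim: n {Cn} u => [u -> | n IH u Cu]; first by rewrite expg1n.
  by rewrite expnS expgnA; apply: IH; apply: ucs_exponent Cu.
exists N; last first.
  by apply: xN; exists 1%N; rewrite //= dvdn1 neq_ltn prime_gt1 ?orbT.
have tX (u : X) : exists k, N (u ^+ (p ^ k)%N).
  by exists (e * n)%N; apply/fN; rewrite homX expnM tQ.
split=> //; apply: bX => //; exact: normal_full.
Qed.

(** * Finite [p]-groups *)

(** Transport to a finite group type gives access to the theory of [p]-groups. *)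
Lemma finGroup_of (X : groupType) : finite_group X ->
  exists (F : finGroupType) (f : {multiplicative X -> F}), bijective f.
Proof.
move=> /finite_seqP[s sP].
have sE x : x \in undup s.
  by rewrite mem_undup; have : [set: X] x by []; rewrite sP.
have axs : Finite.axiom (undup s).
  by move=> x; rewrite count_uniq_mem ?undup_uniq // sE.
pose n := size (undup s).
have ck : pcancel (fun x : X => index x (undup s)) (fun i => ohead (drop i (undup s))).
  move=> x; have lt : (index x (undup s) < size (undup s))%N by rewrite index_mem.
  by rewrite (drop_nth x lt) /= nth_index.
pose F : finGroupType := HB.pack (Group.sort X) (Choice_isCountable.Build X ck) (isFinite.Build X axs).
have [//|f fE] := @hom_of X F id.
by exists F, f; exists id => x; rewrite fE.
Qed.

Lemma card_finGroup (Q : groupType) (F : finGroupType)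
    (f : {multiplicative Q -> F}) : bijective f -> ([set: Q] #= `I_#|F|)%card.
Proof.
move=> [g fK gK]; apply/card_set_bijP; exists (fun x => val (enum_rank (f x))).
split=> [x _|x y _ _ /val_inj/enum_rank_inj|i /= lt_i].
- exact: ltn_ord.
- by move/(congr1 g); rewrite !fK.
- by exists (g (enum_val (Ordinal lt_i))); rewrite // gK enum_valK.
Qed.

Section Steps.
Variables (X : groupType) (p : nat).
Implicit Types M N : set X.

(** For normal [M] and [N]: a central section of exponent dividing [p]. *)
Definition central_step M N : Prop :=
  [/\ M `<=` N, forall x g, N x -> M [~ x, g] &
      forall x, N x -> M (x ^+ p)].

Definition cyclic_step M N : Prop :=
  exists2 x, N x & forall y, N y -> exists k, M ((x ^+ k)^-1 * y).

Definition p_chain n (Z : nat -> set X) : Prop :=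
  [/\ forall i, (i <= n)%N -> normal_subgroup (Z i),
      forall i, (i < n)%N -> central_step (Z i) (Z i.+1) &
      forall i, (i < n)%N -> cyclic_step (Z i) (Z i.+1)].
End Steps.

Lemma finGroup_chain (F : finGroupType) (p : nat) (G N : {group F}) m :
  prime p ->  p.-group G -> N <| G -> #|N| = (p ^ m)%N ->
  exists Z : nat -> {group F},
    [/\ Z 0 = 1%G, Z m = N, forall i, (i <= m)%N -> Z i <| G,
        forall i, (i < m)%N -> Z i \subset Z i.+1 &
        forall i, (i <= m)%N -> #|Z i| = (p ^ i)%N].
Proof.
move=> p_pr pG; elim: m N => [|m IH] N nNG oN.
  exists (fun=> N); split=> // [|[]//].
  by apply/eqP; rewrite -val_eqE /= trivg_card1 oN.
have [|Q [sQN nQG oQ]] := normal_pgroup pG nNG (r := m).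
  by rewrite oN pfactorK.
have [Z [Z0 Zm nZ sZ oZ]] := IH Q nQG oQ.
exists (fun i => if (i <= m)%N then Z i else N); split.
- by [].
- by rewrite ltnn.
- by move=> i; case: (leqP i m) => [le_im _|//]; apply: nZ.
- move=> i; rewrite ltnS => le_im; rewrite le_im.
  case: (ltnP i m) => [|le_mi]; first exact: sZ.
  by have -> : i = m; [apply/anti_leq; rewrite le_im | rewrite Zm].
- move=> i; case: (leqP i m) => [le_im _|lt_mi le_im]; first exact: oZ.
  by rewrite oN; congr (p ^ _)%N; apply/anti_leq; rewrite lt_mi.
Qed.

(** A finite [p]-group has normal subgroups of all possible orders, and a normal
    subgroup of order [p] of a [p]-group is central. *)
Lemma finite_p_chain (X : groupType) p : prime p -> finite_group X ->
  (forall x : X, exists k, x ^+ (p ^ k)%N = 1) ->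
  exists n Z, [/\ p_chain p n Z, Z 0 = [set (1 : X)] & Z n = setT].
Proof.
move=> p_pr finX tX; have [F [f [g fK gK]]] := finGroup_of finX.
pose T : {group F} := [set: F]%G.
have pT : p.-group T.
  apply/pgroupP => q q_pr /Cauchy[//|x _ ox].
  have [k xk] := tX (g x).
  have: x ^+ (p ^ k)%N = 1 by rewrite -(gK x) -homX xk hom1.
  move/eqP; rewrite -order_dvdn ox Euclid_dvdX // => /andP[qp _].
  by rewrite inE -(dvdn_prime2 q_pr p_pr).
have oF := card_pgroup pT.
have [Z [Z0 Zn nZ sZ oZ]] := finGroup_chain p_pr pT (normal_refl _) oF.
set n := logn p _ in oF Zn nZ sZ oZ.
exists n, (fun i => [set x | f x \in Z i]); split; last first.
- by apply/seteqP; split=> x //= _; rewrite Zn inE.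
- apply/seteqP; split=> x /=; rewrite Z0 inE; last by move=> ->; rewrite hom1.
  by rewrite -(hom1 f) => /eqP /(can_inj fK).
have nZZ i : (i < n)%N -> Z i.+1 \subset 'N(Z i).
  move=> lt_in; apply: fintype.subset_trans (normal_sub (nZ _ lt_in)) _.
  exact/normal_norm/nZ/ltnW.
have oq i : (i < n)%N -> #|Z i.+1 / Z i| = p.
  move=> lt_in; rewrite card_quotient ?nZZ // -divgS ?sZ // !oZ // ?(ltnW lt_in) //.
  by rewrite expnS mulnK // expn_gt0 prime_gt0.
split.
- move=> i le_in; have nZi := nZ i le_in; split; last first.
    by move=> x y /= Zy; rewrite homJ memJ_norm // (fintype.subsetP (normal_norm nZi)) //.
  apply/subgroupP; split=> /= [|x y Zx Zy|x Zx]; first by rewrite hom1 group1.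
    by rewrite gmulfM groupM.
  by rewrite homV groupV.
- move=> i lt_in; have nZi := nZ i (ltnW lt_in); have nZi' := nZ i.+1 lt_in.
  split.
  + by move=> x /= Zx; rewrite (fintype.subsetP (sZ i lt_in)).
  + move=> x y /= Zx; rewrite homR.
    have: Z i.+1 / Z i \subset 'Z(T / Z i).
      apply: prime_meetG; first by rewrite oq.
      apply: meet_center_nil; first exact: (pgroup_nil (quotient_pgroup _ pT)).
        exact: quotient_normal.
      by rewrite trivg_card1 oq // neq_ltn prime_gt1 // orbT.
    move=> /fintype.subset_trans/(_ (subsetIr _ _)).
    rewrite quotient_cents2 ?nZZ ?normal_norm // => /fintype.subsetP; apply.
    by rewrite mem_commg ?finset.in_setT.
  + move=> x /= Zx; rewrite homX.
    have nx : f x \in 'N(Z i) by apply: (fintype.subsetP (nZZ i lt_in)).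
    apply: coset_idr; first by rewrite groupX.
    by rewrite morphX // -(oq i lt_in) expg_cardG ?mem_quotient.
- move=> i lt_in.
  have [|x Zx Zx'] := fintype.subsetPn (_ : ~~ (Z i.+1 \subset Z i)).
    apply/negP => /subset_leq_card; rewrite !oZ ?(ltnW lt_in) // leq_exp2l ?prime_gt1 //.
    by rewrite ltnn.
  have nx z : z \in Z i.+1 -> z \in 'N(Z i) by apply: (fintype.subsetP (nZZ i lt_in)).
  have cx : Z i.+1 / Z i = <[coset (Z i) x]>.
    apply: nt_gen_prime; first by rewrite oq.
    rewrite !inE mem_quotient // andbT.
    by apply: contra Zx' => /eqP; apply: coset_idr; apply: nx.
  exists (g x) => [|y /= Zy]; first by rewrite /= gK.
  have: coset (Z i) (f y) \in <[coset (Z i) x]> by rewrite -cx mem_quotient.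
  case/cycleP=> k yk; exists k; rewrite gmulfM homV homX gK.
  apply: coset_idr; first by rewrite groupM ?groupV ?groupX ?nx.
  rewrite morphM ?groupV ?groupX ?nx // morphV ?groupX ?nx // morphX ?nx //=.
  by rewrite yk mulVg.
Qed.

(** * Finite nilpotent quotients *)

Lemma has_orderP (X : groupType) (x : X) m : (0 < m)%N -> x ^+ m = 1 ->
  exists2 n, has_order x n & forall k, x ^+ k = 1 -> n %| k.
Proof.
move=> m_gt0 xm.
have ex : exists n, (0 < n)%N && `[< x ^+ n = 1 >].
  by exists m; rewrite m_gt0; apply/asboolP.
case: (ex_minnP ex) => n /andP[n_gt0 /asboolP xn] min_n.
exists n; first by split=> // k k_gt0 xk; apply: min_n; rewrite k_gt0; apply/asboolP.
move=> k xk; rewrite /dvdn; have [//|r_gt0] := posnP (k %% n).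
have := min_n (k %% n); rewrite r_gt0 leqNgt ltn_pmod //; apply; apply/asboolP.
by move: xk; rewrite {1}(divn_eq k n) expgnDr mulnC expgnA xn expg1n mul1g.
Qed.

Lemma pi_groupP (X : groupType) (pi : nat_pred) :
  pi_group X pi <-> forall x : X, pi_elt X pi x.
Proof.
split=> [[tX piX] x|piX].
  have [n nx] := tX x; exists n; first exact: piX nx.
  by case: nx.
split=> [x|x n [n_gt0 xn min_n]]; have [m pim xm] := piX x;
  have m_gt0 : (0 < m)%N by case/andP: pim.
  by have [n nx _] := has_orderP m_gt0 xm; exists n.
have [k [k_gt0 xk min_k] dvd_k] := has_orderP m_gt0 xm.
have -> : n = k by apply/eqP; rewrite eqn_leq min_n // min_k.
exact: pnat_dvd (dvd_k _ xm) pim.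
Qed.

(** Commutators with arbitrary elements lead down the series, so that its terms
    need not be subgroups. *)
Definition nil_mod (X : groupType) (N : set X) : Prop :=
  exists n (Z : nat -> set X), [/\ Z 0 `<=` N, Z n = setT &
    forall i, (i < n)%N -> forall x g, Z i.+1 x -> Z i [~ x, g]].

(** The kernels of the homomorphisms onto finite nilpotent [P]-groups. *)
Definition finite_nilquot (X : groupType) (P : nat_pred) (N : set X) : Prop :=
  [/\ normal_subgroup N, fin_index setT N, nil_mod N &
      forall x, exists2 m, P.-nat m & N (x ^+ m)].

Lemma nil_mod_ker (X K : groupType) (f : {multiplicative X -> K}) :
  nilpotent_group K -> nil_mod (ker f).
Proof.
move=> /nilpotent_ucs[n Cn]; exists n, (fun i => f @^-1` (ucs K i)).
split=> //; first by apply/seteqP; split=> x // _; apply: Cn.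
by move=> i _ x g /ucsP Cx; rewrite /= homR.
Qed.

Lemma nil_mod_onto (X K : groupType) (f : {multiplicative X -> K}) (N : set X) :
  onto f -> (forall x, f x = 1 <-> N x) -> nil_mod N -> nilpotent_group K.
Proof.
move=> f_onto fN [n [Z [Z0 Zn cZ]]]; apply/nilpotent_ucs; exists n => u.
have [x _ <-] := f_onto u I; have: Z n x by rewrite Zn.
have: (n <= n)%N by []; move: {-2}n x; elim=> [|i IH] x lin Zx.
  by apply/fN/Z0.
apply/ucsP => v; have [g _ <-] := f_onto v I; rewrite -homR.
by apply: IH; [apply: ltnW | apply: cZ].
Qed.

Lemma nil_modI (X : groupType) (N N' : set X) :
  nil_mod N -> nil_mod N' -> nil_mod (N `&` N').
Proof.
move=> [n [Z [Z0 Zn cZ]]] [n' [Z' [Z'0 Z'n cZ']]].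
(* both series are prolonged by the whole group to the same length *)
pose W m (V : nat -> set X) i := if (i < m)%N then V i else setT.
exists (n + n')%N, (fun i => W n Z i `&` W n' Z' i); split.
- move=> x; rewrite /W => -[]; case: (posnP n) => [n0 _|_ Zx];
    case: (posnP n') => [n'0 _|_ Z'x]; split.
  all: try by [apply: Z0; rewrite // -n0 Zn | apply: Z'0; rewrite // -n'0 Z'n].
- by rewrite /W !ltnNge leq_addr leq_addl /= setTI.
have cW m V : V m = setT -> (forall i, (i < m)%N -> forall x g, V i.+1 x -> V i [~ x, g]) ->
    forall i x g, W m V i.+1 x -> W m V i [~ x, g].
  move=> Vm cV i x g; rewrite /W; case: (ltnP i m) => // lt_im.
  case: (ltnP i.+1 m) => [_|le_mi _]; first exact: cV.
  have eq_m : i.+1 = m by apply/anti_leq; rewrite lt_im.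
  by apply: cV => //; rewrite eq_m Vm.
by move=> i _ x g [Wx W'x]; split; apply: cW.
Qed.

Section NilQuotTheory.
Variables (X : groupType) (P : nat_pred).
Implicit Types N M : set X.

Lemma finite_nilquotI N M :
  finite_nilquot P N -> finite_nilquot P M -> finite_nilquot P (N `&` M).
Proof.
move=> [nN fN cN tN] [nM fM cM tM]; split.
- exact: normal_setI.
- exact: fin_indexI.
- exact: nil_modI.
- move=> x; have [m Pm Nx] := tN x; have [k Pk Mx] := tM x.
  exists (m * k)%N; first by rewrite pnatM Pm.
  split; first by rewrite expgnA; apply: (subX (normal_grp nN)).
  by rewrite mulnC expgnA; apply: (subX (normal_grp nM)).
Qed.

Lemma finite_nilquot_ker (K : groupType) (f : {multiplicative X -> K}) :
  fin_nilpotent_pi_group P K -> finite_nilquot P (ker f).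
Proof.
move=> [finK nilK /pi_groupP piK]; split.
- exact: normal_ker.
- have [J [c cP]] := finite_colour finK; exists J, (c \o f) => x y _ _ cxy.
  by rewrite /ker /= gmulfM homV (cP (f x) (f y)) // mulVg.
- exact: nil_mod_ker.
- by move=> x; have [m Pm xm] := piK (f x); exists m; rewrite // /ker /= homX.
Qed.

Lemma fin_index_finite (K : groupType) (f : {multiplicative X -> K}) N :
  onto f -> (forall x, f x = 1 <-> N x) -> fin_index setT N -> finite_group K.
Proof.
move=> f_onto fN [J [c cP]].
have /choice[s sP] u : exists x, f x = u by have [x _ <-] := f_onto u I; exists x.
apply: (@finite_setI _ _ (c \o s)) => u v _ _ /cP.
move=> /(_ I I)/fN; rewrite gmulfM homV !sP => uv.
by rewrite -[RHS](mulVKg u) uv mulg1.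
Qed.

Lemma finite_nilquot_image (K : groupType) (f : {multiplicative X -> K}) N :
  onto f -> (forall x, f x = 1 <-> N x) -> finite_nilquot P N ->
  fin_nilpotent_pi_group P K.
Proof.
move=> f_onto fE [nN fN cN tN]; split.
- exact: (fin_index_finite f_onto fE fN).
- exact: (nil_mod_onto f_onto fE cN).
- apply/pi_groupP => u; have [x _ <-] := f_onto u I; have [m Pm Nx] := tN x.
  by exists m => //; rewrite -homX; apply/fE.
Qed.

Lemma finite_nilquot_group N : finite_nilquot P N ->
  exists (K : groupType) (f : {multiplicative X -> K}),
    [/\ fin_nilpotent_pi_group P K, onto f & forall x, f x = 1 <-> N x].
Proof.
move=> nilN; have [nN _ _ _] := nilN; have [K [f [f_onto fE]]] := quotient_group nN.
by exists K, f; split=> //; apply: (finite_nilquot_image f_onto fE).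
Qed.

Lemma finite_pquot_ker p (K : groupType) (f : {multiplicative X -> K}) :
  prime p -> fin_p_group p K -> finite_pquot p (ker f).
Proof.
move=> p_pr [finK /pi_groupP piK]; split.
- exact: normal_ker.
- have [J [c cP]] := finite_colour finK; exists J, (c \o f) => x y _ _ cxy.
  by rewrite /ker /= gmulfM homV (cP (f x) (f y)) // mulVg.
- move=> x; have [m /p_natP[k ->] xm] := piK (f x).
  by exists k; rewrite /ker /= homX.
Qed.

Lemma finite_pquot_chain p N : prime p -> finite_pquot p N ->
  exists n Z, [/\ p_chain p n Z, Z 0 = N & Z n = setT].
Proof.
move=> p_pr [nN fN tN]; have [K [f [f_onto fE]]] := quotient_group nN.
have [||n [Z [[nZ cZ yZ] Z0 Zn]]] := @finite_p_chain K p p_pr.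
- exact: (fin_index_finite f_onto fE fN).
- move=> u; have [x _ <-] := f_onto u I; have [k Nx] := tN x.
  by exists k; rewrite -homX; apply/fE.
exists n, (fun i => f @^-1` (Z i)); split; last first.
- by rewrite Zn.
- by apply/seteqP; split=> x; rewrite Z0 /= fE.
split=> i lt_in.
- by apply: normal_preim; apply: nZ.
- have [sZ zZ pZ] := cZ i lt_in; split=> [x|x g|x] /=.
  + exact: sZ.
  + by rewrite homR; apply: zZ.
  + by rewrite homX; apply: pZ.
- have [u Zu uP] := yZ i lt_in; have [x _ fx] := f_onto u I.
  exists x => [|y /= /uP[k Zk]]; first by rewrite /= fx.
  by exists k; rewrite gmulfM homV homX fx.
Qed.

Lemma finite_pquot_nil p N : prime p -> p \in P ->
  finite_pquot p N -> finite_nilquot P N.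
Proof.
move=> p_pr Pp pN; have [n [Z [[nZ cZ _] Z0 Zn]]] := finite_pquot_chain p_pr pN.
case: pN => nN fN tN; split=> //.
  exists n, Z; split=> //; first by rewrite Z0.
  by move=> i /cZ[].
by move=> x; have [k Nx] := tN x; exists (p ^ k)%N; rewrite // pnatX pnatE ?Pp.
Qed.

(** For a prime [p] dividing the order of the image of [x] no power of [x] prime
    to [p] dies in the quotient, so [nilpotent_residual] applies there. *)
Lemma finite_nilquot_residual N (x : X) : finite_nilquot P N -> ~ N x ->
  exists p M, [/\ p \in P, prime p, finite_pquot p M & ~ M x].
Proof.
move=> nilN Nx; have [K [f [[finK nilK /pi_groupP piK] f_onto fE]]] :=
  finite_nilquot_group nilN.
have [m Pm fxm] := piK (f x).
have m_gt0 : (0 < m)%N by case/andP: Pm.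
have [d [d_gt0 fxd _] dvd_d] := has_orderP m_gt0 fxm.
have d_gt1 : (1 < d)%N.
  rewrite ltn_neqAle d_gt0 andbT eq_sym; apply/eqP => d1; apply: Nx; apply/fE.
  by rewrite -fxd d1.
have p_pr := pdiv_prime d_gt1; set p := pdiv d in p_pr.
have Pp : p \in P.
  have := pnat_dvd (dvdn_trans (pdiv_dvd d) (dvd_d _ fxm)) Pm.
  by rewrite pnatE.
have [||M pM Mfx] := @nilpotent_residual K p (f x) p_pr nilK.
- exact: p_bounded_finite.
- by move=> k pk fxk; case/negP: pk; apply: dvdn_trans (pdiv_dvd d) (dvd_d _ fxk).
exists p, (f @^-1` M); split=> //; exact: finite_pquot_preim.
Qed.
End NilQuotTheory.

(** * Separability in the factors *)

Lemma coprime_inverse m n : coprime m n -> exists c, m * c = 1 %[mod n].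
Proof.
move=> co_mn; have dv : m %| chinese m n 0 1.
  by rewrite /dvdn -[X in _ == X](mod0n m); apply/eqP; apply: chinese_modl.
by exists (chinese m n 0 1 %/ m)%N; rewrite mulnC divnK //; apply: chinese_modr.
Qed.

Lemma coprime_expg (X : groupType) (x : X) m n :
  coprime m n -> (0 < m)%N -> x ^+ m = 1 -> x ^+ n = 1 -> x = 1.
Proof.
move=> co_mn m_gt0 xm xn; have [d [_ xd _] dvd_d] := has_orderP m_gt0 xm.
have: d %| gcdn m n by rewrite dvdn_gcd !dvd_d.
by rewrite (eqP co_mn) dvdn1 => /eqP d1; rewrite -[x]expg1 -d1.
Qed.

Lemma finite_pquot_coprime (X : groupType) p (N : set X) x m : prime p ->
  finite_pquot p N -> ~~ (p %| m) -> N (x ^+ m) -> N x.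
Proof.
move=> p_pr [nN _ tN] pm; have [Q [f [_ fN]]] := quotient_group nN.
have [k /fN] := tN x; rewrite homX => xpk /fN; rewrite homX => xm.
apply/fN; apply: coprime_expg xpk xm; last by rewrite expn_gt0 prime_gt0.
by apply: coprimeXl; rewrite prime_coprime.
Qed.

Lemma sgp_subgroup (X : groupType) (S : set X) : subgroup (sgp S).
Proof.
apply/subgroupP; split.
- by move=> Y [gY _]; apply: sub1.
- by move=> x y Sx Sy Y SY; apply: (subM (proj1 SY)); [apply: Sx | apply: Sy].
- by move=> x Sx Y SY; apply: (subV (proj1 SY)); apply: Sx.
Qed.

Lemma pRt_torsion (X : groupType) p : prime p -> pRt X p `<=` torsion X.
Proof.
move=> p_pr x [k xk]; have [|n nx _] := has_orderP _ xk; last by exists n.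
by rewrite expn_gt0 prime_gt0.
Qed.

Lemma pRt_hom (X Y : groupType) (f : {multiplicative X -> Y}) p x :
  pRt X p x -> pRt Y p (f x).
Proof. by move=> [k xk]; exists k; rewrite -homX xk hom1. Qed.

(** The exponent [e], given by the Chinese remainder theorem, makes [x ^+ e] the
    [p]-part of [x]; only nonnegative exponents are used. *)
Lemma p_part_elt (X : groupType) p (x : X) : prime p -> torsion X x ->
  exists e, pRt X p (x ^+ e) /\
    exists2 m, ~~ (p %| m) & (x^-1 * x ^+ e) ^+ m = 1.
Proof.
move=> p_pr [n [n_gt0 xn _]]; have [m co_pm nE] := pfactor_coprime p_pr n_gt0.
set k := logn p n in nE; have co : coprime (p ^ k) m by rewrite coprimeXl.
have m_gt0 : (0 < m)%N by move: n_gt0; rewrite nE muln_gt0 => /andP[].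
pose e := chinese (p ^ k) m 1 0.
have e_m : m %| e.
  by rewrite /dvdn -[X in _ == X](mod0n m); apply/eqP; apply: chinese_modr.
have e_p : e = 1 %[mod p ^ k] by apply: chinese_modl.
exists (e + n)%N; split.
  exists k; rewrite -expgnA mulnDl expgnDr.
  have /dvdnP[c ->] := e_m; rewrite -mulnA -nE mulnC expgnA xn expg1n mul1g.
  by rewrite expgnA xn expg1n.
exists m; first by rewrite -prime_coprime.
have -> : x^-1 * x ^+ (e + n) = x ^+ (e + n).-1.
  by rewrite -{1}(prednK (_ : 0 < e + n)%N) ?addn_gt0 ?n_gt0 ?orbT // expgS mulKg.
have /dvdnP[c ->] : p ^ k %| (e + n).-1.
  rewrite -subn1 -eqn_mod_dvd ?addn_gt0 ?n_gt0 ?orbT //.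
  by rewrite nE -modnDmr modnMl addn0 e_p.
by rewrite -expgnA -mulnA (mulnC _ m) -nE mulnC expgnA xn expg1n.
Qed.

Section Factor.
Variables (H X : groupType) (iX : {multiplicative H -> X}) (P : nat_pred).
Hypothesis P_prime : {in P, forall p, prime p}.
Hypothesis P_ne : exists p, p \in P.
Hypothesis iX_inj : injective iX.
Hypothesis H_periodic : periodic H.
Hypothesis resX : residually (fin_nilpotent_pi_group P) X.
Hypothesis bX : onto_injective_on (bounded_nilpotent P) (sgp (torsion X)).

Lemma residual_p (x : X) : x <> 1 ->
  exists p N, [/\ p \in P, finite_pquot p N & ~ N x].
Proof.
move=> /resX[K [s [CK s_onto sx]]].
have [|p [M [Pp _ pM Mx]]] := finite_nilquot_residual (finite_nilquot_ker s CK) (x := x).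
  by move=> kx; apply: sx.
by exists p, M.
Qed.

(** The torsion elements map injectively to a nilpotent group, in which the
    [p]-elements form a subgroup. *)
Lemma pRt_normal p : p \in P -> normal_subgroup (pRt X p).
Proof.
move=> Pp; have p_pr := P_prime Pp.
have [K [s [[n [Z [cZ _]]] s_onto s_inj]]] := bX.
have nilK : nilpotent_group K by exists n, Z.
have nT := pi_elt_normal p nilK; rewrite -pRtE // in nT.
have gT := normal_grp nT; have gS := sgp_subgroup (torsion X).
have tS x : pRt X p x -> sgp (torsion X) x.
  by move=> /(pRt_torsion p_pr); apply: sub_gen_smallest.
have sK x : sgp (torsion X) x -> pRt K p (s x) -> pRt X p x.
  move=> Sx [k sxk]; exists k; apply: s_inj; rewrite ?inE ?homX ?hom1 //.
    exact: (subX gS).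
  exact: (sub1 gS).
split; last by move=> y x [k xk]; exists k; rewrite -conjXg xk conj1g.
apply/subgroupP; split.
- by exists 0%N.
- move=> x y px py; apply: sK; first by apply: (subM gS); apply: tS.
  by rewrite gmulfM; apply: (subM gT); apply: pRt_hom.
- by move=> x [k xk]; exists k; rewrite expVgn xk invg1.
Qed.

Lemma pRt_finite p : p \in P -> finite_set (pRt X p).
Proof.
move=> Pp; have p_pr := P_prime Pp.
have [K [s [bK s_onto s_inj]]] := bX.
have nilK : nilpotent_group K by case: bK => n [Z [cZ _]]; exists n, Z.
have [||||J [c cP]] := p_bounded_nilpotent Pp bK (M := pRt K p) (N := [set 1]).
- by rewrite pRtE //; apply: pi_elt_normal.
- exact: normal_triv.
- by move=> _ ->; exists 0%N.
- by move=> x [k xk]; exists k.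
apply: (@finite_setI _ _ (c \o s)) => x y px py cxy.
have tS z : pRt X p z -> sgp (torsion X) z.
  by move=> /(pRt_torsion p_pr); apply: sub_gen_smallest.
apply: s_inj; rewrite ?inE; [exact: tS | exact: tS |].
have /= /mulg1_eq := cP _ _ (pRt_hom s px) (pRt_hom s py) cxy.
by rewrite invgK.
Qed.

(** Within a fixed bounded nilpotent image, the elements of [p]-power order are
    separated from 1 by one finite [p]-quotient. *)
Lemma pRt_separated p : p \in P ->
  exists N, finite_pquot p N /\ forall x, pRt X p x -> N x -> x = 1.
Proof.
move=> Pp; have p_pr := P_prime Pp.
have [K [s [bK s_onto s_inj]]] := bX.
have nilK : nilpotent_group K by case: bK => n [Z [cZ _]]; exists n, Z.
have [||N pN Nbad] := @finite_pquot_avoid X p X (pRt X p `\ 1) id.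
- exact/finite_setD/pRt_finite.
- move=> x [px x1].
  have sx1 : s x <> 1.
    move=> sx; apply: x1; apply: s_inj; rewrite ?inE ?hom1 //.
      by apply: sub_gen_smallest; apply: (pRt_torsion p_pr).
    exact: sub1 (sgp_subgroup _).
  have [||N pN Nsx] := @nilpotent_residual K p (s x) p_pr nilK.
  + exact: p_bounded_nilpotent bK.
  + move=> m pm sxm; apply: sx1; have [k sxk] := pRt_hom s px.
    apply: coprime_expg sxk sxm; last by rewrite expn_gt0 prime_gt0.
    by apply: coprimeXl; rewrite prime_coprime.
  by exists (s @^-1` N); first exact: finite_pquot_preim.
exists N; split=> // x px Nx; apply: contrapT => x1.
exact: (Nbad x).
Qed.

(** Otherwise, by finiteness of the [p]-torsion, for every [p] of [P] a single
    [p]-element [h p] of [H] agrees with [x] in all finite [p]-quotients. In the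
    bounded nilpotent image [x] has finite order [n], so that [h p] is trivial
    unless [p] divides [n]; the product of the [h p] then agrees with [x] in all
    finite [p]-quotients for all [p], hence equals [x]. *)
Lemma separated_prime (x : X) : ~ range iX x ->
  exists p N, [/\ p \in P, finite_pquot p N & forall h, ~ N (x^-1 * iX h)].
Proof.
move=> Hx; apply: contrapT => no_sep.
(* otherwise every prime [p] of [P] provides an element of [H] that no finite
   [p]-quotient distinguishes from [x] *)
have ex p : exists hp, p \in P ->
    pRt H p hp /\ forall N, finite_pquot p N -> N (x^-1 * iX hp).
  have [Pp|] := boolP (p \in P); last by exists 1.
  apply: contrapT => no_h; apply: no_sep; have p_pr := P_prime Pp.
  have finH : finite_set (pRt H p).
    have [J [c cP]] := finite_colour (pRt_finite Pp).
    apply: (@finite_setI _ _ (c \o iX)) => h k ph pk /cP eq_hk.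
    by apply: iX_inj; apply: eq_hk; apply: pRt_hom.
  have [|N pN Nbad] := finite_pquot_avoid (p := p)
      (g := fun h => x^-1 * iX h) finH.
    move=> h ph; apply: contrapT => no_N; apply: no_h; exists h => _.
    by split=> // N pN; apply: contrapT => Nxh; apply: no_N; exists N.
  exists p, N; split=> // h Nxh.
  have [e [pe [m pm hem]]] := p_part_elt p_pr (H_periodic h).
  apply: (Nbad _ pe).
  have -> : x^-1 * iX (h ^+ e) = x^-1 * iX h * iX (h^-1 * h ^+ e).
    by rewrite -mulgA -gmulfM mulKVg.
  have gN : subgroup N by case: pN => /normal_grp.
  apply: (subM gN) => //; apply: (finite_pquot_coprime p_pr pN pm).
  by rewrite -homX hem hom1; apply: (sub1 gN).
have {ex} [h hP] := choice ex.
have [K [s [bK s_onto s_inj]]] := bX.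
have nilK : nilpotent_group K by case: bK => n [Z [cZ _]]; exists n, Z.
(* in the bounded nilpotent image the difference is a p'-element *)
have tK p : p \in P -> pi_elt K p^' (s (x^-1 * iX (h p))).
  move=> Pp; have p_pr := P_prime Pp; apply: contrapT => no_m.
  have [||N pN Ns] := @nilpotent_residual K p (s (x^-1 * iX (h p))) p_pr nilK.
  - exact: p_bounded_nilpotent bK.
  - move=> m pm sm; apply: no_m; exists m => //.
    by rewrite p'natE.
  - exact: (Ns (proj2 (hP p Pp) (s @^-1` N) (finite_pquot_preim s pN))).
have [n n_gt0 sxn] : exists2 n, (0 < n)%N & s x ^+ n = 1.
  have [p Pp] := P_ne; have p_pr := P_prime Pp.
  have gT := normal_grp (pi_elt_normal predT nilK).
  have T_of pi : pi_elt K pi `<=` pi_elt K predT.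
    by move=> u [m /andP[m_gt0 _] um]; exists m; rewrite // /pnat m_gt0 all_predT.
  have [m /andP[m_gt0 _] xm] : pi_elt K predT (s x); last by exists m.
  have -> : s x = s (iX (h p)) * (s (x^-1 * iX (h p)))^-1.
    by rewrite gmulfM homV invgM invgK mulKVg.
  apply: (subM gT); last by apply/(subV gT)/T_of/(tK p Pp).
  apply: (T_of p); rewrite -pRtE //; apply/pRt_hom/pRt_hom.
  by case: (hP p Pp).
have h1 p : p \in P -> ~~ (p %| n) -> h p = 1.
  move=> Pp pn; have p_pr := P_prime Pp; have [ph _] := hP p Pp.
  apply: iX_inj; rewrite hom1; apply: s_inj.
  - rewrite inE; apply: sub_gen_smallest.
    exact: (pRt_torsion p_pr (pRt_hom iX ph)).
  - by rewrite inE; apply: (sub1 (sgp_subgroup _)).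
  have gT := normal_grp (pi_elt_normal p^' nilK).
  have [m pm sm] : pi_elt K p^' (s (iX (h p))).
    have -> : s (iX (h p)) = s x * s (x^-1 * iX (h p)).
      by rewrite -gmulfM mulKVg.
    apply: (subM gT); last exact: tK.
    by exists n; rewrite ?p'natE.
  have [k hk] := pRt_hom s (pRt_hom iX ph).
  rewrite hom1; apply: coprime_expg hk sm; last by rewrite expn_gt0 prime_gt0.
  by apply: coprimeXl; rewrite prime_coprime // -p'natE //; case/andP: pm.
(* the product of the finitely many nontrivial [h p] *)
have prodh (l : seq nat) : uniq l -> exists k : H, forall p, p \in P ->
    forall (Q : groupType) (f : {multiplicative X -> Q}),
    finite_pquot p (ker f) -> f (iX k) = if p \in l then f (iX (h p)) else 1.
  elim: l => [_|q l IH /= /andP[ql /IH[k kP]]].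
    by exists 1 => p _ Q f _; rewrite !hom1.
  exists ((if q \in P then h q else 1) * k) => p Pp Q f pf.
  rewrite !gmulfM (kP p Pp Q f pf) inE; have p_pr := P_prime Pp.
  have [eq_pq|neq_pq] := eqVneq p q.
    by subst q; rewrite (negbTE ql) Pp mulg1.
  have -> : f (iX (if q \in P then h q else 1)) = 1.
    case: ifP => [Pq|_]; last by rewrite !hom1.
    have [[e he] _] := hP q Pq.
    apply: (finite_pquot_coprime p_pr pf (m := (q ^ e)%N)).
      rewrite Euclid_dvdX // negb_and dvdn_prime2 ?P_prime //.
      by rewrite neq_pq.
    by rewrite /ker /= -homX he !hom1.
  by rewrite mul1g.
have [k kP] := prodh (primes n) (primes_uniq n).
apply: Hx; exists k => //; apply: contrapT => neq_kx.
have [|p [N [Pp pN]]] := residual_p (x := x^-1 * iX k).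
  by move/mulg1_eq; rewrite invgK => /esym.
apply; have p_pr := P_prime Pp.
have [Q [f [f_onto fN]]] : exists (Q : groupType) (f : {multiplicative X -> Q}),
  onto f /\ forall x, f x = 1 <-> N x by apply: quotient_group; case: pN.
have kf : ker f = N by apply/seteqP; split=> y /=; rewrite /ker /= fN.
have /fN := proj2 (hP p Pp) N pN; rewrite gmulfM => fxh.
apply/fN; rewrite gmulfM (kP p Pp Q f) ?kf // mem_primes p_pr n_gt0 /=.
case: ifP => [_|/negbT /(h1 p Pp) hp1] //.
by move: fxh; rewrite hp1 !hom1.
Qed.

Lemma separable_factor : separable (fin_nilpotent_pi_group P) (range iX).
Proof.
move=> x /separated_prime[p [N [Pp pN Nx]]].
have [K [f [CK f_onto fN]]] := finite_nilquot_group
  (finite_pquot_nil (P_prime Pp) Pp pN).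
exists K, f; split=> // -[_ [h _ <-]] fh; apply: (Nx h).
by apply/fN; rewrite gmulfM homV fh mulVg.
Qed.
End Factor.

(** * Centrality of the normal series *)

Lemma expg_mod_eq (X : groupType) (x : X) n a b :
  x ^+ n = 1 -> a = b %[mod n] -> x ^+ a = x ^+ b.
Proof.
move=> xn ab; rewrite (divn_eq a n) (divn_eq b n) ab !expgnDr.
by rewrite !(mulnC _ n) !expgnA xn !expg1n.
Qed.

Lemma prime_order_group (Q : groupType) p : prime p -> ([set: Q] #= `I_p)%card ->
  (forall u : Q, u ^+ p = 1) /\
  forall u v : Q, u <> 1 -> exists c, v = u ^+ c.
Proof.
move=> p_pr oQ.
have finQ : finite_group Q by apply/finite_setP; exists p.
have [F [f [g fK gK]]] := finGroup_of finQ.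
have oF : #|[set: F]%G| = p.
  rewrite cardsT; apply/card_eq_II.
  by rewrite -(card_eqr oQ) card_eq_sym; apply: (card_finGroup (f := f)); exists g.
have Fp x : x \in [set: F]%G by rewrite finset.in_setT.
split=> [u|u v u1].
  by apply: (can_inj fK); rewrite homX hom1 -oF expg_cardG.
have /cycleP[c fv] : f v \in <[f u]>.
  rewrite -(@nt_gen_prime F [set: F]%G) ?oF // !inE andbT; apply/eqP => fu.
  by apply: u1; apply: (can_inj fK); rewrite hom1.
by exists c; apply: (can_inj fK); rewrite homX.
Qed.

(** A factor of order [p] is centralized by [X], because [X] acts on the whole
    series through a finite [p]-group: if conjugation by [g] raises to the power
    [c] modulo [S i], then [c ^ (p ^ k)] is congruent to 1 modulo [p] for some
    [k], hence so is [c] by Fermat. *)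
Lemma p_series_step (X : groupType) p n (S : nat -> set X) N :
  prime p -> normal_p_series p (pRt X p) n S -> finite_pquot p N ->
  (forall x, pRt X p x -> N x -> x = 1) ->
  forall i, (i < n)%N -> central_step p (S i) (S i.+1) /\
    forall x y, S i.+1 x -> ~ S i x -> S i.+1 y ->
      exists c, S i ((x ^+ c)^-1 * y).
Proof.
move=> p_pr [S0 Sn nS oS] [nN fN tN] sepN i lt_in.
have sS j : (j < n)%N -> S j `<=` S j.+1 by move=> /oS[Q [[]]].
have Sp d j : (j + d = n)%N -> S j `<=` pRt X p.
  elim: d j => [|d IH] j; first by rewrite addn0 => ->; rewrite Sn.
  move=> jdn; apply: subset_trans (IH j.+1 _); last by rewrite addSn -addnS.
  by apply: sS; rewrite -jdn addnS ltnS leq_addr.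
have nSi := nS i (ltnW lt_in); have nSi' := nS i.+1 lt_in.
have [Q [[sSi [T [e [f [e_inj re f_onto kf]]]]] oQ]] := oS i lt_in.
have [Qp Qgen] := prime_order_group p_pr oQ.
have inT x : S i.+1 x -> exists t, e t = x.
  by rewrite -re => -[t _ <-]; exists t.
have kfE t : f t = 1 <-> S i (e t).
  by rewrite -[S i (e t)]/((e @^-1` S i) t) -kf.
have gen x y : S i.+1 x -> ~ S i x -> S i.+1 y -> exists c, S i ((x ^+ c)^-1 * y).
  move=> /inT[t <-] Sx /inT[u <-].
  have [|c fu] := Qgen (f t) (f u); first by move/kfE.
  by exists c; rewrite -homX -homV -gmulfM; apply/kfE; rewrite gmulfM homV homX fu mulVg.
split=> //; split=> // [x g Sx|x /inT[t <-]]; last first.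
  by rewrite -homX; apply/kfE; rewrite homX.
have [Sx'|Sx'] := pselect (S i x).
  rewrite /commg; apply: (subM (normal_grp nSi)).
    exact: (subV (normal_grp nSi)).
  exact: normal_conj.
have [R [h [h_onto hS]]] := quotient_group nSi.
have [c Sc] := gen x (x ^ g) Sx Sx' (normal_conj _ nSi' Sx).
have hxg : h x ^ h g = h x ^+ c.
  move/hS: Sc; rewrite gmulfM homV homX homJ => hc.
  by rewrite -[LHS](mulVKg (h x ^+ c)) hc mulg1.
have hxp : h x ^+ p = 1.
  by have [t et] := inT x Sx; rewrite -et -!homX; apply/hS/kfE; rewrite homX.
have hxgk k : h x ^ (h g ^+ k) = h x ^+ (c ^ k)%N.
  elim: k => [|k IH]; first by rewrite conjg1 expg1.
  by rewrite expgSr conjgM IH conjXg hxg -expgnA expnS.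
have [k Nk] := tN g.
have xgk : [~ x, g ^+ (p ^ k)%N] = 1.
  apply: sepN.
    apply: (Sp _ _ (subnKC lt_in)); rewrite /commg; apply: (subM (normal_grp nSi')).
      exact: (subV (normal_grp nSi')).
    exact: normal_conj.
  rewrite commgEr; apply: (subM (normal_grp nN)) => //.
  by apply: normal_conj => //; apply: (subV (normal_grp nN)).
have cpk m : c ^ (p ^ m) = c %[mod p].
  elim: m => [|m IH]; first by rewrite expn0 expn1.
  by rewrite expnS expnM -modnXm fermat_little // modnXm IH.
apply/hS; rewrite homR; apply/eqP/conjg_fixP.
rewrite hxg -(expg_mod_eq hxp (cpk k)) -hxgk -homX -homJ; congr (h _).
by apply/conjg_fixP/eqP.
Qed.

(** * Permutational products *)

Definition eqmod (X : groupType) (N : set X) (x y : X) : Prop := N (x^-1 * y).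

Lemma eqmod_quotient (X : groupType) (N : set X) : normal_subgroup N ->
  exists (Q : groupType) (f : {multiplicative X -> Q}),
    onto f /\ forall x y, eqmod N x y <-> f x = f y.
Proof.
move=> nN; have [Q [f [f_onto fN]]] := quotient_group nN; exists Q, f.
split=> // x y; rewrite /eqmod -fN gmulfM homV; split=> [fxy|->].
  by rewrite -[RHS](mulVKg (f x)) fxy mulg1.
by rewrite mulVg.
Qed.

Lemma eqmod_refl (X : groupType) (N : set X) x : subgroup N -> eqmod N x x.
Proof. by move=> gN; rewrite /eqmod mulVg; apply: (sub1 gN). Qed.

Lemma eqmod_sym (X : groupType) (N : set X) x y :
  subgroup N -> eqmod N x y -> eqmod N y x.
Proof. by move=> gN /(subV gN); rewrite invgM invgK. Qed.

Lemma eqmod_trans (X : groupType) (N : set X) x y z :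
  subgroup N -> eqmod N x y -> eqmod N y z -> eqmod N x z.
Proof. by move=> gN Nxy Nyz; have := subM gN Nxy Nyz; rewrite -mulgA mulVKg. Qed.

Section Section_maps.
Variables (H X : groupType) (i : {multiplicative H -> X}).
Hypothesis i_inj : injective i.

Definition equivariant (r : X -> H) : Prop := forall h x, r (i h * x) = h * r x.

(** [H] acts freely on [X] by translations, so an invariant family of admissible
    values has an equivariant selection. *)
Lemma equivariant_choice (V : X -> set H) :
  (forall x, exists k, V x k) -> (forall h x k, V x k -> V (i h * x) (h * k)) ->
  exists r, equivariant r /\ forall x, V x (r x).
Proof.
move=> exV VM.
pose orb x : set X := [set y | exists h, y = i h * x].
have orbM h x : orb (i h * x) = orb x.
  apply/seteqP; split=> y [k ->]; first by exists (k * h); rewrite gmulfM mulgA.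
  by exists (k * h^-1); rewrite gmulfM homV -mulgA mulKg.
pose c x := xget 1 (orb x).
have cP x : orb x (c x).
  by apply: (@xgetPex _ 1 (orb x)); exists x, 1; rewrite hom1 mul1g.
have /choice[k kP] x : exists k, x = i k * c x.
  by have [h ->] := cP x; exists h^-1; rewrite homV mulKg.
have [v vP] := choice exV.
exists (fun x => k x * v (c x)); split=> [h x|x]; last first.
  by rewrite {1}(kP x); apply: VM; apply: vP.
have cM : c (i h * x) = c x by rewrite /c orbM.
rewrite cM mulgA; congr (_ * _); apply: i_inj; rewrite gmulfM.
apply: (@mulIg _ (c x)); rewrite -mulgA -kP.
by rewrite -{1}cM -kP.
Qed.

Definition coherent (N : set X) (r : X -> H) : Prop :=
  forall x y, eqmod N x y -> eqmod N (i (r x)) (i (r y)).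

(** Refining from one member of a chain to the next smaller one changes the
    values of the selection only modulo the larger member. *)
Lemma coherent_section (N : nat -> set X) t :
  (forall s, (s <= t)%N -> normal_subgroup (N s)) ->
  (forall s, (s < t)%N -> N s `<=` N s.+1) -> N t = setT ->
  exists r, equivariant r /\ forall s, (s <= t)%N -> coherent (N s) r.
Proof.
move=> nN sN Nt.
have sN' s u : (s + u <= t)%N -> N s `<=` N (s + u)%N.
  elim: u => [|u IH]; first by rewrite addn0 => _ x.
  by rewrite addnS => lt x /(IH (ltnW lt)); apply: sN.
suff: forall u s, (s + u = t)%N -> exists r, equivariant r /\
    forall v, (s <= v <= t)%N -> coherent (N v) r.
  move=> /(_ t 0%N erefl)[r [rH rc]]; by exists r; split.
elim=> [|u IH] s.
  rewrite addn0 => ->.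
  have [||r [rH _]] := @equivariant_choice (fun=> setT) => //.
    by exists 1.
  exists r; split=> // v; rewrite -eqn_leq => /eqP <- x y _.
  by rewrite /eqmod Nt.
move=> stu; have lt_st : (s < t)%N by rewrite -stu addnS ltnS leq_addr.
have [|r [rH rc]] := IH s.+1; first by rewrite addSn -addnS.
have nNs := nN s (ltnW lt_st); have gNs := normal_grp nNs.
have [Q [f [f_onto fN]]] := eqmod_quotient nNs.
pose orb x : set X := [set y | exists h, eqmod (N s) (i h * x) y].
have orbE x y : eqmod (N s) x y -> orb x = orb y.
  move=> /fN fxy; apply/seteqP; split=> z [h /fN fz]; exists h; apply/fN;
  by rewrite -fz !gmulfM fxy.
have orbM h x : orb (i h * x) = orb x.
  apply/seteqP; split=> y [k Nk].
    by exists (k * h); rewrite gmulfM -mulgA.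
  by exists (k * h^-1); rewrite gmulfM homV -mulgA mulKg.
pose c x := xget 1 (orb x).
have cP x : orb x (c x).
  apply: (@xgetPex _ 1 (orb x)); exists x, 1; rewrite hom1 mul1g.
  exact: eqmod_refl.
pose V x : set H := [set k | exists h, eqmod (N s) (i h * c x) x /\
                        eqmod (N s) (i (h * r (c x))) (i k)].
have [x|h x k [g [Ngc Ngk]]|r' [r'H r'V]] := @equivariant_choice V.
- have [h /fN fhx] := cP x; exists (h^-1 * r (c x)), h^-1.
  by split; apply/fN; rewrite ?gmulfM // -fhx !homV gmulfM mulKg.
- have cM : c (i h * x) = c x by rewrite /c orbM.
  exists (h * g); rewrite cM; move/fN: Ngc; move/fN: Ngk.
  split; apply/fN; first by rewrite [i (h * g)]gmulfM -mulgA [LHS]gmulfM Ngc -gmulfM.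
  by rewrite -mulgA [i (h * (_ * _))]gmulfM [LHS]gmulfM Ngk -!gmulfM.
exists r'; split=> // v /andP[]; rewrite leq_eqVlt => /orP[/eqP <- _|lt_sv le_vt] x y xy.
  have cxy : c x = c y by rewrite /c (orbE _ _ xy).
  have [h [/fN fh /fN fhr]] := r'V x; have [k [/fN fk /fN fkr]] := r'V y.
  apply/fN; rewrite -fhr -fkr cxy !gmulfM; congr (_ * _).
  move/fN: xy; rewrite -fh -fk !gmulfM cxy; exact: mulIg.
have sNv : N s `<=` N v by rewrite -(subnKC (ltnW lt_sv)); apply: sN'; rewrite subnKC // ltnW.
have [R [g [g_onto gN]]] := eqmod_quotient (nN v le_vt).
have r'r z : g (i (r' z)) = g (i (r z)).
  have [h [Nh Nhr]] := r'V z.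
  have /gN <- : eqmod (N v) (i (h * r (c z))) (i (r' z)) by apply: sNv.
  rewrite -rH; apply/gN; apply: rc; first by rewrite lt_sv.
  exact: sNv.
apply/gN; rewrite !r'r; apply/gN; apply: rc => //.
by rewrite lt_sv.
Qed.
End Section_maps.

(** For an invariant equivalence [E], the kernel of the action on its classes. *)
Definition class_kernel (X : groupType) (W : Type) (act : X -> W -> W)
    (E : W -> W -> Prop) : set X := [set g | forall w, E w (act g w)].

Lemma is_actionVK (X : groupType) W (act : X -> W -> W) g w :
  is_action act -> act g (act g^-1 w) = w.
Proof. by move=> [act1 actM]; rewrite -actM mulgV act1. Qed.

Lemma is_actionKV (X : groupType) W (act : X -> W -> W) g w :
  is_action act -> act g^-1 (act g w) = w.
Proof. by move=> [act1 actM]; rewrite -actM mulVg act1. Qed.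

Section ClassKernel.
Variables (X : groupType) (W : Type) (act : X -> W -> W) (E : W -> W -> Prop).
Hypothesis act_act : is_action act.
Hypothesis E_refl : forall w, E w w.
Hypothesis E_sym : forall v w, E v w -> E w v.
Hypothesis E_trans : forall u v w, E u v -> E v w -> E u w.
Hypothesis E_act : forall g v w, E v w -> E (act g v) (act g w).

Lemma class_kernel_normal : normal_subgroup (class_kernel act E).
Proof.
have [act1 actM] := act_act; split; last first.
  move=> g x Kx w; rewrite /conjg !actM -{1}(is_actionKV g w act_act).
  exact: E_act.
apply/subgroupP; split=> [w|x y Kx Ky w|x Kx w].
- by rewrite act1.
- by rewrite actM; apply: E_trans (Ky w) _; apply: Kx.
- apply: E_sym; rewrite -{2}(is_actionVK x w act_act); exact: Kx.
Qed.

Lemma class_kernel_index (I : finType) (c : W -> I) :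
  (forall v w, c v = c w -> E v w) -> fin_index setT (class_kernel act E).
Proof.
move=> cE; have [act1 actM] := act_act.
have [/contrapT [w0 _]|W0] := pselect (~ ~ exists w : W, True); last first.
  exists unit, (fun=> tt) => x y _ _ _ w.
  by case: W0 => nex; apply: nex; exists w.
have ex i : exists v, (exists w, c w = i) -> c v = i.
  have [[w cw]|no] := pselect (exists w, c w = i); first by exists w.
  by exists w0 => /no.
have [s sP] := choice ex.
exists {ffun I -> I}, (fun g => [ffun i => c (act g (s i))]) => x y _ _ /ffunP eq_xy w.
rewrite actM -{1}(is_actionKV x w act_act); apply: E_act.
have Ew : E w (s (c w)) by apply/E_sym/cE/sP; exists w.
apply: E_trans (E_act x Ew) _; apply: E_trans (E_act y (E_sym Ew)).
by apply: cE; have := eq_xy (c w); rewrite !ffunE.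
Qed.
End ClassKernel.

Section PermutationalProduct.
Variables (H A B G : groupType).
Variables (iA : {multiplicative H -> A}) (iB : {multiplicative H -> B}).
Variables (jA : {multiplicative A -> G}) (jB : {multiplicative B -> G}).
Hypothesis G_amalgam : is_amalgam iA iB jA jB.
Variables (rA : A -> H) (rB : B -> H).
Hypothesis rA_eq : equivariant iA rA.
Hypothesis rB_eq : equivariant iB rB.

(** The permutational product of B. H. Neumann: each factor acts on [A * B] by
    left translations of its own coordinate and drags along the [H]-part of the
    other one. *)
Lemma permutational_product : exists act : G -> A * B -> A * B,
  [/\ is_action act,
      forall a w, act (jA a) w =
        (a * w.1, iB (rA (a * w.1) * (rA w.1)^-1) * w.2) &
      forall b w, act (jB b) w =
        (iA (rB (b * w.2) * (rB w.2)^-1) * w.1, b * w.2)].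
Proof.
have [|||act [act_act actA actB]] := amalgam_action G_amalgam
  (actA := fun a w => (a * w.1, iB (rA (a * w.1) * (rA w.1)^-1) * w.2))
  (actB := fun b w => (iA (rB (b * w.2) * (rB w.2)^-1) * w.1, b * w.2)).
- split=> [[x y]|a a' [x y]] /=; first by rewrite !mul1g mulgV hom1 mul1g.
  by rewrite !mulgA -gmulfM -!mulgA mulKg !mulgA.
- split=> [[x y]|b b' [x y]] /=; first by rewrite !mul1g mulgV hom1 mul1g.
  by rewrite !mulgA -gmulfM -!mulgA mulKg !mulgA.
- by move=> h [x y] /=; rewrite rA_eq rB_eq !mulgK.
by exists act; split=> [|a w|b w] //; [apply: actA | apply: actB].
Qed.
End PermutationalProduct.

(** The [H]-part by which a translation drags the other coordinate is the same,
    modulo the lower term, on points that agree modulo the upper term: either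
    [H] has nothing new in this step, so the section takes the same values
    modulo the lower term, or [H] covers the step and its elements are central
    modulo the lower term. *)
Lemma drag_congr (H A : groupType) (i : {multiplicative H -> A}) (r : A -> H)
    (p : nat) (M M' : set A) : normal_subgroup M -> normal_subgroup M' ->
  central_step p M M' -> equivariant i r -> coherent i M r -> coherent i M' r ->
  i @^-1` M' `<=` i @^-1` M \/ M' `<=` prod_set (i @` (i @^-1` M')) M ->
  forall a x y, eqmod M' x y ->
    (i @^-1` M) ((r (a * x) * (r x)^-1)^-1 * (r (a * y) * (r y)^-1)).
Proof.
move=> nM nM' [sMM' zM' _] r_eq rM rM' alt a x y xy.
have [Q [f [f_onto fM]]] := eqmod_quotient nM.
rewrite /= -/(eqmod _ _ _) gmulfM homV -/(eqmod _ _ _); apply/fM.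
case: alt => [sHM|sM'].
  have same u v : eqmod M' u v -> f (i (r u)) = f (i (r v)).
    move=> /rM' uv; apply/fM; rewrite /eqmod -homV -gmulfM; apply: sHM.
    by rewrite /= gmulfM homV.
  rewrite !gmulfM !homV; rewrite (same x y) // (same (a * x) (a * y)) //.
  by rewrite /eqmod invgM -mulgA mulKg.
have /sM' [_ [h M'h <-] Mh] := xy.
have cent z : commute (f (i h)) (f z).
  have := zM' _ z M'h; have := fM [~ i h, z] 1; rewrite /eqmod mulg1.
  move=> fE Mc; have /fE : M [~ i h, z]^-1 by apply: (subV (normal_grp nM)).
  by rewrite hom1 homR => /eqP/commgP.
have fy : f y = f (i h) * f x.
  rewrite (cent x) -gmulfM; apply/esym/fM.
  by rewrite /eqmod invgM -mulgA.
have fr u v : f v = f (i h) * f u -> f (i (r v)) = f (i h) * f (i (r u)).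
  move=> fv; rewrite -gmulfM -gmulfM -r_eq; apply/esym/fM/rM/fM.
  by rewrite gmulfM fv.
rewrite !gmulfM !homV (fr x y fy) (fr (a * x) (a * y)).
  transitivity (f (i h) * (f (i (r (a * x))) * (f (i (r x)))^-1) * (f (i h))^-1).
    by rewrite -homV -gmulfM cent mulgK.
  by rewrite invgM !mulgA.
by rewrite !gmulfM fy mulgA -(cent a) mulgA.
Qed.

Lemma eqmod_drag (X : groupType) (N : set X) u v x y : normal_subgroup N ->
  N (u^-1 * v) -> eqmod N (x^-1 * y) ((u * x)^-1 * (v * y)).
Proof.
move=> nN; have [Q [f [f_onto fN]]] := eqmod_quotient nN.
move/fN=> fuv; apply/fN; rewrite !gmulfM !homV !gmulfM fuv.
by rewrite invgM -mulgA mulKg.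
Qed.

Section Higman.
Variables (H A B G : groupType).
Variables (iA : {multiplicative H -> A}) (iB : {multiplicative H -> B}).
Variables (jA : {multiplicative A -> G}) (jB : {multiplicative B -> G}).
Hypothesis G_amalgam : is_amalgam iA iB jA jB.

Variables (p t : nat) (NA : nat -> set A) (NB : nat -> set B).
Hypothesis p_pr : prime p.
Hypothesis nNA : forall s, (s <= t)%N -> normal_subgroup (NA s).
Hypothesis nNB : forall s, (s <= t)%N -> normal_subgroup (NB s).
Hypothesis NAB : forall s, (s <= t)%N -> iA @^-1` NA s = iB @^-1` NB s.
Hypothesis stepA : forall s, (s < t)%N -> central_step p (NA s) (NA s.+1).
Hypothesis stepB : forall s, (s < t)%N -> central_step p (NB s) (NB s.+1).
Hypothesis stepH : forall s, (s < t)%N ->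
  iA @^-1` NA s.+1 `<=` iA @^-1` NA s \/
  (NA s.+1 `<=` prod_set (iA @` (iA @^-1` NA s.+1)) (NA s) /\
   NB s.+1 `<=` prod_set (iB @` (iB @^-1` NB s.+1)) (NB s)).
Hypothesis NAt : NA t = setT.
Hypothesis NBt : NB t = setT.

(** Higman's criterion. The chain of pairs [(NA s, NB s)] defines nested equivalence relations on
    [A * B] that [G] preserves; between consecutive ones, [G] preserves moreover
    the differences of equivalent points. An element moving every point within
    its class of level [s.+1] therefore moves all these points by constant
    differences of exponent [p], and its [p]-th power stays within the classes
    of level [s]. *)
Lemma higman : finite_pquot p (NA 0) -> finite_pquot p (NB 0) ->
  exists M, [/\ finite_pquot p M, jA @^-1` M `<=` NA 0 & jB @^-1` M `<=` NB 0].
Proof.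
move=> [_ [IA [cA cAP]] _] [_ [IB [cB cBP]] _].
have [iA_inj iB_inj _ _] := G_amalgam.
have sNA s : (s < t)%N -> NA s `<=` NA s.+1 by case/stepA.
have sNB s : (s < t)%N -> NB s `<=` NB s.+1 by case/stepB.
have [rA [rA_eq rA_co]] := coherent_section iA_inj nNA sNA NAt.
have [rB [rB_eq rB_co]] := coherent_section iB_inj nNB sNB NBt.
have [act [act_act actA actB]] := permutational_product G_amalgam rA_eq rB_eq.
have [act1 actM] := act_act.
have gNA s : (s <= t)%N -> subgroup (NA s) by move=> /nNA/normal_grp.
have gNB s : (s <= t)%N -> subgroup (NB s) by move=> /nNB/normal_grp.
pose E s (v w : A * B) := eqmod (NA s) v.1 w.1 /\ eqmod (NB s) v.2 w.2.
have E_refl s w : (s <= t)%N -> E s w w.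
  by move=> le_st; split; apply: eqmod_refl; [apply: gNA | apply: gNB].
have E_sym s v w : (s <= t)%N -> E s v w -> E s w v.
  by move=> le_st [Ev Ew]; split; apply: eqmod_sym => //; [apply: gNA | apply: gNB].
have E_trans s u v w : (s <= t)%N -> E s u v -> E s v w -> E s u w.
  move=> le_st [Eu Eu'] [Ev Ev']; split.
    by apply: eqmod_trans Ev => //; apply: gNA.
  by apply: eqmod_trans Ev' => //; apply: gNB.
pose inv s g := forall v w, E s.+1 v w ->
  eqmod (NA s) (v.1^-1 * w.1) ((act g v).1^-1 * (act g w).1) /\
  eqmod (NB s) (v.2^-1 * w.2) ((act g v).2^-1 * (act g w).2).
have inv_E s g : (s < t)%N -> inv s g -> forall v w, E s.+1 v w -> E s.+1 (act g v) (act g w).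
  move=> lt_st gP v w Evw; have [gA gB] := gP v w Evw; case: Evw => Ev Ew.
  split; rewrite /eqmod.
    rewrite -(mulVKg (v.1^-1 * w.1) (_^-1 * _)); apply: (subM (gNA _ lt_st)) => //.
    exact: sNA.
  rewrite -(mulVKg (v.2^-1 * w.2) (_^-1 * _)); apply: (subM (gNB _ lt_st)) => //.
  exact: sNB.
have invM s g h : (s < t)%N -> inv s g -> inv s h -> inv s (g * h).
  move=> lt_st gP hP v w Evw; have [hA hB] := hP v w Evw.
  have [gA gB] := gP _ _ (inv_E s h lt_st hP v w Evw); rewrite !actM.
  split; first exact: eqmod_trans (gNA _ (ltnW lt_st)) hA gA.
  exact: eqmod_trans (gNB _ (ltnW lt_st)) hB gB.
have inv_all s g : (s < t)%N -> inv s g.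
  move=> lt_st; have le_st := ltnW lt_st.
  suff: inv s g /\ inv s g^-1 by case.
  apply: (amalgam_ind G_amalgam (Y := [set g | inv s g /\ inv s g^-1])).
  - apply/subgroupP; split=> /=.
    + by rewrite invg1; split=> v w [Ev Ew]; rewrite !act1; split;
         apply: eqmod_refl; [apply: gNA | apply: gNB | apply: gNA | apply: gNB].
    + by move=> x y [xP xVP] [yP yVP]; rewrite invgM; split; apply: invM.
    + by move=> x [xP xVP]; rewrite invgK.
  - suff invA a : inv s (jA a) by move=> a; rewrite /= -homV; split; apply: invA.
    move=> v w [Ev Ew]; rewrite !actA /=; split.
      by rewrite invgM -mulgA mulKg; apply: eqmod_refl; apply: gNA.
    apply: eqmod_drag; first exact: nNB.
    rewrite -homV -gmulfM -[NB s _]/((iB @^-1` NB s) _) -NAB //.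
    apply: (drag_congr (nNA le_st) (nNA lt_st) (stepA lt_st)) => //.
    + exact: rA_co.
    + exact: rA_co.
    + by case: (stepH lt_st) => [|[]]; [left | right].
  - suff invB b : inv s (jB b) by move=> b; rewrite /= -homV; split; apply: invB.
    move=> v w [Ev Ew]; rewrite !actB /=; split; last first.
      by rewrite invgM -mulgA mulKg; apply: eqmod_refl; apply: gNB.
    apply: eqmod_drag; first exact: nNA.
    rewrite -homV -gmulfM -[NA s _]/((iA @^-1` NA s) _) NAB //.
    apply: (drag_congr (nNB le_st) (nNB lt_st) (stepB lt_st)) => //.
    + exact: rB_co.
    + exact: rB_co.
    + by rewrite -!NAB //; case: (stepH lt_st) => [|[]]; [left | right; rewrite NAB].
have E_act s g : (s <= t)%N -> forall v w, E s v w -> E s (act g v) (act g w).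
  case: s => [|s]; last by move=> lt_st; apply: inv_E => //; apply: inv_all.
  rewrite leq_eqVlt => /orP[/eqP t0|lt_0t] v w Evw.
    by rewrite /E t0 NAt NBt.
  have [gA gB] : eqmod (NA 0) (v.1^-1 * w.1) ((act g v).1^-1 * (act g w).1) /\
      eqmod (NB 0) (v.2^-1 * w.2) ((act g v).2^-1 * (act g w).2).
    by apply: inv_all => //; case: Evw => Ev Ew; split; [apply: sNA | apply: sNB].
  case: Evw => Ev Ew; split; rewrite /eqmod.
    by rewrite -(mulVKg (v.1^-1 * w.1) (_^-1 * _)); apply: (subM (gNA _ (ltnW lt_0t))).
  by rewrite -(mulVKg (v.2^-1 * w.2) (_^-1 * _)); apply: (subM (gNB _ (ltnW lt_0t))).
have pow s g : (s < t)%N -> (forall w, E s.+1 w (act g w)) ->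
    forall w, E s w (act (g ^+ p) w).
  move=> lt_st gE w; have le_st := ltnW lt_st.
  have [QA [fA [_ fAN]]] := eqmod_quotient (nNA le_st).
  have [QB [fB [_ fBN]]] := eqmod_quotient (nNB le_st).
  pose dA := w.1^-1 * (act g w).1; pose dB := w.2^-1 * (act g w).2.
  pose q n := act (g ^+ n) w.
  have qS n : q n.+1 = act g (q n) by rewrite /q expgS actM.
  have q0 : q 0%N = w by rewrite /q expg0 act1.
  have step n : fA ((q n).1^-1 * (q n.+1).1) = fA dA /\
                fB ((q n).2^-1 * (q n.+1).2) = fB dB.
    elim: n => [|n [IHA IHB]]; first by rewrite qS q0.
    have [/fAN gA /fBN gB] := inv_all s g lt_st _ _ (gE (q n)).
    by rewrite -!qS in gA gB; rewrite -gA -gB.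
  have powd n : fA (q n).1 = fA w.1 * fA dA ^+ n /\
                fB (q n).2 = fB w.2 * fB dB ^+ n.
    elim: n => [|n [IHA IHB]]; first by rewrite q0 !mulg1.
    have [stA stB] := step n.
    by rewrite !expgSr !mulgA -IHA -IHB -stA -stB -!gmulfM !mulVKg.
  have [dA1 dB1] : NA s.+1 dA /\ NB s.+1 dB by apply: gE.
  have [_ _ pA] := stepA lt_st; have [_ _ pB] := stepB lt_st.
  have [wA wB] := powd p.
  split; [apply/fAN; rewrite wA -homX | apply/fBN; rewrite wB -homX].
    rewrite -[fA w.1]mulg1; congr (_ * _); rewrite ?mulg1 //.
    by rewrite -(hom1 fA); apply/fAN; rewrite /eqmod invg1 mul1g; apply: pA.
  rewrite -[fB w.2]mulg1; congr (_ * _); rewrite ?mulg1 //.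
  by rewrite -(hom1 fB); apply/fBN; rewrite /eqmod invg1 mul1g; apply: pB.
have tors g : forall u s, (s + u = t)%N -> forall w, E s w (act (g ^+ (p ^ u)%N) w).
  elim=> [|u IH] s; first by rewrite addn0 => -> w; rewrite /E NAt NBt.
  move=> stu; rewrite expnS mulnC expgnA; apply: pow.
    by rewrite -stu addnS ltnS leq_addr.
  by apply: IH; rewrite addSn -addnS.
exists (class_kernel act (E 0%N)); split; [split | |].
- by apply: class_kernel_normal => //; move=> *;
    [apply: E_refl | apply: E_sym | apply: E_trans; eauto | apply: E_act].
- apply: (@class_kernel_index _ _ _ _ act_act _ _ _ (IA * IB)%type (fun w => (cA w.1, cB w.2))).
  + by move=> *; apply: E_sym.
  + by move=> u v w; apply: E_trans.
  + by move=> *; apply: E_act.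
  + by move=> v w [cvw cvw']; split; [apply: cAP | apply: cBP].
- by move=> g; exists t; apply: tors.
- by move=> a /(_ (1, 1))[+ _]; rewrite actA /= /eqmod invg1 mul1g mulg1.
- by move=> b /(_ (1, 1))[_ +]; rewrite actB /= /eqmod invg1 mul1g mulg1.
Qed.
End Higman.

(** * Finite [p]-quotients of the amalgam *)

Lemma central_step_refl (X : groupType) p (M : set X) :
  normal_subgroup M -> central_step p M M.
Proof.
move=> nM; have gM := normal_grp nM; split=> // [x g Mx|x Mx].
  by rewrite /commg; apply: (subM gM); [apply: (subV gM) | apply: normal_conj].
exact: (subX gM).
Qed.

Lemma central_step_prod (X : groupType) p (M M' L : set X) :
  normal_subgroup L -> central_step p M M' ->
  central_step p (prod_set M L) (prod_set M' L).
Proof.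
move=> nL [sM cM pM]; have [Q [f [f_onto fL]]] := quotient_group nL.
split=> [x|x g|x]; rewrite !(prod_setE _ fL) => -[y My /= fy].
- by exists y; [apply: sM|].
- by exists [~ y, g]; [apply: cM | rewrite !homR fy].
- by exists (y ^+ p); [apply: pM | rewrite !homX fy].
Qed.

Lemma prod_set_absorb (X : groupType) (M L : set X) :
  subgroup L -> subgroup M -> M `<=` L -> prod_set M L = L.
Proof.
move=> gL gM sML; apply/seteqP; split; last exact: prod_setr.
move=> x [y My Lyx]; rewrite -(mulVKg y x); apply: (subM gL) => //.
exact: sML.
Qed.

Lemma prod_setT (X : groupType) (L : set X) : subgroup L -> prod_set setT L = setT.
Proof. by move=> gL; apply/seteqP; split=> // x _; apply: prod_setl. Qed.

Section Linked.
Variables (H A B : groupType) (p : nat).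
Variables (iA : {multiplicative H -> A}) (iB : {multiplicative H -> B}).

Definition balanced (M : set A) (N : set B) : Prop :=
  [/\ normal_subgroup M, normal_subgroup N & iA @^-1` M = iB @^-1` N].

(** The disjunction is the one required by [drag_congr], on both sides at once. *)
Definition link (M : set A) (N : set B) (M' : set A) (N' : set B) : Prop :=
  [/\ central_step p M M', central_step p N N' &
      iA @^-1` M' `<=` iA @^-1` M \/
      (M' `<=` prod_set (iA @` (iA @^-1` M')) M /\
       N' `<=` prod_set (iB @` (iB @^-1` N')) N)].

Inductive linked : set A -> set B -> Prop :=
| linked_top : linked setT setT
| linked_step M N M' N' :
    balanced M N -> link M N M' N' -> linked M' N' -> linked M N.

Lemma linked_chain M N : linked M N -> exists t NA NB,
  [/\ forall s, (s <= t)%N -> balanced (NA s) (NB s),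
      forall s, (s < t)%N -> link (NA s) (NB s) (NA s.+1) (NB s.+1),
      NA 0 = M /\ NB 0 = N & NA t = setT /\ NB t = setT].
Proof.
elim=> [|{}M {}N M' N' bal lk _ [t [NA [NB [balt lkt [NA0 NB0] [NAt NBt]]]]]].
  exists 0, (fun=> setT), (fun=> setT); split=> // s _.
  by split=> //; apply: normal_full.
exists t.+1, (fun s => if s is s'.+1 then NA s' else M),
  (fun s => if s is s'.+1 then NB s' else N); split=> //.
  by move=> [|s] // le_st; apply: balt.
by move=> [|s] // lt_st; [rewrite NA0 NB0 | apply: lkt].
Qed.
End Linked.

Lemma linked_quotient (H A B G : groupType) (p : nat)
    (iA : {multiplicative H -> A}) (iB : {multiplicative H -> B})
    (jA : {multiplicative A -> G}) (jB : {multiplicative B -> G}) NA NB :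
  is_amalgam iA iB jA jB -> finite_pquot p NA -> finite_pquot p NB ->
  linked p iA iB NA NB ->
  exists M, [/\ finite_pquot p M, jA @^-1` M `<=` NA & jB @^-1` M `<=` NB].
Proof.
move=> G_am pNA pNB /linked_chain[t [CA [CB [bal lk [CA0 CB0] [CAt CBt]]]]].
rewrite -CA0 -CB0 in pNA pNB *.
apply: (higman G_am (t := t)) => //.
- by move=> s /bal[].
- by move=> s /bal[].
- by move=> s /bal[].
- by move=> s /lk[].
- by move=> s /lk[].
- by move=> s /lk[].
Qed.

Section FromSeries.
Variables (H A B : groupType) (p : nat).
Variables (iA : {multiplicative H -> A}) (iB : {multiplicative H -> B}).
Hypothesis p_pr : prime p.
Hypothesis H_periodic : periodic H.
Variables (NA : set A) (NB : set B).
Hypothesis pNA : finite_pquot p NA.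
Hypothesis pNB : finite_pquot p NB.

Let nNA : normal_subgroup NA. Proof. by case: pNA. Qed.
Let nNB : normal_subgroup NB. Proof. by case: pNB. Qed.

(** Above subgroups containing [H] the two sides may be climbed one after the
    other. *)
Lemma linked_above (L : set A) (K : set B) :
  normal_subgroup L -> normal_subgroup K -> NA `<=` L -> NB `<=` K ->
  iA @^-1` L = setT -> iB @^-1` K = setT -> linked p iA iB L K.
Proof.
move=> nL nK sNL sNK LH KH.
have gL := normal_grp nL; have gK := normal_grp nK.
have [n [Z [[nZ cZ _] Z0 Zn]]] := finite_pquot_chain p_pr pNA.
have [m [Y [[nY cY _] Y0 Ym]]] := finite_pquot_chain p_pr pNB.
have ZH i : (i <= n)%N -> iA @^-1` prod_set (Z i) L = setT.
  move=> le_in; apply/seteqP; split=> // h _; apply: prod_setr.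
    exact/normal_grp/nZ.
  by rewrite -[L _]/((iA @^-1` L) h) LH.
have YH j : (j <= m)%N -> iB @^-1` prod_set (Y j) K = setT.
  move=> le_jm; apply/seteqP; split=> // h _; apply: prod_setr.
    exact/normal_grp/nY.
  by rewrite -[K _]/((iB @^-1` K) h) KH.
have linkedY d j : (j + d = m)%N -> linked p iA iB setT (prod_set (Y j) K).
  elim: d j => [|d IH] j jdm.
    by move: jdm; rewrite addn0 => ->; rewrite Ym prod_setT //; apply: linked_top.
  have lt_jm : (j < m)%N by rewrite -jdm addnS ltnS leq_addr.
  apply: linked_step (IH j.+1 _); last by rewrite addSn -addnS.
    split; [exact: normal_full | | by rewrite YH // ltnW].
    by apply: prod_normal => //; apply/nY/ltnW.
  split; last by left.
    exact/central_step_refl/normal_full.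
  by apply: central_step_prod => //; apply: cY.
have linkedZ d i : (i + d = n)%N -> linked p iA iB (prod_set (Z i) L) K.
  elim: d i => [|d IH] i idn.
    move: idn; rewrite addn0 => ->; rewrite Zn prod_setT //.
    have <- : prod_set (Y 0) K = K.
      by rewrite Y0; apply: prod_set_absorb => //; apply: normal_grp.
    exact: linkedY.
  have lt_in : (i < n)%N by rewrite -idn addnS ltnS leq_addr.
  apply: linked_step (IH i.+1 _); last by rewrite addSn -addnS.
    split=> //; last by rewrite ZH ?KH // ltnW.
    by apply: prod_normal => //; apply/nZ/ltnW.
  split; last by left; rewrite !ZH // ltnW.
    by apply: central_step_prod => //; apply: cZ.
  exact: central_step_refl.
have <- : prod_set (Z 0) L = L.
  by rewrite Z0; apply: prod_set_absorb => //; apply: normal_grp.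
exact: linkedZ.
Qed.
End FromSeries.

(** Modulo [N] an element of [H] is its own [p]-part, which lies in [S] as soon
    as it does so modulo [N]; the description on the right does not mention
    [N]. *)
Lemma preim_prod (H X : groupType) (i : {multiplicative H -> X}) p (S N : set X) :
  prime p -> periodic H -> finite_pquot p N -> normal_subgroup (pRt X p) ->
  (forall x, pRt X p x -> N x -> x = 1) -> normal_subgroup S -> S `<=` pRt X p ->
  i @^-1` prod_set S N =
  [set h | exists e, (i @^-1` S) (h ^+ e) /\
    exists2 m, ~~ (p %| m) & (h^-1 * h ^+ e) ^+ m = 1].
Proof.
move=> p_pr H_periodic pN nP sepN nS sSP; have nN : normal_subgroup N by case: pN.
have gN := normal_grp nN.
have inN h e m : ~~ (p %| m) -> (h^-1 * h ^+ e) ^+ m = 1 -> N (i (h^-1 * h ^+ e)).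
  move=> pm hem; apply: (finite_pquot_coprime p_pr pN pm).
  by rewrite -homX hem hom1; apply: (sub1 gN).
apply/seteqP; split=> h /= [].
  move=> s Ss Nsh; have [e [pe [m pm hem]]] := p_part_elt p_pr (H_periodic h).
  exists e; split; last by exists m.
  suff <- : s = i (h ^+ e) by [].
  apply: divg1_eq; apply: sepN.
    apply: (subM (normal_grp nP)); first exact: sSP.
    by apply: (subV (normal_grp nP)); apply: pRt_hom.
  have [Q [f [_ fN]]] := eqmod_quotient nN.
  have /fN fs : eqmod N s (i h) by [].
  have /fN fh : eqmod N (i h) (i (h ^+ e)).
    by rewrite /eqmod -homV -gmulfM; apply: inN pm hem.
  have : eqmod N 1 (s * (i (h ^+ e))^-1).
    by apply/fN; rewrite gmulfM homV -fh fs mulgV hom1.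
  by rewrite /eqmod invg1 mul1g.
move=> e [Se [m pm hem]]; exists (i (h ^+ e)) => //.
by rewrite -(invgK (_ * _)) invgM invgK -homV -gmulfM; apply: (subV gN); apply: inN pm hem.
Qed.

Lemma p_series_incr (X : groupType) p n Y (S : nat -> set X) :
  normal_p_series p Y n S -> forall i j, (i <= j <= n)%N -> S i `<=` S j.
Proof.
move=> [_ _ _ oS] i j /andP[/subnKC <-]; elim: (j - i)%N => [|d IH].
  by rewrite addn0 => _ x.
rewrite addnS => lt_n x /(IH (ltnW lt_n)).
by have [Q [[sS _] _]] := oS _ lt_n; apply: sS.
Qed.

Section Condition.
Variables (H A B : groupType) (p : nat).
Variables (iA : {multiplicative H -> A}) (iB : {multiplicative H -> B}).
Hypothesis p_pr : prime p.
Hypothesis H_periodic : periodic H.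
Variables (NA : set A) (NB : set B).
Hypothesis pNA : finite_pquot p NA.
Hypothesis pNB : finite_pquot p NB.
Hypothesis sepA : forall x, pRt A p x -> NA x -> x = 1.
Hypothesis sepB : forall x, pRt B p x -> NB x -> x = 1.
Hypothesis nPA : normal_subgroup (pRt A p).
Hypothesis nPB : normal_subgroup (pRt B p).
Hypothesis iA_inj : injective iA.
Hypothesis iB_inj : injective iB.

(** The two series are merged into one path from the pair of trivial groups:
    as long as one of them can be climbed without enlarging its intersection
    with [H] this is done; otherwise both next intersections are the successor
    of the current one in the common chain, and both series are climbed. *)
Lemma condition_N_linked : condition_N iA iB p -> linked p iA iB NA NB.
Proof.
move=> [k [S [m [T [serS serT eqST]]]]].
have nNA : normal_subgroup NA by case: pNA.
have nNB : normal_subgroup NB by case: pNB.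
have [S0 Sk nS oS] := serS; have [T0 Tm nT oT] := serT.
have incS := p_series_incr serS; have incT := p_series_incr serT.
have stepS := p_series_step p_pr serS pNA sepA.
have stepT := p_series_step p_pr serT pNB sepB.
pose f i := iA @^-1` S i; pose g j := iB @^-1` T j.
have fg i : (i <= k)%N -> exists2 j, (j <= m)%N & g j = f i.
  move=> le_ik; have : [set g j | j in `I_m.+1] (f i) by rewrite -eqST; exists i.
  by move=> [j /= le_jm gj]; exists j.
have gf j : (j <= m)%N -> exists2 i, (i <= k)%N & f i = g j.
  move=> le_jm; have : [set f i | i in `I_k.+1] (g j) by rewrite eqST; exists j.
  by move=> [i /= le_ik fi]; exists i.
have fE i : (i <= k)%N -> iA @^-1` prod_set (S i) NA =
    [set h | exists e, f i (h ^+ e) /\ exists2 l, ~~ (p %| l) & (h^-1 * h ^+ e) ^+ l = 1].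
  move=> le_ik; apply: preim_prod => //; first exact: nS.
  by rewrite -Sk; apply: incS; rewrite le_ik /=.
have gE j : (j <= m)%N -> iB @^-1` prod_set (T j) NB =
    [set h | exists e, g j (h ^+ e) /\ exists2 l, ~~ (p %| l) & (h^-1 * h ^+ e) ^+ l = 1].
  move=> le_jm; apply: preim_prod => //; first exact: nT.
  by rewrite -Tm; apply: incT; rewrite le_jm /=.
pose LA i := prod_set (S i) NA; pose LB j := prod_set (T j) NB.
have nLA i : (i <= k)%N -> normal_subgroup (LA i).
  by move=> le_ik; apply: prod_normal => //; apply: nS.
have nLB j : (j <= m)%N -> normal_subgroup (LB j).
  by move=> le_jm; apply: prod_normal => //; apply: nT.
have bal i j : (i <= k)%N -> (j <= m)%N -> f i = g j -> balanced iA iB (LA i) (LB j).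
  by move=> le_ik le_jm eq_fg; split; [exact: nLA | exact: nLB | rewrite fE ?gE ?eq_fg].
have cLA i : (i < k)%N -> central_step p (LA i) (LA i.+1).
  by move=> lt_ik; apply: central_step_prod => //; case: (stepS i lt_ik).
have cLB j : (j < m)%N -> central_step p (LB j) (LB j.+1).
  by move=> lt_jm; apply: central_step_prod => //; case: (stepT j lt_jm).
have genA i : (i < k)%N -> f i.+1 <> f i ->
    LA i.+1 `<=` prod_set (iA @` (iA @^-1` LA i.+1)) (LA i).
  move=> lt_ik ne_f; have [h fh nfh] : exists2 h, f i.+1 h & ~ f i h.
    apply: contrapT => no_h; apply: ne_f; apply/seteqP; split=> h.
      by move=> fh; apply: contrapT => nfh; apply: no_h; exists h.
    by apply: incS; rewrite leqnSn.
  have [_ gen] := stepS i lt_ik.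
  move=> y [s Ss Nsy]; have [c Sc] := gen _ _ fh nfh Ss.
  exists (iA (h ^+ c)).
    exists (h ^+ c) => //; apply: (prod_setl (normal_grp nNA)).
    by rewrite homX; apply: (subX (normal_grp (nS _ lt_ik))).
  rewrite homX -(mulVKg s y) mulgA; apply: (subM (normal_grp (nLA _ (ltnW lt_ik)))).
    exact: (prod_setl (normal_grp nNA)).
  exact: (prod_setr (normal_grp (nS _ (ltnW lt_ik)))).
have genB j : (j < m)%N -> g j.+1 <> g j ->
    LB j.+1 `<=` prod_set (iB @` (iB @^-1` LB j.+1)) (LB j).
  move=> lt_jm ne_g; have [h gh ngh] : exists2 h, g j.+1 h & ~ g j h.
    apply: contrapT => no_h; apply: ne_g; apply/seteqP; split=> h.
      by move=> gh; apply: contrapT => ngh; apply: no_h; exists h.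
    by apply: incT; rewrite leqnSn.
  have [_ gen] := stepT j lt_jm.
  move=> y [s Ts Nsy]; have [c Tc] := gen _ _ gh ngh Ts.
  exists (iB (h ^+ c)).
    exists (h ^+ c) => //; apply: (prod_setl (normal_grp nNB)).
    by rewrite homX; apply: (subX (normal_grp (nT _ lt_jm))).
  rewrite homX -(mulVKg s y) mulgA; apply: (subM (normal_grp (nLB _ (ltnW lt_jm)))).
    exact: (prod_setl (normal_grp nNB)).
  exact: (prod_setr (normal_grp (nT _ (ltnW lt_jm)))).
have incf i i' : (i' <= k)%N -> (i <= i')%N -> f i `<=` f i'.
  by move=> le_ik le_ii h; apply: incS; rewrite le_ii.
have incg j j' : (j' <= m)%N -> (j <= j')%N -> g j `<=` g j'.
  by move=> le_jm le_jj h; apply: incT; rewrite le_jj.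
have lkA i j : (i < k)%N -> f i.+1 = f i -> (j <= m)%N ->
    link p iA iB (LA i) (LB j) (LA i.+1) (LB j).
  move=> lt_ik eq_f le_jm; split; [exact: cLA | exact/central_step_refl/nLB |].
  by left; rewrite !fE ?eq_f // ltnW.
have lkB i j : (i <= k)%N -> (j < m)%N -> link p iA iB (LA i) (LB j) (LA i) (LB j.+1).
  by move=> le_ik lt_jm; split; [exact/central_step_refl/nLA | exact: cLB | left].
have path d : forall i j, (i <= k)%N -> (j <= m)%N -> (k + m < i + j + d)%N ->
    f i = g j -> linked p iA iB (LA i) (LB j).
  elim: d => [|d IH] i j le_ik le_jm lt_d eq_fg.
    by move: lt_d; rewrite addn0 ltnNge leq_add.
  have [lt_ik|ge_ik] := ltnP i k; last first.
    have eq_ik : i = k by apply/anti_leq; rewrite le_ik.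
    have [lt_jm|ge_jm] := ltnP j m; last first.
      have eq_jm : j = m by apply/anti_leq; rewrite le_jm.
      apply: (linked_above p_pr pNA pNB); rewrite ?fE ?gE //.
      - exact: nLA.
      - exact: nLB.
      - exact/prod_setr/normal_grp/nS.
      - exact/prod_setr/normal_grp/nT.
      - apply/seteqP; split=> // h _; have [e [pe hem]] := p_part_elt p_pr (H_periodic h).
        by exists e; split=> //; rewrite /f eq_ik /= Sk; apply: pRt_hom.
      - apply/seteqP; split=> // h _; have [e [pe hem]] := p_part_elt p_pr (H_periodic h).
        by exists e; split=> //; rewrite /g eq_jm /= Tm; apply: pRt_hom.
    have eq_g : g j.+1 = g j.
      apply/seteqP; split; last by apply: incg.
      have [i' le_i'k <-] := gf _ lt_jm.
      by rewrite -eq_fg eq_ik; apply: incf.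
    apply: linked_step (bal _ _ le_ik le_jm eq_fg) (lkB _ _ le_ik lt_jm) _.
    by apply: IH; rewrite ?eq_g //; move: lt_d; rewrite !addnS ?addSn.
  have [eq_f|ne_f] := pselect (f i.+1 = f i).
    apply: linked_step (bal _ _ le_ik le_jm eq_fg) (lkA _ _ lt_ik eq_f le_jm) _.
    by apply: IH; rewrite ?eq_f //; move: lt_d; rewrite addnS !addSn.
  have [j' le_j'm gj'] := fg _ lt_ik.
  have lt_jj' : (j < j')%N.
    rewrite ltnNge; apply/negP => le_j'j; apply: ne_f; apply/seteqP; split.
      by rewrite -gj' eq_fg; apply: incg.
    exact: incf.
  have lt_jm : (j < m)%N := leq_trans lt_jj' le_j'm.
  have [eq_g|ne_g] := pselect (g j.+1 = g j).
    apply: linked_step (bal _ _ le_ik le_jm eq_fg) (lkB _ _ le_ik lt_jm) _.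
    by apply: IH; rewrite ?eq_g //; move: lt_d; rewrite !addnS ?addSn.
  have eq_fg' : f i.+1 = g j.+1.
    apply/seteqP; split; last by rewrite -gj'; apply: incg.
    have [i' le_i'k fi'] := gf _ lt_jm; rewrite -fi'; apply: (incf) => //.
    rewrite ltnNge; apply/negP => le_i'i; apply: ne_g; apply/seteqP; split.
      by rewrite -fi' -eq_fg; apply: incf.
    exact: incg.
  apply: linked_step (bal _ _ le_ik le_jm eq_fg) _ (IH i.+1 j.+1 _ _ _ _) => //.
    by split; [exact: cLA | exact: cLB | right; split; [apply: genA | apply: genB]].
  by rewrite addSn addnS !addSn; apply: leq_trans lt_d _; rewrite addnS.
have LA0 : LA 0 = NA.
  rewrite /LA S0; apply: prod_set_absorb; [exact: normal_grp | |].
    exact/normal_grp/normal_triv.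
  by move=> _ ->; apply: (sub1 (normal_grp nNA)).
have LB0 : LB 0 = NB.
  rewrite /LB T0; apply: prod_set_absorb; [exact: normal_grp | |].
    exact/normal_grp/normal_triv.
  by move=> _ ->; apply: (sub1 (normal_grp nNB)).
rewrite -LA0 -LB0; apply: (path (k + m).+1) => //.
have triv (X : groupType) (i : {multiplicative H -> X}) :
    injective i -> i @^-1` [set 1] = [set 1].
  move=> i_inj; apply/seteqP; split=> h /= => [|->]; last exact: hom1.
  by rewrite -(hom1 i) => /i_inj.
by rewrite /f /g S0 T0 !triv.
Qed.
End Condition.

Lemma amalgam_pquot (H A B G : groupType) (p : nat)
    (iA : {multiplicative H -> A}) (iB : {multiplicative H -> B})
    (jA : {multiplicative A -> G}) (jB : {multiplicative B -> G}) NA NB :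
  is_amalgam iA iB jA jB -> prime p -> periodic H ->
  normal_subgroup (pRt A p) -> normal_subgroup (pRt B p) ->
  (exists N, finite_pquot p N /\ forall x, pRt A p x -> N x -> x = 1) ->
  (exists N, finite_pquot p N /\ forall x, pRt B p x -> N x -> x = 1) ->
  condition_N iA iB p -> finite_pquot p NA -> finite_pquot p NB ->
  exists M, [/\ finite_pquot p M, jA @^-1` M `<=` NA & jB @^-1` M `<=` NB].
Proof.
move=> G_am p_pr tH nPA nPB [KA [pKA sepA]] [KB [pKB sepB]] cN pNA pNB.
have [iA_inj iB_inj _ _] := G_am.
have pA := finite_pquotI pKA pNA; have pB := finite_pquotI pKB pNB.
have lk : linked p iA iB (KA `&` NA) (KB `&` NB).
  apply: condition_N_linked => // x px [Kx _]; first exact: sepA.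
  exact: sepB.
have [M [pM MA MB]] := linked_quotient G_am pA pB lk.
by exists M; split=> // x; [case/MA | case/MB].
Qed.

(** * Reduced words *)

Section Words.
Variables (H G : groupType) (F : bool -> groupType).
Variables (i : forall t, {multiplicative H -> F t}).
Variables (j : forall t, {multiplicative F t -> G}).
Hypothesis G_amalgam : is_amalgam (i true) (i false) (j true) (j false).

Definition letter := {t : bool & F t}.
Definition letter_val (l : letter) : G := j (tag l) (tagged l).

Fixpoint word_val (w : seq letter) : G :=
  if w is l :: w' then letter_val l * word_val w' else 1.

(** Words of letters satisfying [P] with alternating types: the first letter
    has type [t], and a further letter on the right would have type [e]. *)
Fixpoint alternating (P : letter -> Prop) (t : bool) (w : seq letter) (e : bool)
    : Prop :=
  if w is l :: w' then [/\ tag l = t, P l & alternating P (~~ t) w' e]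
  else t = e.

Definition outside (l : letter) : Prop := ~ range (i (tag l)) (tagged l).

Lemma amalgam_compatF t s h : j t (i t h) = j s (i s h).
Proof.
by have jE := amalgam_compat G_amalgam h; case: t s => -[]; rewrite ?jE.
Qed.

Lemma word_val_cat w w' : word_val (w ++ w') = word_val w * word_val w'.
Proof. by elim: w => [|l w IH] /=; rewrite ?mul1g // IH mulgA. Qed.

Lemma outsideMl t h x :
  outside (Tagged F x) -> outside (Tagged F (i t h * x)).
Proof.
move=> Ox [k _ ik]; apply: Ox; exists (h^-1 * k) => //=.
by rewrite gmulfM homV /= ik mulKg.
Qed.

Definition reduced (g : G) : Prop :=
  (exists h, g = j true (i true h)) \/
  exists t w e, [/\ w <> [::], alternating outside t w e & g = word_val w].

Lemma absorb_word h t w e : w <> [::] -> alternating outside t w e ->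
  exists w', [/\ w' <> [::], alternating outside t w' e &
                word_val w' = j true (i true h) * word_val w].
Proof.
case: w => [//|[s x] w] _ /= [<- Ox alt].
exists (Tagged F (i s h * x) :: w); split=> //=.
  by split=> //; apply: outsideMl.
by rewrite /letter_val /= gmulfM (amalgam_compatF s true) mulgA.
Qed.

Lemma reduced_mul t (x : F t) g : reduced g -> reduced (j t x * g).
Proof.
have single (y : F t) : reduced (j t y).
  have [[h _ <-]|Oy] := pselect (range (i t) y).
    by left; exists h; apply: amalgam_compatF.
  by right; exists t, [:: Tagged F y], (~~ t); split=> //=; rewrite mulg1.
move=> [[h ->]|[s [w [e [w0 alt ->]]]]].
  by rewrite (amalgam_compatF true t) -gmulfM; apply: single.
have [[h _ <-]|Ox] := pselect (range (i t) x).
  have [w' [w'0 alt' wE]] := absorb_word h w0 alt.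
  by right; exists s, w', e; rewrite (amalgam_compatF t true) -wE.
have [eq_ts|neq_ts] := eqVneq t s; last first.
  right; exists t, (Tagged F x :: w), e; split=> //=; split=> //.
  by have -> : ~~ t = s by move: neq_ts; case: (t); case: (s).
subst s; case: w w0 alt => [//|[s y] w] _ /= [eq_s Oy alt].
rewrite /letter_val /=; subst s; rewrite mulgA -gmulfM.
have [[h _ eq_h]|Oxy] := pselect (range (i t) (x * y)); last first.
  by right; exists t, (Tagged F (x * y) :: w), e; split.
rewrite -eq_h (amalgam_compatF t true).
have [w0|/eqP w0] := eqVneq w [::]; first by left; exists h; rewrite w0 mulg1.
have [w' [w'0 alt' wE]] := absorb_word h w0 alt.
by right; exists (~~ t), w', e.
Qed.

(** The reduced elements are stable under left multiplication by the factors,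
    which generate [G]. *)
Lemma reducedP g : reduced g.
Proof.
suff /(_ g)[/(_ 1) red _] : forall g, (forall g', reduced g' -> reduced (g * g')) /\
    (forall g', reduced g' -> reduced (g^-1 * g')).
  by rewrite -(mulg1 g); apply: red; left; exists 1; rewrite !hom1.
apply: (amalgam_ind G_amalgam (Y := [set g |
    (forall g', reduced g' -> reduced (g * g')) /\
    (forall g', reduced g' -> reduced (g^-1 * g'))])).
- apply/subgroupP; split=> /=.
  + by rewrite invg1; split=> g'; rewrite mul1g.
  + move=> x y [xP xVP] [yP yVP]; split=> g' rg'.
      by rewrite -mulgA; apply/xP/yP.
    by rewrite invgM -mulgA; apply/yVP/xVP.
  + by move=> x [xP xVP]; rewrite invgK.
- by move=> a; split=> g' rg'; rewrite -?homV; apply: reduced_mul.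
- by move=> b; split=> g' rg'; rewrite -?homV; apply: reduced_mul.
Qed.
End Words.

(** * Separation of reduced words *)

Section Transvections.
Variables (q : nat) (L : nat -> bool).

Definition qvect : Type := nat -> 'F_q.

Definition transv (e : bool) (v : qvect) : qvect := fun k =>
  if k is k'.+1 then
    (v k + (if L k' then (if e then v k' else - v k') else 0))%R
  else v 0.

(** As [L] never selects two consecutive indices, the square of the nilpotent
    part vanishes. *)
Lemma transvK e (v : qvect) : (forall k, ~~ (L k && L k.+1)) ->
  transv (~~ e) (transv e v) = v.
Proof.
move=> Lk; apply/funext => -[|k] //=.
case: ifP => Lk1; last by rewrite !GRing.addr0.
have -> : transv e v k = v k.
  case: k Lk1 => [|k] //= Lk1; case: ifP => Lk'; last by rewrite GRing.addr0.
  by have := Lk k; rewrite Lk' Lk1.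
by case: e => /=; rewrite -GRing.addrA ?GRing.subrr ?GRing.addNr GRing.addr0.
Qed.

Lemma transv_diff e (v w : qvect) k : (forall l, (l < k)%N -> v l = w l) ->
  (transv e v k - transv e w k = v k - w k)%R.
Proof.
case: k => [|k] // eq_vw /=; rewrite (eq_vw k) // GRing.opprD GRing.addrACA.
by rewrite GRing.subrr GRing.addr0.
Qed.

Definition top (k : nat) (v : qvect) : Prop :=
  (v k <> 0)%R /\ forall l, (k < l)%N -> (v l = 0)%R.

Lemma top_transv e k (v : qvect) : L k -> top k v -> top k.+1 (transv e v).
Proof.
move=> Lk [vk v0]; split=> [|[|l] lt_kl] //=.
  rewrite Lk v0 // GRing.add0r; case: e => // /eqP; rewrite GRing.oppr_eq0.
  by move/eqP.
rewrite (v0 l.+1) ?(v0 l) //; last by apply: ltnW.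
by rewrite GRing.oppr0 !if_same GRing.addr0.
Qed.
End Transvections.

Lemma transv_agree q (L : nat -> bool) e (v w : qvect q) k :
  (forall l, (l < k)%N -> v l = w l) ->
  forall l, (l < k)%N -> transv L e v l = transv L e w l.
Proof.
move=> eq_vw l lt_lk; apply/eqP; rewrite -GRing.subr_eq0 transv_diff.
  by rewrite eq_vw // GRing.subrr.
by move=> l' lt; apply: eq_vw; apply: ltn_trans lt_lk.
Qed.

Lemma alternating_nth (F : bool -> groupType) (P : letter F -> Prop) t w e x0 k :
  alternating P t w e -> (k < size w)%N -> P (nth x0 w k).
Proof.
by elim: w t k => [|l w IH] t [|k] //= [_ Pl alt] // lt; apply: IH alt _.
Qed.

Lemma alternating_rcons (F : bool -> groupType) (P : letter F -> Prop) t w :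
  w <> [::] -> alternating P t w false ->
  exists w' l, [/\ w = rcons w' l, alternating P t w' true, tag l = true & P l].
Proof.
elim: w t => [//|l w IH] t _ /= [tl Pl alt].
have [w0|/eqP w0] := eqVneq w [::].
  exists [::], l; rewrite w0 in alt *; move: alt tl => /= .
  by case: t => //= _ tl; split.
have [w' [a [-> alt' ta Pa]]] := IH _ w0 alt.
by exists (l :: w'), a; split.
Qed.

Section WordQuotient.
Variables (H G : groupType) (F : bool -> groupType).
Variables (i : forall t, {multiplicative H -> F t}).
Variables (j : forall t, {multiplicative F t -> G}).
Hypothesis G_amalgam : is_amalgam (i true) (i false) (j true) (j false).
Variables (N : groupType) (s : {multiplicative G -> N}).
Hypothesis s_onto : onto s.
Variable q : nat.
Hypothesis q_pr : prime q.

Definition separated (l : letter F) : Prop :=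
  forall h, s (letter_val j l) <> s (j true (i true h)).

Variable w : seq (letter F).
Hypothesis w_sep : forall x0 k, (k < size w)%N -> separated (nth x0 w k).

Let pos k := s (word_val j (drop (size w - k) w)).
Let sameH (n n' : N) := exists h, n = s (j true (i true h)) * n'.
Let L n k := (k <= size w)%N && `[< sameH n (pos k) >].

Let L_disj n k : ~~ (L n k && L n k.+1).
Proof.
apply/negP => /andP[/andP[_ /asboolP[h nE]] /andP[lt_k /asboolP[h' nE']]].
pose x0 : letter F := Tagged F (1 : F true).
have lt : (size w - k.+1 < size w)%N by rewrite ltn_subrL /= (leq_ltn_trans _ lt_k).
have /(_ (h'^-1 * h)) := @w_sep x0 _ lt; apply.
have posS : pos k.+1 = s (letter_val j (nth x0 w (size w - k.+1))) * pos k.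
  by rewrite /pos (drop_nth x0 lt) /= gmulfM subnSK.
apply: (@mulIg _ (pos k)); rewrite -posS !gmulfM !homV -mulgA -nE nE'.
by rewrite mulKg.
Qed.

Let L_H h n : L (s (j true (i true h)) * n) = L n.
Proof.
apply/funext => k; rewrite /L; congr (_ && _); apply/asboolP/asboolP => -[h' nE].
  by exists (h^-1 * h'); rewrite !gmulfM !homV -mulgA -nE mulKg.
by exists (h * h'); rewrite nE !gmulfM mulgA.
Qed.

Let W := (N * qvect q)%type.

Let actF t (x : F t) (v : W) : W :=
  (s (j t x) * v.1, if t then v.2
     else transv (L (s (j t x) * v.1)) true (transv (L v.1) false v.2)).

Let TK n (v : qvect q) : transv (L n) true (transv (L n) false v) = v.
Proof. exact: (transvK false v (@L_disj n)). Qed.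

Let TVK n (v : qvect q) : transv (L n) false (transv (L n) true v) = v.
Proof. exact: (transvK true v (@L_disj n)). Qed.

Let actF_action t : is_action (actF (t := t)).
Proof.
case: t; split=> [[n v]|x y [n v]]; rewrite /actF /= ?hom1 ?mul1g ?TK //.
  by rewrite !gmulfM mulgA.
by rewrite !gmulfM !mulgA TVK.
Qed.

(** The group [G] acts on copies of the space [qvect] indexed by [N]: the first factor permutes the copies, the second one moreover applies
    the transvections attached to the cosets it starts from and arrives at. The
    cosets met by a reduced word are pairwise distinct when consecutive, and
    the transvections push the first basis vector up at each of them. *)
Let word_action : exists act : G -> W -> W, [/\ is_action act,
  forall x, act (j true x) =1 actF x & forall x, act (j false x) =1 actF x].
Proof.
apply: (amalgam_action G_amalgam (actF_action true) (actF_action false)).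
move=> h [n v]; rewrite /actF /= -(amalgam_compatF G_amalgam true false).
by rewrite L_H TK.
Qed.

(** [G] acts unitriangularly on the coordinates, and only the first [size w + 2] of
    them are compared, so that for an element trivial on [N] some power of exponent
    a power of [q] acts trivially. An element of a factor that is trivial on [N] meets the same coset at departure
    and arrival, and the two transvections cancel. *)
Lemma word_quotient : exists K : set G,
  [/\ normal_subgroup K, K `<=` ker s,
      fin_index setT (ker s) -> fin_index setT K,
      forall x, s x = 1 -> exists k, K (x ^+ (q ^ k)%N) &
      (forall t x, s (j t x) = 1 -> K (j t x)) /\
      forall t, alternating separated t w true -> w <> [::] ->
        ~ K (word_val j w) /\ forall l : letter F, tag l = true -> ~ K (word_val j (rcons w l))].
Proof.
have [act [act_act actA actB]] := word_action; have [act1 actM] := act_act.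
pose m := (size w).+2.
pose E (v v' : W) := v.1 = v'.1 /\ forall k, (k < m)%N -> v.2 k = v'.2 k.
pose tri g := forall n v v' k, (forall l, (l < k)%N -> v l = v' l) ->
  ((act g (n, v)).2 k - (act g (n, v')).2 k = v k - v' k)%R.
have tri_agree g n v v' k : tri g -> (forall l, (l < k)%N -> v l = v' l) ->
    forall l, (l < k)%N -> (act g (n, v)).2 l = (act g (n, v')).2 l.
  move=> gT eq_v l lt_lk; apply/eqP; rewrite -GRing.subr_eq0 gT.
    by rewrite eq_v // GRing.subrr.
  by move=> l' lt; apply: eq_v; apply: ltn_trans lt_lk.
have act_fst g v : (act g v).1 = s g * v.1.
  apply: (amalgam_ind G_amalgam (Y := [set g | forall v, (act g v).1 = s g * v.1])).
  - apply/subgroupP; split=> /= [u|x y xP yP u|x xP u].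
    + by rewrite act1 hom1 mul1g.
    + by rewrite actM xP yP gmulfM mulgA.
    + by rewrite homV -{2}(is_actionVK x u act_act) xP mulKg.
  - by move=> a u; rewrite actA.
  - by move=> b u; rewrite actB.
have tri_all g : tri g.
  suff: tri g /\ tri g^-1 by case.
  apply: (amalgam_ind G_amalgam (Y := [set g | tri g /\ tri g^-1])).
  - have triM x y : tri x -> tri y -> tri (x * y).
      move=> xT yT n v v' k eq_v; rewrite !actM.
      have fst_y u : act y (n, u) = (s y * n, (act y (n, u)).2).
        by rewrite [LHS]surjective_pairing act_fst.
      rewrite (fst_y v) (fst_y v') xT ?yT // => l lt_lk.
      exact: tri_agree eq_v _ lt_lk.
    apply/subgroupP; split=> /=.
    + by rewrite invg1; split=> n v v' k _; rewrite !act1.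
    + by move=> x y [xT xVT] [yT yVT]; rewrite invgM; split; apply: triM.
    + by move=> x [xT xVT]; rewrite invgK.
  - suff triA a : tri (j true a) by move=> a; rewrite /= -homV; split.
    by move=> n v v' k eq_v; rewrite !actA /actF /=.
  - suff triB b : tri (j false b) by move=> b; rewrite /= -homV; split.
    move=> n v v' k eq_v; rewrite !actB /actF /= transv_diff ?transv_diff //.
    by apply: transv_agree.
have E_act g v v' : E v v' -> E (act g v) (act g v').
  case: v v' => [n v] [n' v'] [/= <- eq_v]; split; first by rewrite !act_fst.
  exact: tri_agree (tri_all g) eq_v.
have E_refl v : E v v by [].
have E_sym v v' : E v v' -> E v' v by move=> [e1 e2]; split=> // k /e2.
have E_trans u v v' : E u v -> E v v' -> E u v'.
  by move=> [e1 d1] [e2 d2]; split=> [|k lt]; rewrite ?e1 // d1 ?d2.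
exists (class_kernel act E); split.
- exact: class_kernel_normal.
- move=> g /(_ (1, fun=> 0%R))[/= + _]; rewrite act_fst /= mulg1.
  by rewrite /ker /= => <-.
- move=> [J [c cP]].
  have /choice[r rP] (n : N) : exists x, s x = n by have [x _ <-] := @s_onto n I; exists x.
  apply: (@class_kernel_index _ _ _ _ act_act E_sym E_trans E_act
           (J * {ffun 'I_m -> 'F_q})%type
           (fun v => (c (r v.1), [ffun k : 'I_m => v.2 k]))).
  move=> [n v] [n' v'] [/= /cP eq_c /ffunP eq_v]; split=> /= [|k lt_k].
    have := eq_c I I; rewrite /ker /= gmulfM homV !rP => /mulg1_eq.
    by rewrite invgK.
  by have := eq_v (Ordinal lt_k); rewrite !ffunE.
- move=> x sx; have fix_n k g : s g = 1 -> forall v : W, act g v = (v.1, (act g v).2).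
    by move=> sg v; rewrite [LHS]surjective_pairing act_fst sg mul1g.
  have pow k g : s g = 1 -> (forall v l, (l < k)%N -> (act g v).2 l = v.2 l) ->
      forall v l, (l < k.+1)%N -> (act (g ^+ q) v).2 l = v.2 l.
    move=> sg gk v l; pose p n := (act (g ^+ n) v).2.
    have pE n : act (g ^+ n) v = (v.1, p n).
      by rewrite [LHS]surjective_pairing act_fst homX sg expg1n mul1g.
    have p0 : p 0%N = v.2 by rewrite /p expg0 act1.
    have pS n : p n.+1 = (act g (v.1, p n)).2 by rewrite /p expgS actM pE.
    have plow n l' : (l' < k)%N -> p n l' = v.2 l'.
      by move=> lt; elim: n => [|n IH]; rewrite ?p0 // pS gk.
    rewrite ltnS leq_eqVlt => /orP[/eqP ->|lt_lk]; last exact: plow.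
    pose d := (p 1%N k - p 0%N k)%R.
    have dE n : (p n.+1 k - p n k)%R = d.
      elim: n => [//|n IH]; rewrite -IH [in LHS]pS [p n.+1 in X in (_ - X)%R]pS.
      by apply: tri_all => l' lt; rewrite !plow.
    have pq n : (p n k = v.2 k + d *+ n)%R.
      elim: n => [|n IH]; first by rewrite p0 GRing.mulr0n GRing.addr0.
      by rewrite GRing.mulrSr GRing.addrA -IH -(dE n) GRing.addrC GRing.subrK.
    rewrite -[LHS]/(p q k) pq GRing.mulrn_pchar ?GRing.addr0 //.
    exact: pchar_Fp.
  have powk k : forall v l, (l < k)%N -> (act (x ^+ (q ^ k)%N) v).2 l = v.2 l.
    elim: k => [//|k IH]; rewrite expnS mulnC expgnA; apply: pow => //.
    by rewrite homX sx expg1n.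
  exists m => v; split; first by rewrite act_fst homX sx expg1n mul1g.
  by move=> l lt; rewrite powk.
split.
  move=> [] x sx [n v]; rewrite ?actA ?actB /actF /= sx mul1g; split=> //= k _.
  by rewrite TK.
move=> t alt w0.
pose e0 : qvect q := fun k => if k is 0 then 1%R else 0%R.
have top_e0 : top 0 e0 by split=> [|[|l]] //; apply/eqP/GRing.oner_neq0.
have climb u u' t' : w = u' ++ u -> alternating separated t' u true ->
    top (size u + ~~ t') (act (word_val j u) (1, e0)).2.
  elim: u u' t' => [|[b x] u IH] u' t' wE /=; first by move=> ->; rewrite act1.
  move=> [/= <- _ altu].
  have wE' : w = rcons u' (Tagged F x) ++ u by rewrite wE cat_rcons.
  have := IH _ _ wE' altu; rewrite actM.
  have pu : s (word_val j u) = pos (size u).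
    by rewrite /pos wE' size_cat addnK drop_size_cat.
  have pu' : s (j b x) * s (word_val j u) = pos (size u).+1.
    rewrite /pos wE size_cat /= addnK drop_size_cat //=.
    by rewrite /letter_val /= gmulfM.
  have Lpos k : (k <= size w)%N -> L (pos k) k.
    by move=> le; rewrite /L le; apply/asboolP; exists 1; rewrite !hom1 mul1g.
  have lt_u : (size u < size w)%N by rewrite wE size_cat /= addnS ltnS leq_addl.
  rewrite /letter_val; case: b x wE wE' pu' altu => x wE wE' pu' altu /=.
    by rewrite actA /actF /= addn0 addn1.
  rewrite actB /actF /= act_fst mulg1 pu' pu addn0 addn1 => topu.
  by apply: top_transv (Lpos _ lt_u) _; apply: top_transv (Lpos _ (ltnW lt_u)) _.
have top_w := climb w [::] t erefl alt.
have not_E : ~ forall k, (k < m)%N -> e0 k = (act (word_val j w) (1, e0)).2 k.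
  move=> eq_v; have lt_m : (size w + ~~ t < m)%N.
    by rewrite /m; case: (t); rewrite ?addn0 ?addn1 ltnS.
  have [n nE] : exists n, (size w + ~~ t)%N = n.+1.
    by case: (w) w0 => [//|l u] _; exists (size u + ~~ t)%N.
  by move: top_w lt_m; rewrite nE => -[+ _] lt_n; rewrite -eq_v.
split=> [/(_ (1, e0))[_ /= ]//|[b x] /= tb]; subst b.
rewrite -cats1 word_val_cat /= mulg1 /letter_val /=.
move=> /(_ ((s (j true x))^-1, e0))[_ /=]; rewrite actM actA /actF /=.
by rewrite mulgV.
Qed.
End WordQuotient.

(** A word ending in the first factor is treated by removing its last letter,
    which only changes the starting copy. *)
Lemma word_survives (H G : groupType) (F : bool -> groupType)
    (i : forall t, {multiplicative H -> F t})
    (j : forall t, {multiplicative F t -> G})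
    (N : groupType) (s : {multiplicative G -> N}) q t w e :
  is_amalgam (i true) (i false) (j true) (j false) -> onto s -> prime q ->
  w <> [::] -> alternating (separated i j s) t w e ->
  exists K : set G,
  [/\ normal_subgroup K, K `<=` ker s,
      fin_index setT (ker s) -> fin_index setT K,
      forall x, s x = 1 -> exists k, K (x ^+ (q ^ k)%N) &
      (forall t x, s (j t x) = 1 -> K (j t x)) /\ ~ K (word_val j w)].
Proof.
move=> G_am s_onto q_pr w0 alt.
have sep_of u t' e' : alternating (separated i j s) t' u e' ->
    forall x0 k, (k < size u)%N -> separated i j s (nth x0 u k).
  by move=> altu x0 k; apply: alternating_nth altu.
case: e alt => alt.
  have [K [nK sK fK tK [genK wK]]] := word_quotient G_am s_onto q_pr (sep_of _ _ _ alt).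
  by exists K; split=> //; split=> //; case: (wK t alt w0).
have [w' [l [wE alt' tl sl]]] := alternating_rcons w0 alt.
have [w'0|/eqP w'0] := eqVneq w' [::].
  exists (ker s); split=> //; first exact: normal_ker.
    by move=> x sx; exists 0%N.
  split=> //; rewrite wE w'0 /= mulg1 => sl1; apply: (sl 1).
  by rewrite !hom1.
have [K [nK sK fK tK [genK wK]]] := word_quotient G_am s_onto q_pr (sep_of _ _ _ alt').
by exists K; split=> //; split=> //; rewrite wE; case: (wK t alt' w'0) => _; apply.
Qed.

(** * Free kernels *)

Lemma smallest_normal (X : groupType) (S : set X) :
  normal_subgroup (smallest (@normal_subgroup X) S).
Proof.
split; last first.
  by move=> y x Sx N SN; apply: (normal_conj _ (proj1 SN)); apply: Sx.
apply/subgroupP; split.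
- by move=> N [nN _]; apply: (sub1 (normal_grp nN)).
- move=> x y Sx Sy N SN; have gN := normal_grp (proj1 SN).
  by apply: (subM gN); [apply: Sx | apply: Sy].
- move=> x Sx N SN; have gN := normal_grp (proj1 SN).
  by apply: (subV gN); apply: Sx.
Qed.

Section FreeKernel.
Variables (H G : groupType) (F : bool -> groupType).
Variables (i : forall t, {multiplicative H -> F t}).
Variables (j : forall t, {multiplicative F t -> G}).
Hypothesis G_amalgam : is_amalgam (i true) (i false) (j true) (j false).
Variables (N : groupType) (s : {multiplicative G -> N}).
Hypothesis s_onto : onto s.

Definition factor_kernels : set G := [set g | s g = 1 /\ exists t x, g = j t x].

Variables (X : groupType) (f : {multiplicative G -> X}).
Variables (r : {multiplicative X -> N}).
Hypothesis f_onto : onto f.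
Hypothesis f_ker : forall g, f g = 1 <-> smallest (@normal_subgroup G) factor_kernels g.
Hypothesis rf : forall g, r (f g) = s g.

Let e t (a : F t) : X := f (j t a).

Let eV t (a : F t) : e a^-1 = (e a)^-1. Proof. by rewrite /e !homV. Qed.
Let eM t (a b : F t) : e (a * b) = e a * e b. Proof. by rewrite /e !gmulfM. Qed.
Let e1 t : e (1 : F t) = 1. Proof. by rewrite /e !hom1. Qed.
Let eH t t' h : e (i t h) = e (i t' h).
Proof. by rewrite /e (amalgam_compatF G_amalgam t t'). Qed.

Let e_inj t (a : F t) : r (e a) = 1 -> e a = 1.
Proof.
move=> ra; apply/f_ker; apply: sub_gen_smallest; split; first by rewrite -rf.
by exists t, a.
Qed.

Lemma factors_ind (Y : set X) :
  (forall x, Y x -> forall t (a : F t), Y (e a * x)) -> Y 1 -> forall x, Y x.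
Proof.
move=> YM Y1 x; have [g _ <-] := @f_onto x I.
suff [YfM _] : (forall y, Y y -> Y (f g * y)) /\ (forall y, Y y -> Y (f g^-1 * y)).
  by rewrite -[f g]mulg1; apply: YfM.
apply: (amalgam_ind G_amalgam (Y := [set g |
    (forall y, Y y -> Y (f g * y)) /\ (forall y, Y y -> Y (f g^-1 * y))])).
- apply/subgroupP; split=> /=.
  + by rewrite invg1 hom1; split=> y; rewrite mul1g.
  + move=> a b [aP aVP] [bP bVP]; split=> y Yy.
      by rewrite gmulfM -mulgA; apply/aP/bP.
    by rewrite invgM gmulfM -mulgA; apply/bVP/aVP.
  + by move=> a [aP aVP]; rewrite invgK.
- by move=> a; rewrite /= -homV; split=> y Yy; apply: (YM _ Yy true).
- by move=> b; rewrite /= -homV; split=> y Yy; apply: (YM _ Yy false).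
Qed.

(** [N] is the common vertex set and the edges are the cosets of [H]: a set of
    pairs (type, lift) describes partial lifts to [X] of the two vertex sets
    [N / F true] and [N / F false], and the following relation says that the
    lifted subgraph is connected. *)
Inductive reach (T : set (bool * X)) : bool -> X -> Prop :=
| reach_base : T (true, 1) -> reach T true 1
| reach_mul t x (a : F t) : reach T t x -> reach T t (e a * x)
| reach_edge t x : reach T t x -> T (t, x) -> T (~~ t, x) -> reach T (~~ t) x.

Definition lifted_tree (T : set (bool * X)) : Prop :=
  [/\ forall t x (a : F t), T (t, x) -> T (t, e a * x),
      forall t x y, T (t, x) -> T (t, y) -> r x = r y -> x = y &
      forall t x, T (t, x) -> reach T t x].

Lemma reach_sub T T' t x : T `<=` T' -> reach T t x -> reach T' t x.
Proof.
move=> sTT'; elim=> [/sTT'|{}t {}x a _|{}t {}x _ + /sTT' + /sTT'].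
- exact: reach_base.
- exact: reach_mul.
- exact: reach_edge.
Qed.

Lemma reach_nonempty T t x : reach T t x -> T (true, 1).
Proof. by elim. Qed.

(** A maximal tree of lifts reaches every vertex: a neighbour of a lifted vertex
    can be lifted along the edge, and the factors generate [X]. *)
Lemma spanning_tree : exists T, [/\ lifted_tree T, T (true, 1) &
  forall t n, exists2 x, T (t, x) & r x = n].
Proof.
have [|T [[TM Tinj Treach] maxT]] := @Zorn_bigcup _ lifted_tree.
  move=> C CP totC; split.
  - by move=> t x a [T CT Tx]; exists T => //; case: (CP _ CT) => + _ _; apply.
  - move=> t x y [T CT Tx] [T' CT' T'y].
    have [sTT'|sT'T] := totC _ _ CT CT'.
      by have [_ injT' _] := CP _ CT'; apply: injT' (sTT' _ Tx) T'y.
    by have [_ injT _] := CP _ CT; apply: injT Tx (sT'T _ T'y).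
  - move=> t x [T CT Tx]; apply: (@reach_sub T); first by move=> y Ty; exists T.
    by case: (CP _ CT) => _ _; apply.
have T1 : T (true, 1).
  apply: contrapT => T1.
  have T0 t x : ~ T (t, x) by move=> /Treach/reach_nonempty.
  pose T' := [set u : bool * X | u.1 = true /\ exists a : F true, u.2 = e a].
  apply: (maxT T'); first split; first by move=> [t x] /T0.
    by move=> sT'T; apply: T1; apply: sT'T; split=> //; exists 1; rewrite e1.
  split.
  - by move=> [] x a [//= _ [b ->]]; split=> //; exists (a * b); rewrite eM.
  - move=> t x y [/= -> [a ->]] [_ [b /= ->]] rab; apply: (@mulgI _ (e a^-1)).
    rewrite -!eM mulVg e1; apply/esym/e_inj.
    by rewrite eM eV gmulfM homV rab mulVg.
  - move=> t x [/= -> [a ->]]; rewrite -[e a]mulg1; apply/reach_mul/reach_base.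
    by split=> //; exists 1; rewrite e1.
have Tswap t x : T (t, x) -> exists2 y, T (~~ t, y) & r y = r x.
  move=> Tx; apply: contrapT => noy.
  pose T' := T `|` [set u : bool * X | u.1 = ~~ t /\ exists a : F (~~ t), u.2 = e a * x].
  have sTT' : T `<=` T' by left.
  have T'x : T' (~~ t, x) by right; split=> //; exists 1; rewrite e1 mul1g.
  apply: (maxT T').
    split=> // /(_ _ T'x) Tx'; apply: noy; by exists x.
  have newold y z : T (~~ t, y) -> (exists a : F (~~ t), z = e a * x) -> r y <> r z.
    move=> Ty [a ->] ry; apply: noy; exists (e a^-1 * y); first exact: TM.
    by rewrite gmulfM ry gmulfM mulgA -gmulfM -eM mulVg e1 hom1 mul1g.
  split.
  - move=> t' y a [Ty|[/= tE [b yE]]]; first by left; apply: TM.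
    by subst t'; right; split=> //; exists (a * b); rewrite eM /= yE mulgA.
  - move=> t' y z [Ty|[/= tE ey]] [Tz|[/= tE' ez]].
    + exact: Tinj Ty Tz.
    + by subst t'; move/(newold _ _ Ty ez).
    + by subst t'; move/esym/(newold _ _ Tz ey).
    + move: ey ez => [a ->] [b ->]; rewrite !gmulfM => /mulIg rab.
      congr (_ * _); apply: (@mulgI _ (e a^-1)).
      by rewrite -!eM mulVg e1; apply/esym/e_inj; rewrite eM eV gmulfM homV rab mulVg.
  - move=> t' y [/Treach|[/= tE [a yE]]]; first exact: reach_sub.
    subst t'; rewrite /= in yE; rewrite yE; apply: reach_mul.
    by apply: reach_edge => //; [apply: reach_sub sTT' _; apply: Treach | left].
exists T; split=> // t n.
suff: exists2 x, T (true, x) & r x = n.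
  by case: t => // -[x Tx <-]; have [y Ty ry] := Tswap _ _ Tx; exists y.
have [g _ <-] := @s_onto n I; rewrite -rf.
apply: (factors_ind (Y := [set z | exists2 x, T (true, x) & r x = r z])); last first.
  by exists 1.
move=> z [x Tx rx] [] a; first by exists (e a * x); rewrite ?gmulfM ?rx //; apply: TM.
have [y Ty ry] := Tswap _ _ Tx.
have [w Tw rw] := Tswap false (e a * y) (TM _ _ _ Ty).
by exists w => //; rewrite rw !gmulfM ry rx.
Qed.

(** The lifts [al true n] and [al false n] of the two end points of the edge [n]
    differ by an element [mu n] of the kernel, trivial on the edges of the tree;
    the nontrivial ones form a basis. Prescribing values [k n] at them amounts to
    letting [G] act on [N * K] by
    translations of [N], twisted by [k] on the second factor; the kernel
    elements then act on the fibre over 1 by the values of the required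
    homomorphism. *)
Lemma kernel_free (M : groupType) (m : {multiplicative M -> X}) :
  injective m -> range m = ker r -> free_group M.
Proof.
move=> m_inj rm.
have [T [[TM Tinj Treach] T1 Tr]] := spanning_tree.
have ex (u : bool * N) : exists x, T (u.1, x) /\ r x = u.2.
  by have [x Tx rx] := Tr u.1 u.2; exists x.
have [al0 al0P] := choice ex.
pose al t n := al0 (t, n).
have alT t n : T (t, al t n) by case: (al0P (t, n)).
have ral t n : r (al t n) = n by case: (al0P (t, n)).
have alE t x : T (t, x) -> al t (r x) = x.
  by move=> Tx; apply: Tinj (alT t _) Tx _; rewrite ral.
have alM t (a : F t) n : al t (r (e a) * n) = e a * al t n.
  rewrite -{1}(ral t n) -gmulfM; apply: alE; exact: TM.
have al1 : al true 1 = 1 by rewrite -(hom1 r); apply: alE.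
have /choice[mu muP] n : exists u, m u = (al true n)^-1 * al false n.
  have : ker r ((al true n)^-1 * al false n).
    by rewrite /ker /= gmulfM homV !ral mulVg.
  by rewrite -rm => -[u _ <-]; exists u.
have muH h n : mu (r (e (i true h)) * n) = mu n.
  by apply: m_inj; rewrite !muP alM (eH true false) alM invgM -mulgA mulKg.
exists [set u | u <> 1 /\ exists n, u = mu n] => K g.
pose k n := if mu n == 1 then 1 else g (mu n).
have kH h n : k (r (e (i true h)) * n) = k n by rewrite /k muH.
pose actF t (a : F t) (v : N * K) : N * K :=
  (r (e a) * v.1, if t then v.2 else k (r (e a) * v.1) * (k v.1)^-1 * v.2).
have actF_action t : is_action (@actF t).
  case: t; split=> [[n x]|a b [n x]]; rewrite /actF /= ?e1 ?hom1 ?mul1g //.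
  - by rewrite eM gmulfM mulgA.
  - by rewrite mulgV mul1g.
  - by rewrite eM !gmulfM !mulgA mulgVK.
have [|act [act_act actA actB]] :=
    amalgam_action G_amalgam (actF_action true) (actF_action false).
  move=> h [n x]; rewrite /actF /= -(eH true false) kH mulgV mul1g //.
have actFE t (a : F t) v : act (j t a) v = actF t a v.
  by case: t a => a; rewrite ?actA ?actB.
have [act1 actM] := act_act.
have act_ker x : f x = 1 -> forall v, act x v = v.
  move=> /f_ker fx; apply: (fx [set y | forall v, act y v = v]); split.
    split; last first.
      move=> y z zv v; rewrite /conjg !actM zv; exact: is_actionKV.
    apply/subgroupP; split=> /= [//|y z yv zv v|y yv v].
      by rewrite actM zv yv.
    by rewrite -{1}(yv v) is_actionKV.
  move=> y [sy [t [a ya]]] [n x0]; subst y; rewrite actFE /actF /= /e rf sy mul1g.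
  by case: t a sy => a sy; rewrite ?mulgV ?mul1g.
have /choice[se seP] x : exists y, f y = x by have [y _ <-] := @f_onto x I; exists y.
pose actX x v := act (se x) v.
have actXE y v : actX (f y) v = act y v.
  rewrite /actX -{1}(mulgVK y (se (f y))) actM; apply: act_ker.
  by rewrite gmulfM homV seP mulgV.
have actX_act : is_action actX.
  split=> [v|x y v]; first by rewrite -(hom1 f) actXE act1.
  by rewrite -{1}(seP x) -{1}(seP y) -gmulfM actXE actM.
have [actX1 actXM] := actX_act.
have actXe t (a : F t) v : actX (e a) v = actF t a v by rewrite /e actXE actFE.
have actXr x n : exists c, forall y, actX x (n, y) = (r x * n, c * y).
  move: x n; apply: factors_ind => [x cx t a n|n]; last first.
    by exists 1 => y; rewrite actX1 hom1 !mul1g.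
  have [c cP] := cx n; rewrite gmulfM -mulgA.
  exists ((if t then 1 else k (r (e a) * (r x * n)) * (k (r x * n))^-1) * c) => y.
  by rewrite actXM cP actXe /actF /=; case: t a => a; rewrite ?mul1g ?mulgA.
have fix_tree t x : reach T t x -> T (t, x) /\
    actX x (1, 1) = (r x, if t then 1 else k (r x)).
  elim=> [T1'|{}t {}x a _ [Tx xE]|{}t {}x _ [_ xE] Tx Tx'].
  - by rewrite actX1 hom1.
  - split; first exact: TM.
    by rewrite actXM xE actXe /actF /= gmulfM; case: t a {Tx xE} => a; rewrite ?mulgVK.
  - split=> //; rewrite xE; congr (_, _).
    suff kx : k (r x) = 1 by rewrite kx !if_same.
    rewrite /k; suff -> : mu (r x) = 1 by rewrite eqxx.
    apply: m_inj; rewrite muP hom1.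
    by case: t Tx Tx' {xE} => Tx Tx'; rewrite !alE ?mulVg.
have actal t n : actX (al t n) (1, 1) = (n, if t then 1 else k n).
  by have [_] := fix_tree _ _ (Treach _ _ (alT t n)); rewrite ral.
have kerm u : r (m u) = 1.
  by suff : ker r (m u) by []; rewrite -rm; exists u.
pose h u := (actX (m u) (1, 1)).2.
have hE u : actX (m u) (1, 1) = (1, h u).
  have [c cP] := actXr (m u) 1.
  by rewrite /h cP kerm mulg1.
have hM : {morph h : u v / u * v}.
  move=> u v; rewrite {1}/h gmulfM actXM hE.
  have [c cP] := actXr (m u) 1; have := cP 1; rewrite hE !mulg1 => -[_ hu].
  by rewrite cP /= hu.
have [h' h'E] := hom_of hM.
have hmu n : h (mu n) = k n.
  have : actX (al false n) (1, 1) = (n, h (mu n)).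
    rewrite -(mulVKg (al true n) (al false n)) -muP actXM hE.
    have [c cP] := actXr (al true n) 1.
    by have := actal true n; rewrite !cP !mulg1 => -[-> ->]; rewrite mul1g.
  by rewrite actal => -[].
exists h'; split=> [u|h2 h2E u].
  rewrite inE => -[u1 [n un]]; rewrite h'E un hmu /k.
  by case: eqP => // mu1; case: u1; rewrite un.
have agree n : h2 (mu n) = h' (mu n).
  have [mu1|/eqP mu1] := eqVneq (mu n) 1; first by rewrite mu1 !hom1.
  rewrite h2E; last by rewrite inE; split=> //; exists n.
  by rewrite h'E hmu /k; case: eqP.
pose D : set X := [set x | exists2 u, h2 u = h' u & x = al true (r x) * m u].
have Dm v : D (m v) -> h2 v = h' v.
  by move=> [w wE]; rewrite kerm al1 mul1g => /m_inj ->.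
apply: Dm; apply: (factors_ind (Y := D)); last by exists 1; rewrite ?hom1 ?al1 ?mulg1.
move=> x [v vE xE] [] a.
  by exists v => //; rewrite gmulfM alM -mulgA -xE.
exists (mu (r (e a * x)) * ((mu (r x))^-1 * v)).
  by rewrite !gmulfM !homV !agree vE.
rewrite !gmulfM homV !muP mulgA mulVKg alM invgM invgK !mulgA mulgK -!mulgA.
by rewrite -xE.
Qed.
End FreeKernel.

(** * Chief series from finite quotients *)

Lemma cyclic_step_gen (X : groupType) p (M N : set X) : prime p ->
  normal_subgroup M -> central_step p M N -> cyclic_step M N ->
  forall x y, N x -> ~ M x -> N y -> exists c, M ((x ^+ c)^-1 * y).
Proof.
move=> p_pr nM [_ _ pM] [z Nz zP] x y Nx Mx Ny.
have [Q [f [f_onto fM]]] := eqmod_quotient nM.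
have [a /fM fx] : exists a, eqmod M (z ^+ a) x := zP x Nx.
have [b /fM fy] : exists b, eqmod M (z ^+ b) y := zP y Ny.
have fzp : f z ^+ p = 1.
  by rewrite -homX -(hom1 f); apply/esym/fM; rewrite /eqmod invg1 mul1g; apply: pM.
have pa : coprime a p.
  rewrite coprime_sym prime_coprime //; apply/negP => /dvdnP[c aE]; apply: Mx.
  have /fM : f 1 = f x by rewrite -fx homX aE mulnC expgnA fzp expg1n hom1.
  by rewrite /eqmod invg1 mul1g.
have [c ac] := coprime_inverse pa.
exists (c * b)%N; apply/fM; rewrite homX -fx -fy !homX -expgnA mulnA.
by apply: (expg_mod_eq fzp); rewrite -modnMml ac modnMml mul1n.
Qed.

Lemma factor_prime_order (X : groupType) p (M N : set X) : prime p ->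
  normal_subgroup M -> normal_subgroup N -> M `<=` N -> N <> M ->
  (forall x, N x -> M (x ^+ p)) ->
  (forall x y, N x -> ~ M x -> N y -> exists c, M ((x ^+ c)^-1 * y)) ->
  exists Q : groupType, is_factor N M Q /\ ([set: Q] #= `I_p)%card.
Proof.
move=> p_pr nM nN sMN neq_NM expM genM.
have [x [Nx Mx]] : exists x, N x /\ ~ M x.
  apply: contrapT => nox; apply: neq_NM; apply/seteqP; split=> // x Nx.
  by apply: contrapT => Mx; apply: nox; exists x.
have [S [e [e_inj re]]] := subgroup_group (normal_grp nN).
have inN y : N y -> exists t, e t = y by rewrite -re => -[t _ <-]; exists t.
have eN t : N (e t) by rewrite -re; exists t.
have [Q [f [f_onto fM]]] := quotient_group (normal_preim e nM).
exists Q; split.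
  split=> //; exists S, e, f; split=> //.
  by apply/seteqP; split=> t; rewrite /ker /= fM.
have [t et] := inN x Nx; pose u := f t.
have u1 : u <> 1 by move=> /fM; rewrite /= et.
have up : u ^+ p = 1 by rewrite -homX; apply/fM; rewrite /= homX; apply: expM.
have gen v : exists c, v = u ^+ c.
  have [t' _ <-] := f_onto v I; have [c Mc] := genM x (e t') Nx Mx (eN t').
  exists c; have : (e @^-1` M) ((t ^+ c)^-1 * t').
    by rewrite /= gmulfM homV homX et.
  move/fM; rewrite gmulfM homV homX => uc.
  by rewrite -[LHS](mulVKg (f t ^+ c)) uc mulg1.
have [c cP] := choice gen.
have p_gt0 := prime_gt0 p_pr.
have finQ : finite_group Q.
  apply: (@finite_setI _ 'I_p (fun v => Ordinal (ltn_pmod (c v) p_gt0))) => v w _ _.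
  by move=> /(congr1 val) /= /(expg_mod_eq up); rewrite -!cP.
have [F [g [g' gK g'K]]] := finGroup_of finQ.
have oF : #|F| = p.
  rewrite -cardsT -(@nt_prime_order F p (g u)) //; last first.
  - by apply/eqP => gu; apply: u1; apply: (can_inj gK); rewrite gu hom1.
  - by rewrite -homX up hom1.
  rewrite orderE; congr #|pred_of_set _|; apply/setP => v; rewrite finset.in_setT.
  by apply/esym/cycleP; exists (c (g' v)); rewrite -homX -cP g'K.
by rewrite -oF; apply: (card_finGroup (f := g)); exists g'.
Qed.

(** Dropping the repetitions from a chain whose steps have order 1 or [p]. *)
Lemma p_series_of_chain (X : groupType) p n (C : nat -> set X) : prime p ->
  C 0 = [set 1] -> (forall i, (i <= n)%N -> normal_subgroup (C i)) ->
  (forall i, (i < n)%N -> C i `<=` C i.+1) ->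
  (forall i, (i < n)%N -> forall x, C i.+1 x -> C i (x ^+ p)) ->
  (forall i, (i < n)%N -> forall x y, C i.+1 x -> ~ C i x -> C i.+1 y ->
     exists c, C i ((x ^+ c)^-1 * y)) ->
  exists k S, [/\ normal_p_series p (C n) k S,
    forall i, (i <= n)%N -> exists2 i', (i' <= k)%N & S i' = C i &
    forall i', (i' <= k)%N -> exists2 i, (i <= n)%N & S i' = C i].
Proof.
move=> p_pr C0; elim: n => [|n IH] nC sC eC gC.
  exists 0%N, C; split=> [|i le_i|i le_i]; last by exists i.
    by split=> //; rewrite C0.
  by exists i.
have [||||k [S [[S0 Sk nS oS] CS SC]]] := IH.
- by move=> i le_in; apply: nC; apply: leqW.
- by move=> i lt_in; apply: sC; apply: leqW.
- by move=> i lt_in; apply: eC; apply: leqW.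
- by move=> i lt_in; apply: gC; apply: leqW.
have [eqC|neqC] := pselect (C n.+1 = C n).
  exists k, S; split.
  - by rewrite eqC; split.
  - move=> i; rewrite leq_eqVlt => /orP[/eqP ->|]; last exact: CS.
    by rewrite eqC; exists k; rewrite // Sk.
  - by move=> i' /SC[i le_in SE]; exists i; rewrite // leqW.
exists k.+1, (fun i => if (i <= k)%N then S i else C n.+1); split.
- split; rewrite ?ltnn //=.
    by move=> i _; case: (leqP i k) => [/nS|_] //; apply: nC.
  move=> i; rewrite ltnS => le_ik; rewrite le_ik.
  have [lt_ik|ge_ik] := ltnP i k; first exact: oS.
  have -> : i = k by apply/anti_leq; rewrite le_ik.
  rewrite Sk; apply: factor_prime_order => //.
  + exact: nC.
  + exact: nC.
  + exact: sC.
  + exact: eC.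
  + exact: gC.
- move=> i; rewrite leq_eqVlt => /orP[/eqP ->|].
    by exists k.+1; rewrite // ltnn.
  rewrite ltnS => /CS[i' le_i'k SE]; exists i'; first exact: leqW.
  by rewrite le_i'k.
- move=> i' _; case: (leqP i' k) => [/SC[i le_in SE]|_]; last by exists n.+1.
  by exists i; rewrite // leqW.
Qed.

Section ConditionOfQuotient.
Variables (H A B G : groupType).
Variables (iA : {multiplicative H -> A}) (iB : {multiplicative H -> B}).
Variables (jA : {multiplicative A -> G}) (jB : {multiplicative B -> G}).
Variables (p : nat) (M : set G).
Hypothesis p_pr : prime p.
Hypothesis iA_inj : injective iA.
Hypothesis iB_inj : injective iB.
Hypothesis jE : forall h, jA (iA h) = jB (iB h).
Hypothesis nPA : normal_subgroup (pRt A p).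
Hypothesis nPB : normal_subgroup (pRt B p).
Hypothesis pM : finite_pquot p M.
Hypothesis sepA : forall x, pRt A p x -> M (jA x) -> x = 1.
Hypothesis sepB : forall x, pRt B p x -> M (jB x) -> x = 1.

(** Both series are induced by one chief series of the finite [p]-group
    [G / M]. *)
Lemma condition_N_of_quotient : condition_N iA iB p.
Proof.
have [n [Z [[nZ cZ yZ] Z0 Zn]]] := finite_pquot_chain p_pr pM.
have series (X : groupType) (f : {multiplicative X -> G}) :
    normal_subgroup (pRt X p) -> (forall x, pRt X p x -> M (f x) -> x = 1) ->
    exists k S, [/\ normal_p_series p (pRt X p) k S,
      forall i, (i <= n)%N ->
        exists2 i', (i' <= k)%N & S i' = (f @^-1` Z i) `&` pRt X p &
      forall i', (i' <= k)%N ->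
        exists2 i, (i <= n)%N & S i' = (f @^-1` Z i) `&` pRt X p].
  move=> nP sepX.
  have Cn : (f @^-1` Z n) `&` pRt X p = pRt X p by rewrite Zn setTI.
  rewrite -[in X in normal_p_series _ X]Cn.
  apply: (@p_series_of_chain X p n (fun i => (f @^-1` Z i) `&` pRt X p)) => //.
  - apply/seteqP; split=> x /=; rewrite Z0; first by move=> [Mx px]; apply: sepX.
    move=> ->; split; last exact: (sub1 (normal_grp nP)).
    by rewrite hom1; apply: (sub1 (normal_grp _)); case: pM.
  - by move=> i /nZ nZi; apply: normal_setI => //; apply: normal_preim.
  - by move=> i /cZ[sZ _ _] x [/sZ].
  - move=> i /cZ[_ _ pZ] x [Zx px]; split; first by rewrite /= homX; apply: pZ.
    exact: (subX (normal_grp nP)).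
  - move=> i lt_in x y [Zx px] Zx' [Zy py].
    have [|||c Zc] := cyclic_step_gen p_pr (nZ i (ltnW lt_in)) (cZ i lt_in)
      (yZ i lt_in) (x := f x) (y := f y) => //.
      by move=> fx; apply: Zx'.
    exists c; split; first by rewrite /= gmulfM homV homX.
    apply: (subM (normal_grp nP)) => //; apply: (subV (normal_grp nP)).
    exact: (subX (normal_grp nP)).
have [k [S [serS CS SC]]] := series A jA nPA sepA.
have [m [T [serT CT TC]]] := series B jB nPB sepB.
have same i : iA @^-1` ((jA @^-1` Z i) `&` pRt A p) =
              iB @^-1` ((jB @^-1` Z i) `&` pRt B p).
  apply/seteqP; split=> h [/= Zh [e he]]; split; rewrite /= ?jE // -?jE //.
    by exists e; rewrite -homX (iA_inj (etrans (homX _ _ _) (etrans he (esym (hom1 _))))) hom1.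
  by exists e; rewrite -homX (iB_inj (etrans (homX _ _ _) (etrans he (esym (hom1 _))))) hom1.
exists k, S, m, T; split=> //; apply/seteqP; split=> U [i /= le_i <-].
  have [i0 le_i0 ->] := SC _ le_i; have [j le_j Tj] := CT _ le_i0.
  by exists j => //; rewrite Tj same.
have [i0 le_i0 ->] := TC _ le_i; have [j le_j Sj] := CS _ le_i0.
by exists j => //; rewrite Sj same.
Qed.
End ConditionOfQuotient.

(** * Nontriviality of reduced words *)

Lemma alternating_mono (F : bool -> groupType) (P Q : letter F -> Prop) t w e :
  (forall l, P l -> Q l) -> alternating P t w e -> alternating Q t w e.
Proof.
by move=> PQ; elim: w t => [|l w IH] t //= [tl /PQ Ql /IH alt].
Qed.

Lemma quotient_tower (G : groupType) (L M : set G) :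
  normal_subgroup L -> normal_subgroup M -> L `<=` M ->
  exists (X N : groupType) (f : {multiplicative G -> X})
         (s : {multiplicative G -> N}) (r : {multiplicative X -> N}),
  [/\ onto f /\ onto s, onto r, forall g, f g = 1 <-> L g,
      forall g, s g = 1 <-> M g & forall g, r (f g) = s g].
Proof.
move=> nL nM sLM.
have [X [f [f_onto fL]]] := quotient_group nL.
have [N [s [s_onto sM]]] := quotient_group nM.
have fs g g' : f g = f g' -> s g = s g'.
  move=> fg; have /fL/sLM/sM : f (g^-1 * g') = 1.
    by rewrite gmulfM homV fg mulVg.
  by rewrite gmulfM homV => sg; rewrite -[RHS](mulVKg (s g)) sg mulg1.
have /choice[c cP] x : exists g, f g = x by have [g _ <-] := f_onto x I; exists g.
have [|r rE] := @hom_of X N (fun x => s (c x)).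
  by move=> x y; rewrite -gmulfM; apply: fs; rewrite gmulfM !cP.
have rf g : r (f g) = s g by rewrite rE; apply: fs; rewrite cP.
exists X, N, f, s, r; split=> // n _.
by have [g _ <-] := s_onto n I; exists (f g).
Qed.

Section Embedding.
Variables (H G : groupType) (F : bool -> groupType).
Variables (i : forall t, {multiplicative H -> F t}).
Variables (j : forall t, {multiplicative F t -> G}).
Hypothesis G_amalgam : is_amalgam (i true) (i false) (j true) (j false).

(** In the permutational product for arbitrary sections both factors act freely,
    so that its permutation group separates every letter outside [H] from [H]. *)
Lemma permutation_quotient : exists (N : groupType) (s : {multiplicative G -> N}),
  [/\ onto s, forall t x, s (j t x) = 1 -> x = 1 &
      forall l, outside i l -> separated i j s l].
Proof.
have [it_inj if_inj _ _] := G_amalgam.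
have sect t : exists r : F t -> H, equivariant (i t) r.
  have [|||r [r_eq _]] := @equivariant_choice H (F t) (i t) _ (fun=> setT) => //.
  - by case: t.
  - by move=> x; exists 1.
  by exists r.
have [rA rA_eq] := sect true; have [rB rB_eq] := sect false.
have [act [act_act actA actB]] := permutational_product G_amalgam rA_eq rB_eq.
pose Eq (v w : F true * F false) := v = w.
have nK : normal_subgroup (class_kernel act Eq).
  by apply: class_kernel_normal; rewrite /Eq //; congruence.
have [N [s [s_onto sK]]] := quotient_group nK.
have fixj t x y : s (j t x) = s (j t y) -> x = y.
  move=> sxy; have /sK K : s ((j t x)^-1 * j t y) = 1.
    by rewrite gmulfM homV sxy mulVg.
  have := K (1, 1); rewrite -homV -gmulfM /Eq => /esym.
  case: t x y {sxy K} => x y; rewrite ?actA ?actB /= => -[];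
    [move=> + _ | move=> _]; by rewrite mulg1 => /mulg1_eq; rewrite invgK.
exists N, s; split=> // [t x sx|[t x] Ox h sx].
  by apply: (fixj t); rewrite sx !hom1.
apply: Ox; exists h => //=; apply/esym/(fixj t).
by rewrite -(amalgam_compatF G_amalgam true t).
Qed.

Lemma factor_injective t : injective (j t).
Proof.
have [N [s [_ s_inj _]]] := permutation_quotient.
by apply: hom_inj => x jx; apply: (s_inj t); rewrite jx hom1.
Qed.

Lemma reduced_nontrivial t w e : w <> [::] -> alternating (outside i) t w e ->
  word_val j w <> 1.
Proof.
move=> w0 alt w1; have [N [s [s_onto _ s_sep]]] := permutation_quotient.
have [K [nK _ _ _ [_]]] := word_survives G_amalgam s_onto (isT : prime 2) w0
  (alternating_mono s_sep alt).
by case; rewrite w1; apply: (sub1 (normal_grp nK)).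
Qed.

Lemma outsideV t x : outside i (Tagged F (x : F t)) -> outside i (Tagged F x^-1).
Proof.
move=> Ox [h _ ih]; apply: Ox; exists h^-1 => //=.
by rewrite homV ih invgK.
Qed.

(** If elements of orders powers of different primes existed outside [H], then
    they or suitable conjugates would have a nontrivial reduced commutator, which
    dies in all finite nilpotent quotients. *)
Lemma outside_primes (P : nat_pred) p q t t' (x : F t) (y : F t') :
  residually (fin_nilpotent_pi_group P) G -> (forall t, range (i t) <> setT) ->
  prime p -> prime q -> pRt (F t) p x -> pRt (F t') q y ->
  outside i (Tagged F x) -> outside i (Tagged F y) -> p = q.
Proof.
move=> resG neH p_pr q_pr px qy Ox Oy; apply: contrapT => neq_pq.
have comm u v : pRt G p u -> pRt G q v -> [~ u, v] = 1.
  move=> pu qv; apply: contrapT => /resG[K [s [CK s_onto suv]]].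
  have [//|r [M [Pr r_pr pM Muv]]] :=
    finite_nilquot_residual (finite_nilquot_ker s CK) (x := [~ u, v]).
  have nM : normal_subgroup M by case: pM.
  have gM := normal_grp nM; apply: Muv.
  have inM z r' : prime r' -> r' <> r -> pRt G r' z -> M z.
    move=> r'_pr ne [k zk]; apply: (finite_pquot_coprime r_pr pM (m := (r' ^ k)%N)).
      rewrite Euclid_dvdX // negb_and dvdn_prime2 //.
      by apply/orP; left; apply/eqP => /esym.
    by rewrite zk; apply: (sub1 gM).
  have [eq_pr|ne_pr] := pselect (p = r).
    rewrite commgEr; apply: (subM gM); last by apply: inM qv => // eq_qr; apply: neq_pq; rewrite eq_qr.
    apply: normal_conj => //; apply: (subV gM).
    by apply: inM qv => // eq_qr; apply: neq_pq; rewrite eq_qr.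
  have Mu : M u by apply: inM pu.
  by rewrite /commg; apply: (subM gM); [apply: (subV gM) | apply: normal_conj].
have Ox' := outsideV Ox; have Oy' := outsideV Oy.
have [eq_t|ne_t] := eqVneq t t'; last first.
  have tE : t' = ~~ t by move: ne_t; case: (t); case: (t').
  pose w : seq (letter F) := [:: Tagged F x^-1; Tagged F y^-1; Tagged F x; Tagged F y].
  apply: (@reduced_nontrivial t w t) => //.
    by rewrite /w /= !negbK; split=> //; split=> //; split=> //; split.
  by rewrite /w /= /letter_val /= mulg1 !homV; apply: comm; apply: pRt_hom.
subst t'; have [z Oz] : exists z : F (~~ t), outside i (Tagged F z).
  apply: contrapT => noz; apply: (neH (~~ t)); apply/seteqP; split=> // z _.
  by apply: contrapT => Oz; apply: noz; exists z.
have Oz' := outsideV Oz.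
pose w : seq (letter F) := [:: Tagged F x^-1; Tagged F z; Tagged F y^-1;
  Tagged F z^-1; Tagged F x; Tagged F z; Tagged F y; Tagged F z^-1].
apply: (@reduced_nontrivial t w t) => //.
  by rewrite /w /= !negbK; do 8!split=> //.
rewrite /w /= /letter_val /= mulg1 !homV.
have := comm (j t x) (j t y ^ (j (~~ t) z)^-1) (pRt_hom _ px).
rewrite /commg /conjg !invgM !invgK !mulgA; apply.
have [k yk] := pRt_hom (j t) qy; exists k.
by rewrite -mulgA -[X in X * _]invgK -/(conjg _ _) -conjXg yk conj1g.
Qed.
End Embedding.

(** * Residual properties of the amalgam *)

(** If [x ^+ r] lies in [H], so does the part of [x] of order prime to [r], being a
    power of its own [r]-th power; the rest is an [r]-element. *)
Lemma isolated_torsion (H X : groupType) (i : {multiplicative H -> X}) q :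
  periodic H -> (forall r x, prime r -> r <> q -> pRt X r x -> range i x) ->
  isolated' q (range i).
Proof.
move=> tH inH r r_pr ne_rq x [h _ ih].
have gH : subgroup (range i).
  apply/subgroupP; split.
  - by exists 1; rewrite ?hom1.
  - by move=> _ _ [k _ <-] [l _ <-]; exists (k * l); rewrite ?gmulfM.
  - by move=> _ [k _ <-]; exists k^-1; rewrite ?homV.
have tx : torsion X x.
  have [n [n_gt0 hn _]] := tH h.
  have [||d dx _] := @has_orderP X x (r * n)%N; last by exists d.
    by rewrite muln_gt0 prime_gt0.
  by rewrite expgnA -ih -homX hn hom1.
have [e [pe [m rm dm]]] := p_part_elt r_pr tx.
have He := inH _ _ r_pr ne_rq pe.
have [c rc] : exists c, r * c = 1 %[mod m].
  by apply: coprime_inverse; rewrite prime_coprime.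
suff Hd : range i (x^-1 * x ^+ e).
  have := subM gH He (subV gH Hd); rewrite invgM invgK mulgA mulgV mul1g.
  exact.
have cx : commute x^-1 (x ^+ e) by apply/commute_sym/commuteV/commute_sym/commuteX.
have -> : x^-1 * x ^+ e = ((x^-1 * x ^+ e) ^+ r) ^+ c.
  by rewrite -expgnA (expg_mod_eq dm rc).
apply: (subX gH); rewrite expgMn // expVgn; apply: (subM gH).
  by apply: (subV gH); exists h.
exact: (subX gH).
Qed.

Lemma extension_tower (C D : group_class) (X N : groupType)
    (r : {multiplicative X -> N}) :
  onto r -> D N ->
  (forall (M : groupType) (m : {multiplicative M -> X}),
     injective m -> range m = ker r -> C M) ->
  extension C D X.
Proof.
move=> r_onto DN CM.
have [M [m [m_inj rm]]] := subgroup_group (normal_grp (normal_ker r)).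
by exists M, N, m, r; split=> //; apply: CM rm.
Qed.

Section Main.
Variables (H G : groupType) (F : bool -> groupType).
Variables (i : forall t, {multiplicative H -> F t}).
Variables (j : forall t, {multiplicative F t -> G}).
Variable P : nat_pred.
Hypothesis P_prime : {in P, forall p, prime p}.
Hypothesis P_ne : exists p, p \in P.
Hypothesis G_amalgam : is_amalgam (i true) (i false) (j true) (j false).
Hypothesis neH : forall t, range (i t) <> setT.
Hypothesis resF : forall t, residually (fin_nilpotent_pi_group P) (F t).
Hypothesis bF : forall t, onto_injective_on (bounded_nilpotent P) (sgp (torsion (F t))).
Hypothesis H_periodic : periodic H.

Let i_inj t : injective (i t).
Proof. by case: G_amalgam => ? ? _ _; case: t. Qed.

Definition condition_N_all : Prop :=
  forall p, p \in P -> condition_N (i true) (i false) p.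

(** The letters are separated from [H] by finitely many members of the class [Q];
    modulo their intersection [M] the word remains reduced. *)
Lemma refine_word (Q : set (set G)) q t w e :
  (forall M, Q M -> normal_subgroup M) -> Q setT ->
  (forall M N, Q M -> Q N -> Q (M `&` N)) ->
  (forall l, outside i l ->
     exists2 M, Q M & forall h, ~ M ((letter_val j l)^-1 * j true (i true h))) ->
  prime q -> w <> [::] -> alternating (outside i) t w e ->
  exists M K, [/\ Q M, normal_subgroup K, K `<=` M,
    fin_index setT M -> fin_index setT K &
    [/\ forall x, M x -> exists k, K (x ^+ (q ^ k)%N),
       forall t x, M (j t x) -> K (j t x) & ~ K (word_val j w)]].
Proof.
move=> nQ QT QI sepQ q_pr w0 alt.
pose sep M (l : letter F) := forall h, ~ M ((letter_val j l)^-1 * j true (i true h)).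
have [M [QM altM]] : exists M, Q M /\ alternating (sep M) t w e.
  elim: w t alt {w0} => [|l w IH] t /=; first by exists setT.
  move=> [tl Ol /IH[N [QN altN]]]; have [M QM Ml] := sepQ l Ol.
  exists (M `&` N); split; first exact: QI.
  split=> // [h [Mh _]|]; first exact: (Ml h).
  by apply: alternating_mono altN => l' sep_l' h [_ /sep_l'].
have [N [s [s_onto sM]]] := quotient_group (nQ M QM).
have [|K [nK sK fK tK [genK wK]]] := word_survives G_amalgam s_onto q_pr w0
  (e := e) (t := t).
  apply: alternating_mono altM => l sep_l h sl; apply: (sep_l h); apply/sM.
  by rewrite gmulfM homV sl mulVg.
have kM : ker s = M by apply/seteqP; split=> x; rewrite /ker /= sM.
exists M, K; rewrite kM in sK fK; split=> //; split=> // [x /sM|t' x /sM].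
  exact: tK.
exact: genK.
Qed.

Section Sufficiency.
Hypothesis N_all : condition_N_all.

(** The finite [p]-quotients of each factor are recovered from those of [G]. *)
Lemma factor_pquot p t N : p \in P -> finite_pquot p N ->
  exists2 M, finite_pquot p M & forall x : F t, M (j t x) -> N x.
Proof.
move=> Pp; have p_pr := P_prime Pp.
have amP NA NB := @amalgam_pquot _ _ _ _ p _ _ _ _ NA NB G_amalgam p_pr H_periodic
  (pRt_normal P_prime (bF true) Pp) (pRt_normal P_prime (bF false) Pp)
  (pRt_separated P_prime (bF true) Pp) (pRt_separated P_prime (bF false) Pp)
  (N_all Pp).
case: t N => N pN.
  by have [M [pM MN _]] := amP N setT pN (finite_pquotT _ p); exists M.
by have [M [pM _ MN]] := amP setT N (finite_pquotT _ p) pN; exists M.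
Qed.

Lemma letter_pquot p t (x : F t) N : p \in P -> finite_pquot p N ->
  (forall h, ~ N (x^-1 * i t h)) ->
  exists2 M, finite_pquot p M & forall h, ~ M ((j t x)^-1 * j true (i true h)).
Proof.
move=> Pp pN Nx; have [M pM MN] := factor_pquot Pp pN.
exists M => // h; rewrite (amalgam_compatF G_amalgam true t) -homV -gmulfM.
by move=> /MN; apply: Nx.
Qed.

Lemma amalgamated_pquot h : i true h <> 1 ->
  exists p M, [/\ p \in P, finite_pquot p M & ~ M (j true (i true h))].
Proof.
move=> /(residual_p (@resF true))[p [N [Pp pN Nh]]].
have [M pM MN] := factor_pquot Pp pN.
by exists p, M; split=> // /MN.
Qed.

(** Separating letters by [q]-quotients makes [M] and then [K] the kernel of a finite
    [q]-quotient. *)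
Lemma residually_of_separable q : q \in P ->
  (forall t, separable (fin_p_group q) (range (i t))) ->
  residually (fin_nilpotent_pi_group P) G.
Proof.
move=> Pq sepq g g1; have q_pr := P_prime Pq.
suff [p [M [Pp pM Mg]]] : exists p M, [/\ p \in P, finite_pquot p M & ~ M g].
  have [K [f [CK f_onto fM]]] := finite_nilquot_group
    (finite_pquot_nil (P_prime Pp) Pp pM).
  by exists K, f; split=> // /fM.
have [[h gE]|[t [w [e [w0 alt gE]]]]] := reducedP G_amalgam g; rewrite gE.
  by apply: amalgamated_pquot => ih; apply: g1; rewrite gE ih hom1.
have [||||M [K [pM nK sKM fK [tK _ wK]]]] := refine_word (Q := finite_pquot q)
  _ _ _ _ q_pr w0 alt.
- by move=> M [].
- exact: finite_pquotT.
- exact: finite_pquotI.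
- move=> [s x] /= Ox; have [L [f [CL f_onto fx]]] := sepq s x Ox.
  apply: (letter_pquot Pq (finite_pquot_ker f q_pr CL)) => h.
  rewrite /ker /= gmulfM homV => /mulg1_eq; rewrite invgK => fE.
  by apply: fx; exists (i s h); [exists h | rewrite fE].
exists q, K; split=> //; case: pM => nM fM tM; split=> // [|x]; first exact: fK.
have [k /tK[l Kx]] := tM x; exists (k + l)%N.
by rewrite expnD expgnA.
Qed.

(** In general the letters are separated from [H] with different primes, and [M]
    is only nilpotent; the passage from [M] to [K] adds an arbitrary prime [q]. *)
Lemma refine_nilquot g q : g <> 1 -> prime q ->
  exists M K, [/\ finite_nilquot P M, normal_subgroup K, K `<=` M,
    fin_index setT K &
    [/\ forall x, M x -> exists k, K (x ^+ (q ^ k)%N),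
       forall t x, M (j t x) -> K (j t x) & ~ K g]].
Proof.
move=> g1 q_pr.
have [[h gE]|[t [w [e [w0 alt gE]]]]] := reducedP G_amalgam g; rewrite gE.
  have [|p [M [Pp pM Mh]]] := @amalgamated_pquot h.
    by move=> ih; apply: g1; rewrite gE ih hom1.
  exists M, M; have [nM fM _] := pM; split=> //; first exact: finite_pquot_nil (P_prime Pp) Pp pM.
  by split=> // x Mx; exists 0%N.
have [||||M [K [pM nK sKM fK refK]]] := refine_word (Q := finite_nilquot P)
  _ _ _ _ q_pr w0 alt.
- by move=> M [].
- by have [p Pp] := P_ne; apply: (finite_pquot_nil (P_prime Pp) Pp); apply: finite_pquotT.
- exact: finite_nilquotI.
- move=> [s x] /= Ox.
  have [p [N [Pp pN Nx]]] := separated_prime P_prime P_ne (@i_inj s)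
    H_periodic (@resF s) (bF s) Ox.
  have [M pM Mx] := letter_pquot Pp pN Nx; exists M => //; exact: finite_pquot_nil (P_prime Pp) Pp pM.
exists M, K; split=> //; apply: fK; by case: pM.
Qed.

(** The factors meet [M] and [K] in the same subgroups. Killing only these leaves
    [g] nontrivial, as they lie in [K], and the image of [M] is free. *)
Lemma residually_free :
  residually (extension free_group (fin_nilpotent_pi_group P)) G.
Proof.
move=> g g1; have [M [K [nilM nK sKM _ [_ genK Kg]]]] := refine_nilquot g1 (isT : prime 2).
have nM : normal_subgroup M by case: nilM.
have [N [s [s_onto sM]]] := quotient_group nM.
pose L := smallest (@normal_subgroup G) (factor_kernels j s).
have sLK : L `<=` K.
  move=> x; apply; split=> // y [/sM My [t [a yE]]].
  by rewrite yE in My *; apply: genK.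
have [X [N' [f [s' [r [[f_onto s'_onto] r_onto fL s'M rf]]]]]] :=
  quotient_tower (smallest_normal (factor_kernels j s)) nM
    (subset_trans sLK sKM).
exists X, f; split=> //; last by move=> /fL/sLK.
have ssL : factor_kernels j s = factor_kernels j s'.
  by apply/seteqP; split=> x [sx jx]; split=> //; [apply/s'M/sM | apply/sM/s'M].
rewrite ssL in fL.
apply: (extension_tower r_onto (finite_nilquot_image s'_onto s'M nilM)).
by move=> Y m; apply: (kernel_free G_amalgam s'_onto f_onto fL rf).
Qed.

(** Modulo [K] the image of [M] is a finite [q]-group. *)
Lemma residually_q q : prime q ->
  residually (extension (fin_p_group q) (fin_nilpotent_pi_group P)) G.
Proof.
move=> q_pr g g1; have [M [K [nilM nK sKM fK [tK _ Kg]]]] := refine_nilquot g1 q_pr.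
have nM : normal_subgroup M by case: nilM.
have [X [N [f [s [r [[f_onto s_onto] r_onto fE sM rf]]]]]] := quotient_tower nK nM sKM.
exists X, f; split=> //; last by move=> /fE.
apply: (extension_tower r_onto (finite_nilquot_image s_onto sM nilM)).
move=> Y m m_inj rm; split.
  have [J [c cP]] := finite_colour (fin_index_finite f_onto fE fK).
  by apply: (@finite_setI _ _ (c \o m)) => x y _ _ /cP/m_inj; apply.
apply/pi_groupP => y; have : ker r (m y) by rewrite -rm; exists y.
have [x _ fx] := f_onto (m y) I; rewrite /ker /= -fx rf => /sM/tK[k /fE].
rewrite homX fx -homX -[X in _ = X](hom1 m) => /m_inj yk.
by exists (q ^ k)%N; rewrite // pnatX pnat_id.
Qed.
End Sufficiency.

(** The finitely many [p]-elements of the factors survive in one finite [p]-quotient,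
    since a [p]-element dies in the finite [r]-quotients for all other primes [r]. *)
Lemma condition_N_of_residual p : p \in P ->
  (forall x, pRt G p x -> x <> 1 -> exists2 N, finite_nilquot P N & ~ N x) ->
  condition_N (i true) (i false) p.
Proof.
move=> Pp resp; have p_pr := P_prime Pp.
have [it_inj if_inj _ _] := G_amalgam.
have sepF t : exists N, finite_pquot p N /\
    forall x : F t, pRt (F t) p x -> N (j t x) -> x = 1.
  have [||N pN Nbad] := @finite_pquot_avoid G p (F t) (pRt (F t) p `\ 1) (j t).
  - exact/finite_setD/(pRt_finite P_prime (bF t) Pp).
  - move=> x [px x1]; have [||N nilN Nx] := resp (j t x); first exact: pRt_hom.
      by move=> jx; apply: x1; apply: (factor_injective G_amalgam); rewrite jx hom1.
    have [p' [M [_ p'_pr pM Mx]]] := finite_nilquot_residual nilN Nx.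
    have [eq_p|/eqP neq_p] := eqVneq p' p.
      by subst p'; exists M.
    case: Mx; have [k xk] := px.
    apply: (finite_pquot_coprime p'_pr pM (m := (p ^ k)%N)).
      by rewrite Euclid_dvdX // negb_and dvdn_prime2 //; apply/orP; left; apply/eqP.
    by rewrite -homX xk hom1; apply: (sub1 (normal_grp _)); case: pM.
  exists N; split=> // x px Nx; apply: contrapT => x1.
  exact: (Nbad x).
have [M [pM sepM]] := sepF true; have [N [pN sepN]] := sepF false.
apply: (condition_N_of_quotient p_pr it_inj if_inj (amalgam_compat G_amalgam)
  (pRt_normal P_prime (bF true) Pp) (pRt_normal P_prime (bF false) Pp)
  (finite_pquotI pM pN)) => x px [Mx Nx]; [exact: sepM | exact: sepN].
Qed.

Lemma condition_N_necessary :
  residually (fin_nilpotent_pi_group P) G -> condition_N_all.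
Proof.
move=> resG p Pp; apply: condition_N_of_residual => // x _ /resG[K [s [CK _ sx]]].
by exists (ker s); [apply: finite_nilquot_ker | move=> kx; apply: sx].
Qed.

(** For [q] different from [p], a [p]-element cannot lie in the normal [q]-subgroup
    of the extension, so it survives in the nilpotent quotient. *)
Lemma condition_N_of_extensions :
  (forall q, prime q ->
     residually (extension (fin_p_group q) (fin_nilpotent_pi_group P)) G) ->
  condition_N_all.
Proof.
move=> resG p Pp; have p_pr := P_prime Pp.
apply: condition_N_of_residual => // x [k xk] x1.
have [q q_pr neq_pq] : exists2 q, prime q & p != q.
  by have [->|] := eqVneq p 2; [exists 3 | exists 2].
have [E [s [[K [Q [m [f [m_inj _ rm [_ /pi_groupP qK] CQ]]]]] _ sx]]] := resG q q_pr x x1.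
have [h hE] := hom_comp f s; exists (ker h); first exact: finite_nilquot_ker.
rewrite /ker /= hE /= => fsx; apply: sx.
have [y _ my] : range m (s x) by rewrite rm.
have [_ /p_natP[l ->] yl] := qK y.
apply: (@coprime_expg E (s x) (p ^ k) (q ^ l)).
- by apply: coprimeXl; apply: coprimeXr; rewrite prime_coprime // dvdn_prime2.
- by rewrite expn_gt0 prime_gt0.
- by rewrite -homX xk hom1.
- by rewrite -my -homX yl hom1.
Qed.

(** All elements of prime power order outside [H] belong to one prime, which is in
    [P] because the factors are residually finite [P]-groups. *)
Lemma isolated_prime : residually (fin_nilpotent_pi_group P) G ->
  exists2 q, q \in P & forall t, isolated' q (range (i t)).
Proof.
move=> resG.
have [[r [t [x [r_pr rx Ox]]]]|inside] := pselect (exists r t (x : F t),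
    [/\ prime r, pRt (F t) r x & outside i (Tagged F x)]); last first.
  have [q Pq] := P_ne; exists q => // t; apply: isolated_torsion => // r x r_pr _ rx.
  by apply: contrapT => Ox; apply: inside; exists r, t, x.
have Pr : r \in P.
  have [|p [N [Pp pN Nx]]] := residual_p (@resF t) (x := x).
    by move=> x1; apply: Ox; exists 1; rewrite //= x1 hom1.
  have [<- //|/eqP neq_pr] := eqVneq p r.
  case: Nx; have [k xk] := rx.
  apply: (finite_pquot_coprime (P_prime Pp) pN (m := (r ^ k)%N)).
    rewrite Euclid_dvdX ?(P_prime Pp) // negb_and dvdn_prime2 ?(P_prime Pp) //.
    by apply/orP; left; apply/eqP.
  by rewrite xk; apply: (sub1 (normal_grp _)); case: pN.
exists r => // t'; apply: isolated_torsion => // r' y r'_pr neq_r'r r'y.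
apply: contrapT => Oy; apply: neq_r'r.
exact: (outside_primes G_amalgam resG neH r'_pr r_pr r'y rx Oy Ox).
Qed.
End Main.

Theorem theorem4 (H A B G : groupType)
    (iA : {multiplicative H -> A}) (iB : {multiplicative H -> B})
    (jA : {multiplicative A -> G}) (jB : {multiplicative B -> G})
    (P : nat_pred)
    (P_prime : {in P, forall p, prime p})
    (G_amalgam : is_amalgam iA iB jA jB)
    (star : condition_star iA iB P)
    (H_periodic : periodic H)
    (A_bounded : onto_injective_on (bounded_nilpotent P) (sgp (torsion A)))
    (B_bounded : onto_injective_on (bounded_nilpotent P) (sgp (torsion B))) :
  (forall p, p \in P ->
     (finite_set (pRt A p) /\ normal_subgroup (pRt A p)) /\
     (finite_set (pRt B p) /\ normal_subgroup (pRt B p))) /\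
  (separable (fin_nilpotent_pi_group P) (range iA) /\
   separable (fin_nilpotent_pi_group P) (range iB)) /\
  ((exists2 q, q \in P & separable (fin_p_group q) (range iA) /\
                         separable (fin_p_group q) (range iB)) ->
   (forall p, p \in P -> condition_N iA iB p) ->
   residually (fin_nilpotent_pi_group P) G) /\
  (residually (fin_nilpotent_pi_group P) G ->
   (exists2 q, q \in P & isolated' q (range iA) /\ isolated' q (range iB)) /\
   (forall p, p \in P -> condition_N iA iB p)) /\
  ((residually (extension free_group (fin_nilpotent_pi_group P)) G /\
    (forall q, prime q ->
       residually (extension (fin_p_group q) (fin_nilpotent_pi_group P)) G)) <->
   (forall p, p \in P -> condition_N iA iB p)).
Proof.
have [[neA neB] P_ne [resA resB] _] := star.
have [iA_inj iB_inj _ _] := G_amalgam.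
pose F (t : bool) : groupType := if t then A else B.
pose i t : {multiplicative H -> F t} :=
  match t return {multiplicative H -> F t} with true => iA | false => iB end.
pose j t : {multiplicative F t -> G} :=
  match t return {multiplicative F t -> G} with true => jA | false => jB end.
have G_am : is_amalgam (i true) (i false) (j true) (j false) by [].
have neH t : range (i t) <> setT by case: t.
have resF t : residually (fin_nilpotent_pi_group P) (F t) by case: t.
have bF t : onto_injective_on (bounded_nilpotent P) (sgp (torsion (F t))) by case: t.
split; last split; last split; last split; last split.
- by move=> p Pp; split; split;
    [exact: pRt_finite Pp | exact: pRt_normal Pp
    |exact: pRt_finite Pp | exact: pRt_normal Pp].
- by split; apply: separable_factor.
- move=> [q Pq [sepA sepB]] N_all.
  by apply: (residually_of_separable P_prime G_am resF bF H_periodic N_all Pq); case.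
- move=> resG; split; last exact: (condition_N_necessary P_prime G_am bF resG).
  have [q Pq iso] := isolated_prime P_prime P_ne G_am neH resF H_periodic resG.
  by exists q => //; split; [exact: (iso true) | exact: (iso false)].
- move=> [_ resq]; exact: (condition_N_of_extensions P_prime G_am bF resq).
- move=> N_all; split=> [|q].
    exact: (residually_free P_prime P_ne G_am resF bF H_periodic N_all).
  exact: (residually_q P_prime P_ne G_am resF bF H_periodic N_all).
Qed.
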